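(* Let $n\ge1$ and let $\mu,\nu$ be partitions with $\ell(\mu)+\ell(\nu)\le2n$. Then $$\int P^{(2n)}_{\mu\bar\nu}(q^{\pm1/4}z_1,\dots,q^{\pm1/4}z_n;q,t)\prod_{1\le i<j\le n}\frac{((z_i/z_j)^{\pm1};q^{1/2})}{(t(z_i/z_j)^{\pm1};q^{1/2})}\,dT=0$$ unless $\mu=\nu$.
   Context: Notation. $(a;q)=\prod_{k\ge0}(1-aq^k)$; $((z_i/z_j)^{\pm1};q)=(z_i/z_j;q)(z_j/z_i;q)$, and similarly with a scalar prefactor. The parameters $q,t$ are generic (analytically, complex with $|q|,|t|<1$, with a fixed fourth root $q^{1/4}$ and $q^{1/2}=(q^{1/4})^2$). $dT$ is Haar measure on the unit torus $|z_1|=\dots=|z_n|=1$. For a nonincreasing integer vector $\lambda\in\mathbb Z^{N}$, $P_\lambda^{(N)}(x_1,\dots,x_N;q,t)$ is the symmetric Macdonald (Laurent) polynomial of type $A$: $P^{(N)}_\lambda=(x_1\cdots x_N)^{\lambda_N}P^{(N)}_{(\lambda_1-\lambda_N,\dots,\lambda_N-\lambda_N)}$ with the usual monic Macdonald polynomial on the right. For partitions $\mu,\nu$ with $\ell(\mu)+\ell(\nu)\le N$, $\mu\bar\nu$ is the vector $(\mu_1,\mu_2,\dots,0,\dots,0,\dots,-\nu_2,-\nu_1)$ of length $N$. The arguments $q^{\pm1/4}z_1,\dots,q^{\pm1/4}z_n$ are the $2n$ values $q^{1/4}z_1,q^{-1/4}z_1,\dots,q^{1/4}z_n,q^{-1/4}z_n$.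 *)

(* Defs.v *)
From mathcomp Require Import all_boot all_order all_algebra.
From mathcomp Require Import all_classical all_reals all_analysis.
From mathcomp Require Import complex.
From mathcomp Require Import -(notations) mpoly.

Set Implicit Arguments.
Unset Strict Implicit.
Unset Printing Implicit Defensive.

Import Order.TTheory GRing.Theory Num.Theory.
Import numFieldNormedType.Exports.

Local Open Scope classical_set_scope.
Local Open Scope ring_scope.
Local Open Scope complex_scope.

(* The point exp(2 pi i theta) of the unit circle. *)
Definition circle_point (R : realType) (theta : R) : R[i] :=
  cos (2 * pi * theta) +i* sin (2 * pi * theta).

(* Integral of a complex-valued function over the unit circle, for the Haar
   measure of total mass 1. *)
Definition circle_integral (R : realType) (f : R[i] -> R[i]) : R[i] :=
  (\int[@lebesgue_measure R]_(theta in `[0, 1]) complex.Re (f (circle_point theta))) +i*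
  (\int[@lebesgue_measure R]_(theta in `[0, 1]) complex.Im (f (circle_point theta))).

(* Integral over |z_1| = ... = |z_n| = 1 for Haar measure, written as an
   iterated integral; by Fubini this is the integral for the product measure
   when f is continuous on the torus, which is the only case used below. *)
Fixpoint torus_integral (R : realType) (n : nat) :
    (n.-tuple R[i] -> R[i]) -> R[i] :=
  match n with
  | 0 => fun f => f [tuple]
  | m.+1 => fun f =>
      circle_integral (fun z1 => torus_integral (fun z => f (cons_tuple z1 z)))
  end.

(* (a; q) = prod_(k >= 0) (1 - a q^k), the limit of the partial products being
   taken on real and imaginary parts; it converges for |q| < 1. *)
Definition qpoch (R : realType) (a q : R[i]) : R[i] :=
  limn (fun m : nat => complex.Re (\prod_(k < m) (1 - a * q ^+ k))) +i*
  limn (fun m : nat => complex.Im (\prod_(k < m) (1 - a * q ^+ k))).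

(* prod_(i < j) ((z_i/z_j)^{+-1}; q) / (t (z_i/z_j)^{+-1}; q) *)
Definition macdonald_density (R : realType) (q t : R[i]) (n : nat)
    (z : n.-tuple R[i]) : R[i] :=
  \prod_(i < n) \prod_(j < n | (i < j)%N)
    (let u := tnth z i / tnth z j in
     (qpoch u q * qpoch u^-1 q) / (qpoch (t * u) q * qpoch (t * u^-1) q)).

(* Macdonald's scalar product on polynomials in N variables. It is bilinear:
   the coefficients of g are not conjugated, only the variables are inverted. *)
Definition torus_product (R : realType) (q t : R[i]) (N : nat)
    (f g : mpoly N R[i]) : R[i] :=
  torus_integral (fun z : N.-tuple R[i] =>
    meval (tnth z) f * meval (fun i => (tnth z i)^-1) g
    * macdonald_density q t z).

(* Partitions with at most N parts, as exponent vectors. *)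
Definition is_partition_vec (N : nat) (kappa : multinom N) : Prop :=
  forall i j : 'I_N, (i <= j)%N -> (kappa j <= kappa i)%N.

Definition dominated (N : nat) (kappa lambda : multinom N) : Prop :=
  mdeg kappa = mdeg lambda /\
  forall k : nat, (\sum_(i < N | (i < k)%N) kappa i <=
                   \sum_(i < N | (i < k)%N) lambda i)%N.

(* m_kappa: one monomial for each distinct rearrangement of kappa. *)
Definition monomial_sym (C : comNzRingType) (N : nat) (kappa : multinom N) :
    mpoly N C :=
  \sum_(s <- permutations (val kappa))
    mpolyX C (Multinom [tuple nth 0%N s i | i < N]).

(* P = P_lambda^(N)(x_1, ..., x_N; q, t) for a partition lambda:
   P = m_lambda + sum_(kappa < lambda) c_kappa m_kappa (dominance order), and P
   is orthogonal to m_kappa for every kappa < lambda. *)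
Definition is_macdonald (R : realType) (q t : R[i]) (N : nat)
    (lambda : multinom N) (P : mpoly N R[i]) : Prop :=
  [/\ P \is @mpoly.symmetric N R[i],
      mcoeff lambda P = 1,
      forall kappa, is_partition_vec kappa -> mcoeff kappa P != 0 ->
        dominated kappa lambda
    & forall kappa, is_partition_vec kappa -> dominated kappa lambda ->
        kappa <> lambda -> torus_product q t P (monomial_sym R[i] kappa) = 0].

Definition last_part (N : nat) (lambda : N.-tuple int) : int := last 0 lambda.

(* (lambda_1 - lambda_N, ..., lambda_N - lambda_N), whose entries are
   nonnegative when lambda is nonincreasing. *)
Definition shifted_vec (N : nat) (lambda : N.-tuple int) : multinom N :=
  Multinom [tuple absz (tnth lambda i - last_part lambda)%R | i < N].

(* F is the Laurent polynomial function P_lambda^(N)(.; q, t) of a nonincreasing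
   integer vector lambda, on arguments with nonzero coordinates. *)
Definition is_laurent_macdonald (R : realType) (q t : R[i]) (N : nat)
    (lambda : N.-tuple int) (F : ('I_N -> R[i]) -> R[i]) : Prop :=
  exists2 P : mpoly N R[i],
    is_macdonald q t (shifted_vec lambda) P
  & forall x : 'I_N -> R[i], (forall i, x i != 0) ->
      F x = (\prod_(i < N) x i) ^ last_part lambda * meval x P.

(* Partitions are finite nonincreasing sequences of positive parts, so that the
   length is the size of the sequence. *)
Definition is_partition (mu : seq nat) : bool :=
  sorted geq mu && all (leq 1) mu.

(* (mu_1, mu_2, ..., 0, ..., 0, ..., - nu_2, - nu_1); when
   size mu + size nu <= N at most one of the two terms is nonzero. *)
Definition mubar (N : nat) (mu nu : seq nat) : N.-tuple int :=
  [tuple (nth 0%N mu i)%:Z - (nth 0%N nu (N - i.+1))%:Z | i < N].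

(* The 2n values r z_1, r^-1 z_1, ..., r z_n, r^-1 z_n. *)
Definition doubled_args (R : realType) (r : R[i]) (n : nat)
    (z : n.-tuple R[i]) : 'I_(2 * n) -> R[i] :=
  fun i => (if odd i then r^-1 else r) * nth 0 z i./2.

(* Genericity of the parameters: algebraic independence over the rationals. *)
Definition generic (R : realType) (q t : R[i]) : Prop :=
  forall p : mpoly 2 rat, p != 0 ->
    meval (tnth [tuple q; t]) (map_mpoly ratr p) != 0.

(* Main.v *)
(** Let [D] be Macdonald's first difference operator in N = 2n variables. Writing
    [I f] for the integral of [f] at the doubled arguments against the density,
    [I (D f)] splits into one term for each way of shifting an argument
    [r^{+-1} z_i]. Shifting the contour [z_i -> z_i / r^2] turns the shifts of
    [r z_i] into integrals that are invariant under [z -> 1/z] term by term, and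
    those of [r^-1 z_i] into a single integral whose kernel is invariant under
    [z -> 1/z] by an identity between rational functions (Lagrange interpolation).
    Hence [I (D f) = I (D f')] with [f' x = f (1/x)], whereas [I f = I f'].

    The Macdonald polynomial is an eigenfunction of [D], and of the operator with
    parameters [1/q], [1/t] which describes [D] on [f']. Comparing the eigenvalues,
    [I f <> 0] forces [mu] and [nu] to be equal because [q] and [t] are
    algebraically independent.

    The polynomial is defined by orthogonality for the torus scalar product, for
    which [D] is self-adjoint and triangular; that [P] is an eigenfunction then
    needs the scalar product to be nondegenerate on symmetric polynomials of lower
    weight. An eigenvector of norm 0 would be orthogonal to all symmetric
    polynomials, and so would its products with powers of [x_1 ... x_N]; this is
    impossible since the density is an invertible function times
    [V(z) V(1/z)], where [V] is the Vandermonde product. *)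

Require Import Defs.
From mathcomp Require Import all_boot all_order all_algebra.
From mathcomp Require Import all_classical all_reals all_analysis.
From mathcomp Require Import complex.
From mathcomp Require Import -(notations) mpoly.
From mathcomp Require Import fingroup perm.
From mathcomp Require Import ring lra zify.

Set Implicit Arguments.
Unset Strict Implicit.
Unset Printing Implicit Defensive.

Import Order.TTheory GRing.Theory Num.Theory.
Import numFieldNormedType.Exports.

Local Open Scope classical_set_scope.
Local Open Scope ring_scope.
Local Open Scope complex_scope.

(** The density has base [r ^+ 2], whereas the operator shifts by [q = r ^+ 4]; this mismatch
    dictates the contour shift. Shifting [r z_i] gives the pair [r^5 z_i, r^-1 z_i], which
    [z_i -> z_i / r^2] centres at [r^3 z_i, r^-3 z_i]. Shifting [r^-1 z_i] gives [r z_i, r^3 z_i],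
    which the same substitution turns into [r^-1 z_i, r z_i], the original pair swapped. Terms of
    the second kind therefore share the factor [f(r^{+-1} z)] and only the sum of their coefficients
    has to be invariant. The coefficients of [D] have poles on the torus, which are cancelled
    against zeros of the density before any contour moves. With [lambda] the vector built from [mu]
    and [nu], the final comparison is between [sum_i t^{N-i} q^{lambda_i}] and
    [sum_i t^{N-i} q^{-lambda_{N+1-i}}]; it forces [lambda_i = - lambda_{N+1-i}], that is [mu = nu].
    The eigenvalue equation at [1/q, 1/t] is not deduced from the one at [q, t]: each follows from
    self-adjointness of its own operator. The eigenvectors of [D] at [q, t] are constructed
    beforehand, by triangularity alone, and serve to prove that the scalar product is
    nondegenerate. *)

Section ComplexParts.
Variable R : realType.
Implicit Types x y : R[i].

Lemma ReD x y : complex.Re (x + y) = complex.Re x + complex.Re y.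
Proof. by case: x y => a b [c d]. Qed.

Lemma ImD x y : complex.Im (x + y) = complex.Im x + complex.Im y.
Proof. by case: x y => a b [c d]. Qed.

Lemma ReB x y : complex.Re (x - y) = complex.Re x - complex.Re y.
Proof. by case: x y => a b [c d]. Qed.

Lemma ImB x y : complex.Im (x - y) = complex.Im x - complex.Im y.
Proof. by case: x y => a b [c d]. Qed.

Lemma ReM x y : complex.Re (x * y) =
  complex.Re x * complex.Re y - complex.Im x * complex.Im y.
Proof. by case: x y => a b [c d]. Qed.

Lemma ImM x y : complex.Im (x * y) =
  complex.Re x * complex.Im y + complex.Im x * complex.Re y.
Proof. by case: x y => a b [c d]. Qed.

Lemma le_Re_norm x (e : R) : `|x| <= e%:C -> `|complex.Re x| <= e.
Proof. by move=> h; rewrite -lecR; apply: le_trans h; exact: normc_ge_Re. Qed.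

Lemma le_Im_norm x (e : R) : `|x| <= e%:C -> `|complex.Im x| <= e.
Proof.
move=> h; rewrite -normrN -ReiNIm; apply: le_Re_norm.
by rewrite normrM (_ : `|'i%C| = 1 :> R[i]) ?mulr1 // normc_def /= expr0n expr1n add0r sqrtr1.
Qed.

Lemma normc_le_ReIm x (e d : R) : `|complex.Re x| <= e -> `|complex.Im x| <= d ->
  `|x| <= (e + d)%:C.
Proof.
move=> h1 h2; rewrite [x]complexE; apply: le_trans (ler_normD _ _) _.
rewrite normrM !normc_def /= !expr0n expr1n /= !addr0 add0r sqrtr1 mul1r !sqrtr_sqr.
by rewrite -rmorphD lecR lerD.
Qed.

Lemma normc_eq_Re x : `|x| = (complex.Re `|x|)%:C.
Proof. by rewrite normc_def. Qed.

Lemma cvg_ReIm_prod (u : nat -> R[i]) (L : R[i]) (d : nat -> R) :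
  d @ \oo --> (0 : R) -> (forall m, `|u m - L| <= (d m)%:C) ->
  limn (fun m => complex.Re (u m)) +i* limn (fun m => complex.Im (u m)) = L.
Proof.
move=> d0 uL.
have key (v : nat -> R) (l : R) : (forall m, `|v m - l| <= d m) -> limn v = l.
  move=> h; apply: cvg_lim => //; apply/subr_cvg0/norm_cvg0P.
  apply: squeeze_cvgr (cvg_cst 0) d0.
  by apply: nearW => m; rewrite normr_ge0 h.
rewrite [RHS]complexE (key _ (complex.Re L)) ?(key _ (complex.Im L)).
- by rewrite {1}[_ +i* _]complexE.
- by move=> m; rewrite -ImB; apply: le_Im_norm.
- by move=> m; rewrite -ReB; apply: le_Re_norm.
Qed.

End ComplexParts.

(** * Integration over the unit circle *)

Section CircleIntegral.
Variable R : realType.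
Local Notation C := R[i].
Local Notation mu := (@lebesgue_measure R).
Implicit Types (theta : R) (g : R -> R).

Lemma circle_pointD (a b : R) :
  circle_point (a + b) = circle_point a * circle_point b.
Proof.
rewrite /circle_point !mulrDr cosD sinD; simpc.
by congr (_ +i* _); ring.
Qed.

Lemma circle_point0 : circle_point (0 : R) = 1.
Proof. by rewrite /circle_point mulr0 cos0 sin0. Qed.

Lemma norm_circle_point theta : `|circle_point theta| = 1.
Proof. by rewrite normc_def /= cos2Dsin2 sqrtr1. Qed.

Lemma circle_point_neq0 theta : circle_point theta != 0.
Proof. by rewrite -normr_eq0 norm_circle_point oner_eq0. Qed.

Lemma circle_pointX theta (n : nat) :
  circle_point theta ^+ n = circle_point (n%:R * theta).
Proof.
elim: n => [|n IH]; first by rewrite mul0r circle_point0.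
by rewrite exprS IH -circle_pointD -[n.+1]add1n natrD; congr circle_point; ring.
Qed.

Lemma circle_pointXz theta (k : int) :
  circle_point theta ^ k = circle_point (k%:~R * theta).
Proof.
case: k => n; first exact: circle_pointX.
rewrite -[LHS]/(circle_point theta ^- n.+1) -exprVn.
rewrite (_ : (circle_point theta)^-1 = circle_point (- theta)); last first.
  apply: (mulfI (circle_point_neq0 theta)).
  by rewrite mulfV ?circle_point_neq0 // -circle_pointD subrr circle_point0.
by rewrite circle_pointX mulrN NegzE mulrNz mulNr.
Qed.

Let integrable01 g : continuous g -> mu.-integrable `[0, 1] (EFin \o g).
Proof.
move=> cg; apply: continuous_compact_integrable; first exact: segment_compact.
exact: continuous_subspaceT.
Qed.

Let lebesgue01 : fine (mu `[0, 1]) = 1.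
Proof. by rewrite lebesgue_measure_itv /= lte_fin ltr01 -EFinD subr0. Qed.

Let cts_cos (w : R) : continuous (fun x : R => cos (w * x)).
Proof.
by move=> x; apply: (@continuous_comp _ _ _ (fun x => w * x));
  [exact: mulrl_continuous|exact: continuous_cos].
Qed.

Let cts_sin (w : R) : continuous (fun x : R => sin (w * x)).
Proof.
by move=> x; apply: (@continuous_comp _ _ _ (fun x => w * x));
  [exact: mulrl_continuous|exact: continuous_sin].
Qed.

Lemma cos_sin_int2pi (k : int) : cos (2 * pi * k%:~R) = 1 :> R /\
  sin (2 * pi * k%:~R) = 0 :> R.
Proof.
have h : circle_point (k%:~R : R) = 1.
  have h1 : circle_point (1 : R) = 1.
    by rewrite /circle_point mulr1 mulr_natl cos2pi sin2pi.
  by rewrite -[k%:~R]mulr1 -circle_pointXz h1 exp1rz.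
by move: h => [].
Qed.

Let integral_FTC (f F : R -> R) : continuous f ->
  (forall x : R, is_derive x 1 F (f x)) ->
  \int[mu]_(x in `[0, 1]) f x = F 1 - F 0.
Proof.
move=> cf dF.
have cF : continuous F.
  by move=> x; apply: differentiable_continuous; apply/derivable1_diffP; case: (dF x).
rewrite /Rintegral (@continuous_FTC2 _ f F) //.
- exact: continuous_subspaceT.
- split => [x _||]; first by case: (dF x).
  + exact/cvg_at_right_filter/cF.
  + exact/cvg_at_left_filter/cF.
- by move=> x _; rewrite derive1E; exact: derive_val.
Qed.

Lemma integral_cos_int (k : int) :
  \int[mu]_(x in `[0, 1]) cos (2 * pi * k%:~R * x) = (k == 0)%:R.
Proof.
have [->|k0] := eqVneq k 0.
  under eq_Rintegral do rewrite mulr0 mul0r cos0.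
  by rewrite Rintegral_cst // lebesgue01 mulr1.
set w := 2 * pi * k%:~R.
have w0 : w != 0 by rewrite /w !mulf_eq0 !negb_or pnatr_eq0 intr_eq0 k0 (gt_eqF (pi_gt0 R)).
have dF x : is_derive (x : R) 1 (fun x => sin (w * x) / w) (cos (w * x)).
  by apply: is_derive_eq; rewrite /GRing.scale /=; field.
rewrite (@integral_FTC _ _ (@cts_cos w) dF).
by rewrite mulr0 mulr1 sin0 (cos_sin_int2pi k).2 !mul0r subrr.
Qed.

Lemma integral_sin_int (k : int) :
  \int[mu]_(x in `[0, 1]) sin (2 * pi * k%:~R * x) = 0.
Proof.
have [->|k0] := eqVneq k 0.
  under eq_Rintegral do rewrite mulr0 mul0r sin0.
  by rewrite Rintegral_cst // mul0r.
set w := 2 * pi * k%:~R.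
have w0 : w != 0 by rewrite /w !mulf_eq0 !negb_or pnatr_eq0 intr_eq0 k0 (gt_eqF (pi_gt0 R)).
have dF x : is_derive (x : R) 1 (fun x => - cos (w * x) / w) (sin (w * x)).
  by apply: is_derive_eq; rewrite /GRing.scale /=; field.
rewrite (@integral_FTC _ _ (@cts_sin w) dF).
by rewrite mulr0 mulr1 cos0 (cos_sin_int2pi k).1 subrr.
Qed.

(** Exponents may repeat in the list, so that sums are concatenations and no normal form has to be
    maintained. The same encoding is used below in several variables. *)
Definition laurent1 (s : seq (C * int)) (w : C) : C := \sum_(c <- s) c.1 * w ^ c.2.

Definition const_term1 (s : seq (C * int)) : C := \sum_(c <- s | c.2 == 0) c.1.

(** Continuity and the values of the integrals go through one induction, because additivity of the
    integral needs integrability, which is obtained from continuity. *)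
Let cts_ReIm_laurent1 s :
  [/\ continuous (fun x => complex.Re (laurent1 s (circle_point x))),
      continuous (fun x => complex.Im (laurent1 s (circle_point x))),
      \int[mu]_(x in `[0, 1]) complex.Re (laurent1 s (circle_point x)) =
        complex.Re (const_term1 s) &
      \int[mu]_(x in `[0, 1]) complex.Im (laurent1 s (circle_point x)) =
        complex.Im (const_term1 s)].
Proof.
elim: s => [|[c k] s [cRe cIm iRe iIm]].
  rewrite /laurent1 /const_term1 big_nil /=.
  have -> : (fun x : R => complex.Re (\sum_(c <- [::]) c.1 * circle_point x ^ c.2)) = cst 0.
    by apply/funext => x; rewrite big_nil.
  have -> : (fun x : R => complex.Im (\sum_(c <- [::]) c.1 * circle_point x ^ c.2)) = cst 0.
    by apply/funext => x; rewrite big_nil.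
  by split; [exact: cst_continuous|exact: cst_continuous| |];
    rewrite Rintegral_cst // mul0r.
pose w : R := 2 * pi * k%:~R.
have E1 x : complex.Re (laurent1 ((c, k) :: s) (circle_point x)) =
    (complex.Re c * cos (w * x) + - complex.Im c * sin (w * x)) +
    complex.Re (laurent1 s (circle_point x)).
  by rewrite {1}/laurent1 big_cons ReD ReM circle_pointXz /= /w mulrA mulNr.
have E2 x : complex.Im (laurent1 ((c, k) :: s) (circle_point x)) =
    (complex.Re c * sin (w * x) + complex.Im c * cos (w * x)) +
    complex.Im (laurent1 s (circle_point x)).
  by rewrite {1}/laurent1 big_cons ImD ImM circle_pointXz /= /w mulrA.
have cc a : continuous (fun x : R => a * cos (w * x)).
  by move=> x; apply: cvgM; [exact: cvg_cst|exact: cts_cos].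
have cs a : continuous (fun x : R => a * sin (w * x)).
  by move=> x; apply: cvgM; [exact: cvg_cst|exact: cts_sin].
have ccs a b : continuous (fun x : R => a * cos (w * x) + b * sin (w * x)).
  by move=> x; apply: cvgD; [exact: cc|exact: cs].
have csc a b : continuous (fun x : R => a * sin (w * x) + b * cos (w * x)).
  by move=> x; apply: cvgD; [exact: cs|exact: cc].
have ic a : \int[mu]_(x in `[0, 1]) (a * cos (w * x)) = a * (k == 0)%:R.
  by rewrite RintegralZl ?integral_cos_int //; exact/integrable01/cts_cos.
have is_ a : \int[mu]_(x in `[0, 1]) (a * sin (w * x)) = 0.
  by rewrite RintegralZl ?integral_sin_int ?mulr0 //; exact/integrable01/cts_sin.
have CTE : const_term1 ((c, k) :: s) = (k == 0)%:R * c + const_term1 s.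
  by rewrite /const_term1 big_cons /=; case: eqP; rewrite ?mul1r ?mul0r ?add0r.
split.
- rewrite (funext E1) => x; apply: cvgD; [exact: ccs|exact: cRe].
- rewrite (funext E2) => x; apply: cvgD; [exact: csc|exact: cIm].
- under eq_Rintegral do rewrite E1.
  rewrite RintegralD ?iRe //; last 2 first.
  + exact/integrable01/ccs.
  + exact/integrable01.
  rewrite RintegralD ?ic ?is_ //; last 2 first.
  + exact/integrable01/cc.
  + exact/integrable01/cs.
  rewrite CTE ReD ReM addr0; congr (_ + _).
  by case: eqP => _ /=; rewrite ?mul0r ?mulr0 ?mulr1 ?mul1r subr0.
- under eq_Rintegral do rewrite E2.
  rewrite RintegralD ?iIm //; last 2 first.
  + exact/integrable01/csc.
  + exact/integrable01.
  rewrite RintegralD ?ic ?is_ //; last 2 first.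
  + exact/integrable01/cs.
  + exact/integrable01/cc.
  rewrite CTE ImD ImM add0r; congr (_ + _).
  by case: eqP => _ /=; rewrite ?mul0r ?mulr0 ?mulr1 ?mul1r ?addr0.
Qed.

Let cts_unif_lim g : (forall e : R, 0 < e ->
    exists2 g', continuous g' & forall x, `|g x - g' x| <= e) -> continuous g.
Proof.
move=> H x; apply/cvgrPdist_le => e e0.
have e3 : 0 < e / 3 by rewrite divr_gt0.
have [g' cg' gg'] := H _ e3.
have /cvgrPdist_le /(_ _ e3) := cg' x.
apply: filterS => y hy.
rewrite (_ : g x - g y = (g x - g' x) + (g' x - g' y) - (g y - g' y)); last by ring.
rewrite (_ : e = e / 3 + e / 3 + e / 3); last by field.
by apply: le_trans (ler_normB _ _) _; rewrite lerD // (le_trans (ler_normD _ _)) // lerD.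
Qed.

(** Approximability to every precision makes [h] continuous on the circle, hence integrable; the
    bound then comes from the one approximation [s]. The two summands of [e + e] stand for the real
    and the imaginary part. *)
Lemma circle_integral_approx (h : C -> C) :
  (forall e : R, 0 < e -> exists s, forall w, `|w| = 1 -> `|h w - laurent1 s w| <= e%:C) ->
  forall s (e : R), (forall w, `|w| = 1 -> `|h w - laurent1 s w| <= e%:C) ->
  `|circle_integral h - const_term1 s| <= (e + e)%:C.
Proof.
move=> H s e hs.
have key (P : C -> R) : (forall a b, P (a - b) = P a - P b) ->
   (forall x d, `|x| <= d%:C -> `|P x| <= d) ->
   (forall s, continuous (fun x => P (laurent1 s (circle_point x))) /\
     \int[mu]_(x in `[0, 1]) P (laurent1 s (circle_point x)) = P (const_term1 s)) ->
   `|\int[mu]_(x in `[0, 1]) P (h (circle_point x)) - P (const_term1 s)| <= e.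
  move=> PB Pn Ps.
  have ch : continuous (fun x => P (h (circle_point x))).
    apply: cts_unif_lim => d /H[s' hs'].
    exists (fun x => P (laurent1 s' (circle_point x))); first by case: (Ps s').
    by move=> x; rewrite -PB; apply: Pn; apply: hs'; exact: norm_circle_point.
  have [cs <-] := Ps s.
  rewrite -RintegralB //; [|exact: integrable01|exact: integrable01].
  have cB : continuous (fun x => P (h (circle_point x)) - P (laurent1 s (circle_point x))).
    by move=> x; apply: cvgB; [exact: ch | exact: cs].
  apply: le_trans (le_normr_Rintegral _ _) _ => //; first exact: integrable01.
  have -> : e = \int[mu]_(x in `[0, 1]) e.
    by rewrite Rintegral_cst // lebesgue01 mulr1.
  apply: le_Rintegral => //.
  - apply: integrable01 => x.
    by apply: (@continuous_comp _ _ _ _ (@Num.norm _ R) x); [exact: cB|exact: norm_continuous].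
  - by apply: integrable01; exact: cst_continuous.
  - by move=> x _; rewrite -PB; apply: Pn; apply: hs; exact: norm_circle_point.
apply: normc_le_ReIm; rewrite /circle_integral.
- rewrite ReB; apply: (key (@complex.Re R)); [exact: ReB|exact: le_Re_norm|].
  by move=> s'; case: (cts_ReIm_laurent1 s').
- rewrite ImB; apply: (key (@complex.Im R)); [exact: ImB|exact: le_Im_norm|].
  by move=> s'; case: (cts_ReIm_laurent1 s').
Qed.

End CircleIntegral.

(** * The modulus as a real number *)

Section RealNorm.
Variable R : realType.
Implicit Types x y : R[i].

(** The norm of [R[i]] takes its values in [R[i]]; a real-valued modulus keeps estimates and limits
    inside [R]. *)
Definition nrm x : R := complex.Re `|x|.

Lemma nrmE x : `|x| = (nrm x)%:C.
Proof. exact: normc_eq_Re. Qed.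

Lemma nrm_ge0 x : 0 <= nrm x.
Proof. by rewrite -ler0c -nrmE. Qed.

Lemma nrmM x y : nrm (x * y) = nrm x * nrm y.
Proof. by apply: (@complexI R); rewrite -nrmE normrM !nrmE -rmorphM. Qed.

Lemma nrmV x : nrm x^-1 = (nrm x)^-1.
Proof. by apply: (@complexI R); rewrite -nrmE normfV nrmE fmorphV. Qed.

Lemma nrmX x n : nrm (x ^+ n) = nrm x ^+ n.
Proof. by apply: (@complexI R); rewrite -nrmE normrX nrmE rmorphXn. Qed.

Lemma nrmN x : nrm (- x) = nrm x.
Proof. by rewrite /nrm normrN. Qed.

Lemma nrm0 : nrm (0 : R[i]) = 0.
Proof. by rewrite /nrm normr0. Qed.

Lemma nrm1 : nrm (1 : R[i]) = 1.
Proof. by rewrite /nrm normr1. Qed.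

Lemma nrmD x y : nrm (x + y) <= nrm x + nrm y.
Proof. by rewrite -lecR rmorphD -!nrmE ler_normD. Qed.

Lemma nrmB x y : nrm (x - y) <= nrm x + nrm y.
Proof. by rewrite -lecR rmorphD -!nrmE ler_normB. Qed.

Lemma lerB_nrm x y : nrm x - nrm y <= nrm (x - y).
Proof. by rewrite -lecR rmorphB -!nrmE (lerB_dist x y). Qed.

Lemma nrm_eq0 x : (nrm x == 0) = (x == 0).
Proof. by rewrite -[RHS]normr_eq0 nrmE -(rmorph0 (real_complex R)) (inj_eq (@complexI R)). Qed.

Lemma nrm_gt0 x : (0 < nrm x) = (x != 0).
Proof. by rewrite lt0r nrm_eq0 nrm_ge0 andbT. Qed.

Lemma nrm_sum (I : Type) (s : seq I) (P : pred I) (F : I -> R[i]) :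
  nrm (\sum_(i <- s | P i) F i) <= \sum_(i <- s | P i) nrm (F i).
Proof.
elim/big_rec2: _ => [|i a b _ h]; first by rewrite nrm0.
by apply: le_trans (nrmD _ _) _; rewrite lerD2l.
Qed.

Lemma nrm_prod (I : Type) (s : seq I) (P : pred I) (F : I -> R[i]) :
  nrm (\prod_(i <- s | P i) F i) = \prod_(i <- s | P i) nrm (F i).
Proof. exact: (big_morph _ nrmM nrm1). Qed.

Lemma nrm_le x (e : R) : (`|x| <= e%:C) = (nrm x <= e).
Proof. by rewrite nrmE lecR. Qed.

Lemma nrm_eq1 x : (`|x| = 1) <-> (nrm x = 1).
Proof.
split => [h|]; first by rewrite /nrm h.
by rewrite nrmE => ->.
Qed.

Lemma nrm_small_eq x y (k : R) : (forall e, 0 < e -> nrm (x - y) <= k * e) -> x = y.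
Proof.
move=> h; apply/eqP; rewrite -subr_eq0 -nrm_eq0 eq_le nrm_ge0 andbT.
apply/ler_addgt0Pl => e e0; rewrite addr0.
have k0 : 0 < `|k| + 1 by rewrite ltr_wpDl.
apply: le_trans (h (e / (`|k| + 1)) _) _; first by rewrite divr_gt0.
rewrite mulrA ler_pdivrMr // mulrC ler_pM2l //.
by apply: le_trans (ler_norm _) _; rewrite lerDl.
Qed.

End RealNorm.

(** * Laurent polynomials and the torus integral *)

Section Laurent.
Variable R : realType.
Local Notation C := R[i].
Implicit Type n : nat.

Definition laurent n (s : seq (C * {ffun 'I_n -> int})) (x : 'I_n -> C) : C :=
  \sum_(c <- s) c.1 * \prod_i x i ^ c.2 i.

Definition const_term n (s : seq (C * {ffun 'I_n -> int})) : C :=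
  \sum_(c <- s | c.2 == 0) c.1.

Definition on_torus n (z : n.-tuple C) : Prop := forall i, nrm (tnth z i) = 1.

(* Only such functions are integrated: their integrals are limits of constant
   terms, and linearity and changes of variables are read off constant terms. *)
Definition lapprox n (K : n.-tuple C -> Prop) (f : n.-tuple C -> C) : Prop :=
  forall e : R, 0 < e ->
  exists s, forall z, K z -> nrm (f z - laurent s (tnth z)) <= e.

(** Each circle costs a factor 2, because real and imaginary parts are estimated separately; hence
    [2 ^+ n]. *)
Lemma torus_integral_approx n (f : n.-tuple C -> C) : lapprox (@on_torus n) f ->
  forall s (e : R), (forall z, on_torus z -> nrm (f z - laurent s (tnth z)) <= e) ->
  nrm (torus_integral f - const_term s) <= 2 ^+ n * e.
Proof.
elim: n f => [|n IH] f fA s e fs.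
  rewrite expr0 mul1r /=; suff -> : const_term s = laurent s (tnth [tuple]).
    by apply: fs => -[].
  rewrite /const_term /laurent; apply: eq_big => [c|c _]; last by rewrite big_ord0 mulr1.
  by apply/eqP/ffunP => -[].
(* [sec s w] is [s] with its first coordinate frozen at [w]; [proj s] is the constant term of [s] in
   the other coordinates, as a Laurent polynomial in the first one. *)
pose sec s (w : C) : seq (C * {ffun 'I_n -> int}) :=
  [seq (c.1 * w ^ (c.2 ord0), [ffun i => c.2 (lift ord0 i)]) |
    c : C * {ffun 'I_n.+1 -> int} <- s].
pose proj s : seq (C * int) := [seq (c.1, c.2 ord0) |
    c : C * {ffun 'I_n.+1 -> int} <- s & [ffun i => c.2 (lift ord0 i)] == (0 : {ffun 'I_n -> int})].
have secE s' w (z : n.-tuple C) :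
    laurent s' (tnth (cons_tuple w z)) = laurent (sec s' w) (tnth z).
  rewrite /laurent big_map; apply: eq_bigr => c _ /=.
  rewrite big_ord_recl mulrA; congr (_ * _).
  by apply: eq_bigr => i _; rewrite ffunE tnthS.
have projE s' w : laurent1 (proj s') w = const_term (sec s' w).
  by rewrite /laurent1 /const_term !big_map big_filter.
have proj0 s' : const_term1 (proj s') = const_term s'.
  rewrite /const_term1 /const_term !big_map big_filter_cond; apply: eq_bigl => c /=.
  apply/andP/eqP => [[/eqP h1 /eqP h2]|->].
    apply/ffunP => i; rewrite ffunE; case: (unliftP ord0 i) => [j ->|-> //].
    by move/ffunP: h1 => /(_ j); rewrite !ffunE.
  by split; [apply/eqP/ffunP => i; rewrite !ffunE|rewrite ffunE].
have torS w (z : n.-tuple C) : nrm w = 1 -> on_torus z -> on_torus (cons_tuple w z).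
  by move=> h1 h2 i; case: (unliftP ord0 i) => [j ->|->]; rewrite ?tnthS.
have fS w : nrm w = 1 -> lapprox (@on_torus n) (fun z => f (cons_tuple w z)).
  move=> w1 d /fA[s' hs']; exists (sec s' w) => z hz.
  by rewrite -secE; apply: hs'; exact: torS.
have hE s' d w : (forall z, on_torus z -> nrm (f z - laurent s' (tnth z)) <= d) ->
    nrm w = 1 ->
    nrm (torus_integral (fun z => f (cons_tuple w z)) - laurent1 (proj s') w) <= 2 ^+ n * d.
  move=> hs' w1; rewrite projE; apply: IH; first exact: fS.
  by move=> z hz; rewrite -secE; apply: hs'; exact: torS.
rewrite /= -nrm_le -proj0 exprS -mulrA mulr_natl mulr2n; apply: circle_integral_approx.
  move=> d d0; have d1 : 0 < d / 2 ^+ n by rewrite divr_gt0 ?exprn_gt0.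
  have [s' hs'] := fA _ d1; exists (proj s') => w /nrm_eq1 w1.
  by rewrite nrm_le (le_trans (hE _ _ _ hs' w1)) // mulrC divfK // expf_neq0.
by move=> w /nrm_eq1 w1; rewrite nrm_le; exact: hE.
Qed.

Lemma eq_torus_integral n (f g : n.-tuple C -> C) :
  (forall z, on_torus z -> f z = g z) -> torus_integral f = torus_integral g.
Proof.
elim: n f g => [|n IH] f g fg /=; first by apply: fg => -[].
rewrite /circle_integral.
have h theta : torus_integral (fun z => f (cons_tuple (circle_point theta) z)) =
    torus_integral (fun z => g (cons_tuple (circle_point theta) z)).
  apply: IH => z hz; apply: fg => i.
  case: (unliftP ord0 i) => [j ->|->]; rewrite ?tnthS //.
  exact/nrm_eq1/norm_circle_point.
by congr (_ +i* _); apply: eq_Rintegral => theta _; rewrite h.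
Qed.

End Laurent.

(** * Substitutions in Laurent polynomials and their constant terms *)

Section LaurentOps.
Variable R : realType.
Local Notation C := R[i].
Variable n : nat.
Implicit Types (s : seq (C * {ffun 'I_n -> int})) (x : 'I_n -> C).

Lemma laurent_cat s1 s2 x : laurent (s1 ++ s2) x = laurent s1 x + laurent s2 x.
Proof. by rewrite /laurent big_cat. Qed.

Lemma const_term_cat s1 s2 : const_term (s1 ++ s2) = const_term s1 + const_term s2.
Proof. by rewrite /const_term big_cat. Qed.

Lemma laurent_scale (a : C) s x :
  laurent [seq (a * c.1, c.2) | c <- s] x = a * laurent s x.
Proof. by rewrite /laurent big_map mulr_sumr; apply: eq_bigr => c _ /=; rewrite mulrA. Qed.

Lemma const_term_scale (a : C) s :
  const_term [seq (a * c.1, c.2) | c <- s] = a * const_term s.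
Proof. by rewrite /const_term big_map mulr_sumr. Qed.

Lemma laurent_mul s1 s2 x : (forall i, x i != 0) ->
  laurent [seq (c.1 * d.1, c.2 + d.2) | c <- s1, d <- s2] x =
  laurent s1 x * laurent s2 x.
Proof.
move=> x0; rewrite /laurent big_allpairs_dep /= mulr_suml.
apply: eq_bigr => c _; rewrite mulr_sumr; apply: eq_bigr => d _ /=.
rewrite mulrACA -big_split /=; congr (_ * _).
by apply: eq_bigr => i _; rewrite ffunE expfzDr.
Qed.

Lemma laurent_perm (p : {perm 'I_n}) s x :
  laurent [seq (c.1, [ffun i => c.2 (p i)]) | c : C * {ffun 'I_n -> int} <- s]
    x = laurent s (fun i => x ((p^-1)%g i)).
Proof.
rewrite /laurent big_map; apply: eq_bigr => c _ /=; congr (_ * _).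
rewrite (reindex_inj (@perm_inj _ p^-1%g)) /=.
by apply: eq_bigr => i _; rewrite ffunE permKV.
Qed.

Lemma const_term_perm (p : {perm 'I_n}) s :
  const_term [seq (c.1, [ffun i => c.2 (p i)]) | c : C * {ffun 'I_n -> int} <- s] =
  const_term s.
Proof.
rewrite /const_term big_map; apply: eq_bigl => c /=.
apply/eqP/eqP => [h|->]; last by apply/ffunP => i; rewrite !ffunE.
by apply/ffunP => i; move/ffunP: h => /(_ (p^-1%g i)); rewrite !ffunE permKV.
Qed.

Lemma laurent_inv s x :
  laurent [seq (c.1, - c.2) | c <- s] x = laurent s (fun i => (x i)^-1).
Proof.
rewrite /laurent big_map; apply: eq_bigr => c _ /=; congr (_ * _).
by apply: eq_bigr => i _; rewrite ffunE exprz_inv.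
Qed.

Lemma const_term_inv s : const_term [seq (c.1, - c.2) | c <- s] = const_term s.
Proof. by rewrite /const_term big_map; apply: eq_bigl => c; rewrite oppr_eq0. Qed.

Lemma laurent_shift (a : C) (k : 'I_n) s x :
  laurent [seq (c.1 * a ^ c.2 k, c.2) | c : C * {ffun 'I_n -> int} <- s] x =
  laurent s (fun i => if i == k then a * x i else x i).
Proof.
rewrite /laurent big_map; apply: eq_bigr => c _ /=; rewrite -mulrA; congr (_ * _).
rewrite (bigD1 k) //= [in RHS](bigD1 k) //= eqxx expfzMl mulrA.
by congr (_ * _); apply: eq_bigr => i /negbTE ->.
Qed.

(** This is the algebraic core of the contour shift: dilating a variable rescales each coefficient
    by a power of [a], which is 1 at exponent 0. *)
Lemma const_term_shift (a : C) (k : 'I_n) s :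
  const_term [seq (c.1 * a ^ c.2 k, c.2) | c : C * {ffun 'I_n -> int} <- s] =
  const_term s.
Proof.
rewrite /const_term big_map; apply: eq_bigr => c /eqP /= ->.
by rewrite ffunE expr0z mulr1.
Qed.

End LaurentOps.

(** * The algebra of uniform limits of Laurent polynomials *)

Section Approx.
Variable R : realType.
Local Notation C := R[i].
Variable n : nat.
Variable K : n.-tuple C -> Prop.
Implicit Types (s : seq (C * {ffun 'I_n -> int})) (f g : n.-tuple C -> C).

(** Shared by the torus and the pairs of tori. It makes Laurent polynomials bounded on [K], as
    closure of approximable functions under products requires. *)
Definition bounded_units := exists2 B : R, 0 < B & forall z, K z -> forall i,
  [/\ tnth z i != 0, nrm (tnth z i) <= B & nrm (tnth z i)^-1 <= B].

Lemma lapprox_eq f g : (forall z, K z -> f z = g z) -> lapprox K g -> lapprox K f.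
Proof. by move=> fg H e /H[s hs]; exists s => z Kz; rewrite fg // hs. Qed.

Lemma lapprox_lim f :
  (forall e : R, 0 < e -> exists2 g, lapprox K g & forall z, K z -> nrm (f z - g z) <= e) ->
  lapprox K f.
Proof.
move=> H e e0; have e2 : 0 < e / 2 by rewrite divr_gt0.
have [g gA fg] := H _ e2; have [s gs] := gA _ e2; exists s => z Kz.
have -> : f z - laurent s (tnth z) = (f z - g z) + (g z - laurent s (tnth z)) by ring.
by rewrite (le_trans (nrmD _ _)) // (splitr e) lerD ?fg ?gs.
Qed.

Lemma lapprox_laurent s : lapprox K (fun z => laurent s (tnth z)).
Proof. by move=> e e0; exists s => z _; rewrite subrr nrm0 ltW. Qed.

Lemma lapprox_cst (a : C) : lapprox K (fun=> a).
Proof.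
apply: (@lapprox_eq _ (fun z => laurent [:: (a, 0)] (tnth z))); last exact: lapprox_laurent.
move=> z _; rewrite /laurent big_seq1 /= big1 ?mulr1 // => i _.
by rewrite ffunE expr0z.
Qed.

Lemma lapprox_coordX (i : 'I_n) (k : int) : lapprox K (fun z => tnth z i ^ k).
Proof.
apply: (@lapprox_eq _
  (fun z => laurent [:: (1, [ffun j => if j == i then k else 0])] (tnth z))); last exact: lapprox_laurent.
move=> z _; rewrite /laurent big_seq1 /= mul1r (bigD1 i) //= ffunE eqxx.
by rewrite big1 ?mulr1 // => j /negbTE ji; rewrite ffunE ji expr0z.
Qed.

Lemma lapprox_coord (i : 'I_n) : lapprox K (fun z => tnth z i).
Proof. by have := @lapprox_coordX i 1; apply: lapprox_eq. Qed.

Lemma lapprox_coordV (i : 'I_n) : lapprox K (fun z => (tnth z i)^-1).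
Proof. by have := @lapprox_coordX i (-1); apply: lapprox_eq => z _; rewrite exprN1. Qed.

Lemma lapproxD f g : lapprox K f -> lapprox K g -> lapprox K (fun z => f z + g z).
Proof.
move=> fA gA e e0; have e2 : 0 < e / 2 by rewrite divr_gt0.
have [s hs] := fA _ e2; have [s' hs'] := gA _ e2; exists (s ++ s') => z Kz.
rewrite laurent_cat (splitr e) opprD addrACA.
by rewrite (le_trans (nrmD _ _)) // lerD ?hs ?hs'.
Qed.

Lemma lapprox_sum (I : Type) (r : seq I) (P : pred I) (F : I -> n.-tuple C -> C) :
  (forall i, P i -> lapprox K (F i)) -> lapprox K (fun z => \sum_(i <- r | P i) F i z).
Proof.
move=> H; elim: r => [|i r IH].
  by apply: lapprox_eq (lapprox_cst 0) => z _; rewrite big_nil.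
have [Pi|Pi] := boolP (P i); last first.
  by apply: lapprox_eq IH => z _; rewrite big_cons (negbTE Pi).
by apply: lapprox_eq (lapproxD (H i Pi) IH) => z _; rewrite big_cons Pi.
Qed.

Hypothesis bK : bounded_units.

Lemma laurent_bounded s : exists2 M, 0 < M & forall z, K z -> nrm (laurent s (tnth z)) <= M.
Proof.
have [B B0 hB] := bK.
elim: s => [|c s [M M0 hM]].
  by exists 1 => // z _; rewrite /laurent big_nil nrm0.
exists (nrm c.1 * \prod_(i < n) B ^+ `|c.2 i| + M).
  by rewrite ltr_wpDl // mulr_ge0 ?nrm_ge0 ?prodr_ge0 // => i _; rewrite exprn_ge0 // ltW.
move=> z Kz; rewrite /laurent big_cons (le_trans (nrmD _ _)) // lerD ?hM //.
rewrite nrmM ler_wpM2l ?nrm_ge0 // nrm_prod; apply: ler_prod => i _.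
rewrite nrm_ge0 /=; have [_ h1 h2] := hB z Kz i.
case: (c.2 i) => k /=; first by rewrite nrmX lerXn2r // ?nnegrE ?nrm_ge0 ?ltW.
by rewrite -[_ ^ _]/(_ ^- k.+1) -exprVn nrmX lerXn2r // ?nnegrE ?nrm_ge0 ?ltW.
Qed.

Lemma lapprox_bounded f : lapprox K f -> exists2 M, 0 < M & forall z, K z -> nrm (f z) <= M.
Proof.
move=> /(_ 1 ltr01)[s hs]; have [M M0 hM] := laurent_bounded s.
exists (1 + M); first by rewrite addr_gt0.
move=> z Kz; rewrite -[f z](subrK (laurent s (tnth z))).
by rewrite (le_trans (nrmD _ _)) // lerD ?hs ?hM.
Qed.

Lemma lapproxM f g : lapprox K f -> lapprox K g -> lapprox K (fun z => f z * g z).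
Proof.
move=> fA gA; have [M M0 hM] := lapprox_bounded fA.
apply: lapprox_lim => e e0.
have e1 : 0 < e / (2 * M) by rewrite divr_gt0 // mulr_gt0.
(* [g] is approximated first: the precision demanded of the approximation of [f] depends on the
   bound [M'] of the list chosen for [g]. *)
have [s gs] := gA _ e1; have [M' M'0 hM'] := laurent_bounded s.
have e2 : 0 < e / (2 * M') by rewrite divr_gt0 // mulr_gt0.
have [s' fs] := fA _ e2.
exists (fun z => laurent [seq (c.1 * d.1, c.2 + d.2) | c <- s', d <- s] (tnth z)).
  exact: lapprox_laurent.
move=> z Kz; rewrite laurent_mul; last first.
  by have [B _ /(_ z Kz) hB] := bK => i; case: (hB i).
set a := laurent s' _; set b := laurent s _.
have -> : f z * g z - a * b = f z * (g z - b) + (f z - a) * b by ring.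
rewrite (le_trans (nrmD _ _)) // !nrmM (splitr e) lerD //.
  have -> : e / 2 = M * (e / (2 * M)) by field; rewrite gt_eqF.
  by rewrite ler_pM ?nrm_ge0 ?hM ?gs.
have -> : e / 2 = e / (2 * M') * M' by field; rewrite gt_eqF.
by rewrite ler_pM ?nrm_ge0 ?hM' ?fs.
Qed.

Lemma lapprox_prod (I : Type) (r : seq I) (P : pred I) (F : I -> n.-tuple C -> C) :
  (forall i, P i -> lapprox K (F i)) -> lapprox K (fun z => \prod_(i <- r | P i) F i z).
Proof.
move=> H; elim: r => [|i r IH].
  by apply: lapprox_eq (lapprox_cst 1) => z _; rewrite big_nil.
have [Pi|Pi] := boolP (P i); last first.
  by apply: lapprox_eq IH => z _; rewrite big_cons (negbTE Pi).
by apply: lapprox_eq (lapproxM (H i Pi) IH) => z _; rewrite big_cons Pi.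
Qed.

Lemma lapproxX f m : lapprox K f -> lapprox K (fun z => f z ^+ m).
Proof.
move=> fA; have := @lapprox_prod _ (iota 0 m) xpredT (fun=> f) (fun _ _ => fA).
by apply: lapprox_eq => z _; rewrite big_const_seq count_predT size_iota iter_mulr_1.
Qed.

Lemma lapprox_geom f (rho : R) : rho < 1 -> (forall z, K z -> nrm (f z) <= rho) ->
  lapprox K f -> lapprox K (fun z => (1 - f z)^-1).
Proof.
move=> rho1 fr fA.
(* A negative [rho] forces [K] to be empty. *)
have [r0|r0] := ltP rho 0.
  by move=> e e0; exists [::] => z /fr; rewrite leNgt (lt_le_trans r0) ?nrm_ge0.
apply: lapprox_lim => e e0.
have cv : (rho ^+ m / (1 - rho)) @[m --> \oo] --> (0 : R).
  rewrite -(mul0r (1 - rho)^-1); apply: cvgMl; apply: cvg_expr.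
  by rewrite ger0_norm.
have /cvgrPdist_le /(_ _ e0) [m _ /(_ m (leqnn m))] := cv.
rewrite sub0r normrN => hm; exists (fun z => \sum_(k < m) f z ^+ k).
  by apply: lapprox_sum => k _; exact: lapproxX.
move=> z Kz; apply: le_trans hm; apply: le_trans (ler_norm _).
have f1 : 0 < 1 - rho by rewrite subr_gt0.
have f2 : 1 - rho <= nrm (1 - f z).
  by apply: le_trans (lerB_nrm _ _); rewrite nrm1 lerB // fr.
have f3 : 1 - f z != 0 by rewrite -nrm_gt0 (lt_le_trans f1).
have -> : (1 - f z)^-1 - \sum_(k < m) f z ^+ k = f z ^+ m / (1 - f z).
  apply: (mulfI f3); rewrite mulrBr mulfV // mulrCA mulfV // mulr1.
  by rewrite -[RHS](subrK 1) subrX1; ring.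
rewrite nrmM nrmV nrmX ler_pM ?exprn_ge0 ?invr_ge0 ?nrm_ge0 //.
  by rewrite lerXn2r // ?nnegrE ?nrm_ge0 ?fr.
by rewrite lef_pV2 ?posrE // (lt_le_trans f1).
Qed.

End Approx.

(** * Linearity and changes of variables on the torus *)

Section TorusIntegral.
Variable R : realType.
Local Notation C := R[i].
Variable n : nat.
Local Notation T := (@on_torus R n).
Implicit Types (s : seq (C * {ffun 'I_n -> int})) (f g : n.-tuple C -> C).

Lemma on_torus_neq0 (z : n.-tuple C) i : T z -> tnth z i != 0.
Proof. by move=> /(_ i) h; rewrite -nrm_gt0 h. Qed.

Lemma on_torus_bounded : bounded_units T.
Proof. by exists 1 => // z Tz i; rewrite (on_torus_neq0 _ Tz) nrmV Tz invr1. Qed.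

(** The common route to all changes of variables: a substitution acts on the approximating lists,
    and only has to preserve their constant terms. *)
Lemma torus_integral_match f g :
  (forall e : R, 0 < e -> exists s s',
    [/\ forall z, T z -> nrm (f z - laurent s (tnth z)) <= e,
        forall z, T z -> nrm (g z - laurent s' (tnth z)) <= e &
        const_term s = const_term s']) ->
  torus_integral f = torus_integral g.
Proof.
move=> H.
have fA : lapprox T f by move=> e /H[s [_ [hs _ _]]]; exists s.
have gA : lapprox T g by move=> e /H[_ [s [_ hs _]]]; exists s.
apply: (@nrm_small_eq _ _ _ (2 * 2 ^+ n)) => e /H[s [s' [hs hs' E]]].
have -> : torus_integral f - torus_integral g =
  (torus_integral f - const_term s) - (torus_integral g - const_term s').
  by rewrite E; ring.
have -> : 2 * 2 ^+ n * e = 2 ^+ n * e + 2 ^+ n * e by ring.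
by rewrite (le_trans (nrmB _ _)) // lerD // torus_integral_approx.
Qed.

Lemma torus_integral_laurent s :
  torus_integral (fun z => laurent s (tnth z)) = const_term s.
Proof.
apply: (@nrm_small_eq _ _ _ (2 ^+ n)) => e e0.
apply: torus_integral_approx; first exact: lapprox_laurent.
by move=> z _; rewrite subrr nrm0 ltW.
Qed.

Lemma torus_integral_bound f (M : R) : lapprox T f ->
  (forall z, T z -> nrm (f z) <= M) -> nrm (torus_integral f) <= 2 ^+ n * M.
Proof.
move=> fA fM; have := @torus_integral_approx R n f fA [::] M.
rewrite /const_term big_nil subr0; apply => z Tz.
by rewrite /laurent big_nil subr0 fM.
Qed.

Lemma torus_integralD f g : lapprox T f -> lapprox T g ->
  torus_integral (fun z => f z + g z) = torus_integral f + torus_integral g.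
Proof.
move=> fA gA; apply: (@nrm_small_eq _ _ _ (4 * 2 ^+ n)) => e e0.
have [s hs] := fA _ e0; have [s' hs'] := gA _ e0.
have -> : torus_integral (fun z => f z + g z) - (torus_integral f + torus_integral g) =
  (torus_integral (fun z => f z + g z) - const_term (s ++ s')) -
  ((torus_integral f - const_term s) + (torus_integral g - const_term s')).
  by rewrite const_term_cat; ring.
have -> : 4 * 2 ^+ n * e = 2 ^+ n * (e + e) + (2 ^+ n * e + 2 ^+ n * e) by ring.
apply: le_trans (nrmB _ _) _; apply: lerD; last first.
  by apply: le_trans (nrmD _ _) _; rewrite lerD ?torus_integral_approx.
apply: torus_integral_approx; first exact: lapproxD.
move=> z Tz; rewrite laurent_cat opprD addrACA.
by apply: le_trans (nrmD _ _) _; rewrite lerD ?hs ?hs'.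
Qed.

Lemma torus_integralZ (a : C) f : lapprox T f ->
  torus_integral (fun z => a * f z) = a * torus_integral f.
Proof.
move=> fA; apply: (@nrm_small_eq _ _ _ (2 * nrm a * 2 ^+ n)) => e e0.
have [s hs] := fA _ e0.
have -> : torus_integral (fun z => a * f z) - a * torus_integral f =
  (torus_integral (fun z => a * f z) - const_term [seq (a * c.1, c.2) | c <- s]) -
  a * (torus_integral f - const_term s).
  by rewrite const_term_scale; ring.
have -> : 2 * nrm a * 2 ^+ n * e = 2 ^+ n * (nrm a * e) + nrm a * (2 ^+ n * e) by ring.
apply: le_trans (nrmB _ _) _; apply: lerD; last first.
  by rewrite nrmM; apply: ler_wpM2l; [exact: nrm_ge0|exact: torus_integral_approx].
apply: torus_integral_approx.
  by apply: lapproxM; [exact: on_torus_bounded|exact: lapprox_cst|].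
move=> z Tz; rewrite laurent_scale -mulrBr nrmM.
by rewrite ler_wpM2l ?nrm_ge0 ?hs.
Qed.

Lemma torus_integral_sum (I : Type) (r : seq I) (P : pred I) (F : I -> n.-tuple C -> C) :
  (forall i, P i -> lapprox T (F i)) ->
  torus_integral (fun z => \sum_(i <- r | P i) F i z) =
  \sum_(i <- r | P i) torus_integral (F i).
Proof.
move=> H; elim: r => [|i r IH].
  transitivity (torus_integral (fun z : n.-tuple C => laurent [::] (tnth z))).
    by apply: eq_torus_integral => z _; rewrite /laurent !big_nil.
  by rewrite torus_integral_laurent /const_term !big_nil.
rewrite big_cons -IH; case: ifP => Pi; last first.
  by apply: eq_torus_integral => z _; rewrite big_cons Pi.
rewrite -torus_integralD; [|exact: H|exact: lapprox_sum].
by apply: eq_torus_integral => z _; rewrite big_cons Pi.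
Qed.

Definition permute_tuple (p : {perm 'I_n}) (z : n.-tuple C) : n.-tuple C :=
  [tuple tnth z (p i) | i < n].

Definition inv_tuple (z : n.-tuple C) : n.-tuple C := [tuple (tnth z i)^-1 | i < n].

Definition scale_tuple (k : 'I_n) (a : C) (z : n.-tuple C) : n.-tuple C :=
  [tuple if i == k then a * tnth z i else tnth z i | i < n].

Lemma on_torus_perm p z : T z -> T (permute_tuple p z).
Proof. by move=> Tz i; rewrite tnth_mktuple. Qed.

Lemma on_torus_inv z : T z -> T (inv_tuple z).
Proof. by move=> Tz i; rewrite tnth_mktuple nrmV Tz invr1. Qed.

Lemma torus_integral_perm p f : lapprox T f ->
  torus_integral (fun z => f (permute_tuple p z)) = torus_integral f.
Proof.
move=> fA; apply: torus_integral_match => e /fA[s hs].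
exists [seq (c.1, [ffun i => c.2 ((p^-1)%g i)]) | c : C * {ffun 'I_n -> int} <- s], s.
split => //; last exact: const_term_perm.
move=> z Tz; rewrite laurent_perm invgK.
apply: le_trans (hs _ (on_torus_perm p Tz)).
suff -> : (tnth (permute_tuple p z)) = (fun i => tnth z (p i)) by [].
by apply/funext => i; rewrite tnth_mktuple.
Qed.

Lemma torus_integral_inv f : lapprox T f ->
  torus_integral (fun z => f (inv_tuple z)) = torus_integral f.
Proof.
move=> fA; apply: torus_integral_match => e /fA[s hs].
exists [seq (c.1, - c.2) | c <- s], s; split => //; last exact: const_term_inv.
move=> z Tz; rewrite laurent_inv.
apply: le_trans (hs _ (on_torus_inv Tz)).
suff -> : (tnth (inv_tuple z)) = (fun i => (tnth z i)^-1) by [].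
by apply/funext => i; rewrite tnth_mktuple.
Qed.

(* A function approximable by Laurent polynomials on both tori at once has the
   same integral over each of them; this replaces Cauchy's theorem. *)
Definition two_tori (k : 'I_n) (rho : R) (z : n.-tuple C) : Prop :=
  (forall i, i != k -> nrm (tnth z i) = 1) /\
  (nrm (tnth z k) = 1 \/ nrm (tnth z k) = rho).

Lemma two_tori_bounded k rho : 0 < rho -> bounded_units (two_tori k rho).
Proof.
move=> r0; have r0' : 0 < rho^-1 by rewrite invr_gt0.
have h1 : 0 < 1 + rho + rho^-1 by rewrite !addr_gt0.
exists (1 + rho + rho^-1) => // z [z1 zk] i.
have : nrm (tnth z i) = 1 \/ nrm (tnth z i) = rho.
  by have [->|/z1 ->] := eqVneq i k; [|left].
by case=> h; rewrite -nrm_gt0 nrmV h ?invr1; split => //; lra.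
Qed.

Lemma torus_integral_shift k (a : C) f : lapprox (two_tori k (nrm a)) f ->
  torus_integral (fun z => f (scale_tuple k a z)) = torus_integral f.
Proof.
move=> fA; apply: torus_integral_match => e /fA[s hs].
exists [seq (c.1 * a ^ c.2 k, c.2) | c : C * {ffun 'I_n -> int} <- s], s.
split; last exact: const_term_shift; last first.
  by move=> z Tz; apply: hs; split => [i _|]; [|left]; exact: Tz.
move=> z Tz; rewrite laurent_shift.
have Kz : two_tori k (nrm a) (scale_tuple k a z).
  split=> [i /negbTE ik|]; rewrite tnth_mktuple ?ik ?eqxx; first exact: Tz.
  by right; rewrite nrmM Tz mulr1.
apply: le_trans (hs _ Kz).
suff -> : tnth (scale_tuple k a z) = (fun i => if i == k then a * tnth z i else tnth z i) by [].
by apply/funext => i; rewrite tnth_mktuple.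
Qed.

Lemma lapprox_two_tori k rho f : lapprox (two_tori k rho) f -> lapprox T f.
Proof.
move=> fA e /fA[s hs]; exists s => z Tz; apply: hs.
by split => [i _|]; [|left]; exact: Tz.
Qed.

Lemma lapprox_permute p f : lapprox T f -> lapprox T (fun z => f (permute_tuple p z)).
Proof.
move=> fA e /fA[s hs].
exists [seq (c.1, [ffun i => c.2 ((p^-1)%g i)]) | c : C * {ffun 'I_n -> int} <- s].
move=> z Tz; rewrite laurent_perm invgK.
apply: le_trans (hs _ (on_torus_perm p Tz)).
suff -> : (tnth (permute_tuple p z)) = (fun i => tnth z (p i)) by [].
by apply/funext => i; rewrite tnth_mktuple.
Qed.

Lemma lapprox_inv f : lapprox T f -> lapprox T (fun z => f (inv_tuple z)).
Proof.
move=> fA e /fA[s hs]; exists [seq (c.1, - c.2) | c <- s] => z Tz; rewrite laurent_inv.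
apply: le_trans (hs _ (on_torus_inv Tz)).
suff -> : (tnth (inv_tuple z)) = (fun i => (tnth z i)^-1) by [].
by apply/funext => i; rewrite tnth_mktuple.
Qed.

End TorusIntegral.

(** * Uniform convergence of q-Pochhammer symbols and of their inverses *)

Section InfiniteProducts.
Variable R : realType.
Local Notation C := R[i].

Lemma geometric_small (rho e : R) : 0 <= rho < 1 -> 0 < e -> exists m, rho ^+ m <= e.
Proof.
move=> /andP[r0 r1] e0.
have cv : rho ^+ m @[m --> \oo] --> (0 : R) by apply: cvg_expr; rewrite ger0_norm.
have /cvgrPdist_le /(_ _ e0) [m _ /(_ m (leqnn m))] := cv.
by rewrite sub0r normrN => h; exists m; apply: le_trans h; exact: ler_norm.
Qed.

(** The limit is the supremum of the lower bounds [x m - K * rho ^+ m], each of which lies below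
    every upper bound [x l + K * rho ^+ l]. This retains the explicit rate. *)
Lemma real_geometric_limit (x : nat -> R) (K rho : R) : 0 <= K -> 0 <= rho ->
  (forall m l, (m <= l)%N -> `|x l - x m| <= K * rho ^+ m) ->
  exists l, forall m, `|x m - l| <= K * rho ^+ m.
Proof.
move=> K0 r0 H.
have d0 m : 0 <= K * rho ^+ m by rewrite mulr_ge0 // exprn_ge0.
have cmp m l : x m - K * rho ^+ m <= x l + K * rho ^+ l.
  have [ml|/ltnW lm] := leqP m l.
    have := H _ _ ml; have := d0 l; rewrite ler_norml => h /andP[h1 h2]; lra.
  have := H _ _ lm; have := d0 m; rewrite ler_norml => h /andP[h1 h2]; lra.
pose S := [set x m - K * rho ^+ m | m in [set: nat]].
have ubS l : ubound S (x l + K * rho ^+ l) by move=> _ [m _ <-]; exact: cmp.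
have hS : has_sup S.
  by split; [exists (x 0%N - K * rho ^+ 0); exists 0%N | exists (x 0%N + K * rho ^+ 0)].
exists (sup S) => m; rewrite ler_norml.
have h1 : sup S <= x m + K * rho ^+ m by apply: ge_sup => //; case: hS.
have h2 : x m - K * rho ^+ m <= sup S by apply: sup_upper_bound => //; exists m.
by apply/andP; split; lra.
Qed.

Lemma geometric_sum_le (rho : R) m : 0 <= rho < 1 -> \sum_(k < m) rho ^+ k <= (1 - rho)^-1.
Proof.
move=> /andP[r0 r1]; have h : 0 < 1 - rho by rewrite subr_gt0.
rewrite -(ler_pM2l h) mulfV ?gt_eqF // -[1 - rho]opprB mulNr -subrX1 opprB.
by rewrite gerBl exprn_ge0.
Qed.

(** [K] depends on [A] and [rho] but not on [v]: this uniformity makes [qpoch] a uniform limit of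
    its partial products on bounded sets. *)
Lemma infinite_product_limit (A rho : R) : 0 <= A -> 0 <= rho < 1 ->
  exists2 K : R, 0 <= K & forall v : nat -> C, (forall k, nrm (v k) <= A * rho ^+ k) ->
  exists L : C, forall m, nrm (\prod_(k < m) (1 + v k) - L) <= K * rho ^+ m.
Proof.
move=> A0 rho01; have /andP[r0 r1] := rho01.
have h1 : 0 < 1 - rho by rewrite subr_gt0.
(* [B] bounds all partial products through [1 + x <= expR x]. Telescoping then bounds the increments
   after [m] by [K1 * rho ^+ m]. *)
pose B := expR (A / (1 - rho)).
pose K1 := B * A / (1 - rho).
have K10 : 0 <= K1 by rewrite !mulr_ge0 ?invr_ge0 ?expR_ge0 // ltW.
exists (K1 + K1) => [|v hv]; first exact: addr_ge0.
pose P m := \prod_(k < m) (1 + v k).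
have PB m : nrm (P m) <= B.
  apply: (@le_trans _ _ (\prod_(k < m) expR (A * rho ^+ k))).
    rewrite nrm_prod; apply: ler_prod => k _; rewrite nrm_ge0 /=.
    apply: le_trans (nrmD _ _) _; rewrite nrm1.
    by apply: le_trans (expR_ge1Dx _); rewrite lerD2l.
  rewrite -(big_morph (@expR R) (@expRD R) (@expR0 R)) ler_expR -mulr_sumr.
  by rewrite ler_wpM2l // geometric_sum_le.
have dP m l : nrm (P (m + l)%N - P m) <= K1 * rho ^+ m.
  have -> : P (m + l)%N - P m = \sum_(k < l) P (m + k)%N * v (m + k)%N.
    elim: l => [|l IH]; first by rewrite addn0 subrr big_ord0.
    by rewrite big_ord_recr /= -IH addnS /P big_ord_recr /=; ring.
  apply: le_trans (nrm_sum _ _ _) _.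
  apply: (@le_trans _ _ (\sum_(k < l) B * (A * rho ^+ (m + k)))).
    by apply: ler_sum => k _; rewrite nrmM ler_pM ?nrm_ge0.
  rewrite -mulr_sumr -mulr_sumr; under eq_bigr do rewrite exprD.
  rewrite -mulr_sumr /K1 -!mulrA ler_wpM2l ?expR_ge0 // ler_wpM2l //.
  by rewrite [leRHS]mulrC ler_wpM2l ?exprn_ge0 // geometric_sum_le.
have key (f : C -> R) : (forall a b, f (a - b) = f a - f b) ->
    (forall a, `|f a| <= nrm a) ->
    exists l, forall m, `|f (P m) - l| <= K1 * rho ^+ m.
  move=> fB fn; apply: real_geometric_limit => // m l /subnKC <-.
  by rewrite -fB; apply: le_trans (fn _) _.
have [a ha] : exists l, forall m, `|complex.Re (P m) - l| <= K1 * rho ^+ m.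
  by apply: key; [exact: ReB | move=> x; apply: le_Re_norm; rewrite nrmE].
have [b hb] : exists l, forall m, `|complex.Im (P m) - l| <= K1 * rho ^+ m.
  by apply: key; [exact: ImB | move=> x; apply: le_Im_norm; rewrite nrmE].
exists (a +i* b) => m; rewrite -nrm_le mulrDl.
by apply: normc_le_ReIm; rewrite ?ReB ?ImB /=; [exact: ha|exact: hb].
Qed.

Lemma geometric_cvg0 (K rho : R) : 0 <= rho < 1 -> K * rho ^+ m @[m --> \oo] --> (0 : R).
Proof.
move=> /andP[r0 r1]; rewrite -(mulr0 K); apply: cvgMr.
by apply: cvg_expr; rewrite ger0_norm.
Qed.

Lemma qpoch_uniform (q : C) (A : R) : nrm q < 1 -> 0 <= A ->
  exists2 K : R, 0 <= K & forall a, nrm a <= A ->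
  forall m, nrm (\prod_(k < m) (1 - a * q ^+ k) - qpoch a q) <= K * nrm q ^+ m.
Proof.
move=> q1 A0; have rho01 : 0 <= nrm q < 1 by rewrite nrm_ge0.
have [K K0 H] := infinite_product_limit A0 rho01; exists K => // a aA.
have [|L hL] := H (fun k => - (a * q ^+ k)).
  by move=> k; rewrite nrmN nrmM nrmX ler_wpM2r ?exprn_ge0 ?nrm_ge0.
have -> : qpoch a q = L; last by move=> m; exact: hL.
apply: (cvg_ReIm_prod (geometric_cvg0 K rho01)) => m.
by rewrite nrm_le; exact: hL.
Qed.

Lemma qpochS (a q : C) : nrm q < 1 -> qpoch a q = (1 - a) * qpoch (a * q) q.
Proof.
move=> q1; pose A := nrm a + nrm (a * q).
have [||K K0 H] := @qpoch_uniform q A => //; first by rewrite addr_ge0 ?nrm_ge0.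
apply: (@nrm_small_eq _ _ _ (K + nrm (1 - a) * K)) => e e0.
have [|m hm] := @geometric_small (nrm q) e _ e0; first by rewrite nrm_ge0.
have h1 := H a _ m.+1; have h2 := H (a * q) _ m.
rewrite big_ord_recl /= expr0 mulr1 in h1.
have E : \prod_(i < m) (1 - a * q ^+ bump 0 i) = \prod_(i < m) (1 - a * q * q ^+ i).
  by apply: eq_bigr => k _; rewrite /bump /= add1n exprS mulrA.
rewrite {}E in h1.
have -> : qpoch a q - (1 - a) * qpoch (a * q) q =
  (1 - a) * (\prod_(i < m) (1 - a * q * q ^+ i) - qpoch (a * q) q) -
  ((1 - a) * \prod_(i < m) (1 - a * q * q ^+ i) - qpoch a q) by ring.
apply: le_trans (nrmB _ _) _; rewrite nrmM [leRHS]mulrDl [leLHS]addrC; apply: lerD.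
  apply: le_trans (h1 _) _; first by rewrite /A lerDl nrm_ge0.
  apply: ler_wpM2l => //; apply: le_trans hm; rewrite exprS.
  by rewrite ler_piMl ?exprn_ge0 ?nrm_ge0 // ltW.
rewrite -mulrA; apply: ler_wpM2l; first exact: nrm_ge0.
apply: le_trans (h2 _) _; first by rewrite /A lerDr nrm_ge0.
exact: ler_wpM2l.
Qed.

(** Since [1 / (1 - x) = 1 + x / (1 - x)], the product of the inverses has the shape treated by
    [infinite_product_limit]. Its limit times [qpoch a q] is 1, which also shows that [qpoch a q]
    does not vanish. *)
Lemma qpochV_uniform (q : C) (rho : R) : nrm q < 1 -> rho < 1 ->
  exists2 K : R, 0 <= K & forall a, nrm a <= rho -> qpoch a q != 0 /\
  forall m, nrm (\prod_(k < m) (1 - a * q ^+ k)^-1 - (qpoch a q)^-1) <= K * nrm q ^+ m.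
Proof.
move=> q1 r1; have q01 : 0 <= nrm q < 1 by rewrite nrm_ge0.
have h1 : 0 < 1 - rho by rewrite subr_gt0.
have A0 : 0 <= (1 - rho)^-1 by rewrite invr_ge0 ltW.
have [K K0 H] := infinite_product_limit A0 q01; exists K => // a ar.
have [K' K'0 H'] := qpoch_uniform q1 (nrm_ge0 a).
have aq k : nrm (a * q ^+ k) <= rho.
  rewrite nrmM nrmX; apply: le_trans ar.
  by rewrite ler_piMr ?nrm_ge0 // exprn_ile1 ?nrm_ge0 // ltW.
have f2 k : 1 - rho <= nrm (1 - a * q ^+ k).
  by apply: le_trans (lerB_nrm _ _); rewrite nrm1 lerB.
have f3 k : 1 - a * q ^+ k != 0 by rewrite -nrm_gt0 (lt_le_trans h1).
have E k : 1 + a * q ^+ k / (1 - a * q ^+ k) = (1 - a * q ^+ k)^-1.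
  by have := f3 k; move: (q ^+ k) => y hy; field.
have [|L hL] := H (fun k => a * q ^+ k / (1 - a * q ^+ k)).
  move=> k; rewrite nrmM nrmV mulrC ler_pM ?invr_ge0 ?nrm_ge0 //.
    by rewrite lef_pV2 ?posrE // (lt_le_trans h1).
  rewrite nrmM nrmX ler_piMl ?exprn_ge0 ?nrm_ge0 //.
  by rewrite (le_trans ar) // ltW.
have {}hL m : nrm (\prod_(k < m) (1 - a * q ^+ k)^-1 - L) <= K * nrm q ^+ m.
  by have := hL m; under eq_bigr do rewrite E.
have aP := H' a (lexx _).
suff hqL : qpoch a q * L = 1.
  have q0 : qpoch a q != 0.
    by apply/eqP => h; move: hqL; rewrite h mul0r => /esym/eqP; rewrite oner_eq0.
  by have -> : (qpoch a q)^-1 = L by rewrite -[LHS]mulr1 -hqL mulKf.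
apply: (@nrm_small_eq _ _ _ (nrm (qpoch a q) * K + (K + nrm L) * K')) => e e0.
have [m hm] := geometric_small q01 e0.
pose P := \prod_(k < m) (1 - a * q ^+ k).
pose Q := \prod_(k < m) (1 - a * q ^+ k)^-1.
have PQ : P * Q = 1.
  by rewrite /P /Q -big_split /= big1 // => k _; rewrite mulfV.
have -> : qpoch a q * L - 1 = - (qpoch a q * (Q - L)) - Q * (P - qpoch a q).
  by rewrite -PQ; ring.
apply: le_trans (nrmB _ _) _; rewrite nrmN !nrmM [leRHS]mulrDl; apply: lerD.
  rewrite -mulrA; apply: ler_wpM2l; first exact: nrm_ge0.
  by apply: le_trans (hL m) _; exact: ler_wpM2l.
rewrite -mulrA; apply: ler_pM; rewrite ?nrm_ge0 //.
  rewrite -[Q](subrK L); apply: le_trans (nrmD _ _) _; rewrite lerD2r.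
  apply: le_trans (hL m) _; rewrite ler_piMr // exprn_ile1 ?nrm_ge0 // ltW //.
by apply: le_trans (aP m) _; exact: ler_wpM2l.
Qed.

Lemma qpoch_neq0 (a q : C) : nrm q < 1 -> nrm a < 1 -> qpoch a q != 0.
Proof. by move=> q1 a1; have [K _ /(_ a (lexx _)) []] := qpochV_uniform q1 a1. Qed.

Variable n : nat.
Variable K : n.-tuple C -> Prop.
Hypothesis bK : bounded_units K.

Lemma lapprox_qpoch (q : C) (f : n.-tuple C -> C) : nrm q < 1 -> lapprox K f ->
  lapprox K (fun z => qpoch (f z) q).
Proof.
move=> q1 fA; have [A A0 fA'] := lapprox_bounded bK fA.
have [M M0 H] := qpoch_uniform q1 (ltW A0).
apply: lapprox_lim => e e0.
have M1 : 0 < M + 1 by rewrite ltr_wpDl.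
have [||m hm] := @geometric_small (nrm q) (e / (M + 1)); rewrite ?nrm_ge0 ?divr_gt0 //.
exists (fun z => \prod_(k < m) (1 - f z * q ^+ k)).
  apply: lapprox_prod => // k _; apply: lapproxD; first exact: lapprox_cst.
  have : lapprox K (fun z => f z * (- q ^+ k)) by apply: lapproxM => //; exact: lapprox_cst.
  by apply: lapprox_eq => z _; rewrite mulrN.
move=> z Kz; rewrite -nrmN opprB; apply: le_trans (H _ (fA' _ Kz) m) _.
have -> : e = (M + 1) * (e / (M + 1)) by rewrite mulrC divfK // gt_eqF.
by rewrite ler_pM ?exprn_ge0 ?nrm_ge0 // lerDl.
Qed.

Lemma lapprox_qpochV (q : C) (f : n.-tuple C -> C) (rho : R) : nrm q < 1 -> rho < 1 ->
  (forall z, K z -> nrm (f z) <= rho) -> lapprox K f ->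
  lapprox K (fun z => (qpoch (f z) q)^-1).
Proof.
move=> q1 r1 fr fA; have [M M0 H] := qpochV_uniform q1 r1.
apply: lapprox_lim => e e0.
have M1 : 0 < M + 1 by rewrite ltr_wpDl.
have [||m hm] := @geometric_small (nrm q) (e / (M + 1)); rewrite ?nrm_ge0 ?divr_gt0 //.
exists (fun z => \prod_(k < m) (1 - f z * q ^+ k)^-1).
  apply: lapprox_prod => // k _; apply: (@lapprox_geom _ _ _ bK _ rho) => //.
    move=> z Kz; rewrite nrmM nrmX; apply: le_trans (fr z Kz).
    by rewrite ler_piMr ?nrm_ge0 // exprn_ile1 ?nrm_ge0 // ltW.
  by apply: lapproxM => //; exact: lapprox_cst.
move=> z Kz; rewrite -nrmN opprB; have [_ h] := H _ (fr _ Kz).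
apply: le_trans (h m) _.
have -> : e = (M + 1) * (e / (M + 1)) by rewrite mulrC divfK // gt_eqF.
by rewrite ler_pM ?exprn_ge0 ?nrm_ge0 // lerDl.
Qed.

End InfiniteProducts.

(** * The factors of the density and their behaviour under shifts *)

Section Theta.
Variable R : realType.
Local Notation C := R[i].
Variables q t : C.
Hypotheses (q_lt1 : nrm q < 1) (t_lt1 : nrm t < 1).
Implicit Type u : C.

Definition theta u : C := (qpoch u q * qpoch u^-1 q) / (qpoch (t * u) q * qpoch (t * u^-1) q).

(* [theta1], [theta2] and [theta3] are [theta] multiplied by the factors that the
   difference operators contribute ([theta1E], [theta2E], [theta3E]), with the
   poles of these factors cancelled. *)
Definition theta1 u : C := (qpoch (q * u) q * qpoch u^-1 q) /
  (qpoch (t * q * u) q * qpoch (t * u^-1) q).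

Definition theta2 u : C := (qpoch (q ^+ 2 * u) q * qpoch u^-1 q) /
  (qpoch (t * q ^+ 2 * u) q * qpoch (t * u^-1) q).

Definition theta3 u : C := (1 - t * u / q) * (- q / u) * (1 - u^-1) *
  (qpoch (q ^+ 2 / u) q * qpoch (q * u) q) / (qpoch (t * q * u) q * qpoch (t * u^-1) q).

Lemma thetaV u : theta u^-1 = theta u.
Proof. by rewrite /theta invrK (mulrC (qpoch u^-1 q)) (mulrC (qpoch (t / u) q)). Qed.

Lemma qpoch1 : qpoch 1 q = 0.
Proof. by rewrite qpochS // subrr mul0r. Qed.

Lemma unit_neq0 u : nrm u = 1 -> u != 0.
Proof. by move=> h; rewrite -nrm_gt0 h. Qed.

Let qpoch_t u : nrm u <= 1 -> qpoch (t * u) q != 0.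
Proof.
move=> u1; apply: qpoch_neq0 => //; rewrite nrmM (le_lt_trans _ t_lt1) //.
by rewrite ler_piMr ?nrm_ge0.
Qed.

Let qpoch_tq u m : nrm u = 1 -> qpoch (t * q ^+ m * u) q != 0.
Proof.
move=> u1; rewrite -mulrA qpoch_t // nrmM u1 mulr1 nrmX.
by rewrite exprn_ile1 ?nrm_ge0 // ltW.
Qed.

Let one_sub_neq0 u : nrm u < 1 -> 1 - u != 0.
Proof.
move=> h; rewrite subr_eq0; apply/eqP => E.
by move: h; rewrite -E nrm1 ltxx.
Qed.

Lemma theta1E u : nrm u = 1 -> theta1 u = theta u * ((t * u - 1) / (u - 1)).
Proof.
move=> u1; have [->|un1] := eqVneq u 1.
  (* At [u = 1] the quotient is a division by 0, worth 0, and [theta1] vanishes because of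
     [qpoch 1 q]. *)
  by rewrite subrr invr0 !mulr0 /theta1 invr1 qpoch1 mulr0 mul0r.
have u0 := unit_neq0 u1.
have un1' : u - 1 != 0 by rewrite subr_eq0.
rewrite /theta /theta1 (@qpochS _ u) // (@qpochS _ (t * u)) //.
have h1 : qpoch (t * q * u) q != 0 by rewrite -[q]expr1 expr1 (@qpoch_tq _ 1%N).
have h2 : qpoch (t / u) q != 0 by apply: qpoch_t; rewrite nrmV u1 invr1.
have h3 : 1 - t * u != 0 by apply: one_sub_neq0; rewrite nrmM u1 mulr1.
have -> : t * u * q = t * q * u by ring.
have -> : u * q = q * u by ring.
field; rewrite ?h1 ?h2 ?un1' ?h3 //.
Qed.

(** The source of self-adjointness: on the first kernel, the contour shift has the same effect as
    inversion. *)
Lemma theta1_shift u : q != 0 -> u != 0 -> theta1 (q^-1 * u) = theta1 u^-1.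
Proof.
move=> q0 u0; rewrite /theta1 mulVKf // invrK invfM invrK.
have -> : t * q / u = t * (q / u) by rewrite mulrA.
have -> : t * q * (q^-1 * u) = t * u by field.
by rewrite (mulrC (qpoch u q)) (mulrC (qpoch (t * u) q)).
Qed.

Lemma theta2E u : nrm u = 1 -> theta2 u =
  theta u * ((t * u - 1) / (u - 1) * ((t * q * u - 1) / (q * u - 1))).
Proof.
move=> u1; rewrite mulrA -theta1E //.
have u0 := unit_neq0 u1.
rewrite /theta1 /theta2 (@qpochS _ (q * u)) // (@qpochS _ (t * q * u)) //.
have -> : t * q * u * q = t * q ^+ 2 * u by ring.
have -> : q * u * q = q ^+ 2 * u by ring.
have h1 : qpoch (t * q ^+ 2 * u) q != 0 by rewrite qpoch_tq.
have h2 : qpoch (t / u) q != 0 by apply: qpoch_t; rewrite nrmV u1 invr1.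
have h4 : 1 - q * u != 0 by apply: one_sub_neq0; rewrite nrmM u1 mulr1.
have h4' : q * u - 1 != 0 by rewrite -opprB oppr_eq0.
have h3 : 1 - t * q * u != 0.
  apply: one_sub_neq0; rewrite !nrmM u1 mulr1.
  by rewrite (le_lt_trans _ t_lt1) // ler_piMr ?nrm_ge0 // ltW.
field; rewrite ?h1 ?h2 ?h4' ?h3 //.
Qed.

(** [theta2] is symmetric under [v -> q^-2 / v], so [q^-1] is its centre of symmetry. The shift of
    the operator will be the square of this [q], and the contour shift its inverse. *)
Lemma theta2_shift u : q != 0 -> u != 0 -> theta2 (q^-1 * u) = theta2 (q^-1 * u^-1).
Proof.
move=> q0 u0; rewrite /theta2 !invfM !invrK.
have -> : t * q ^+ 2 * (q^-1 * u) = t * (q * u) by field.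
have -> : t * q ^+ 2 * (q^-1 / u) = t * (q / u) by field; rewrite u0.
have -> : q ^+ 2 * (q^-1 * u) = q * u by field.
have -> : q ^+ 2 * (q^-1 / u) = q / u by field; rewrite u0.
by rewrite (mulrC (qpoch (q * u) q)) (mulrC (qpoch (t * (q * u)) q)^-1).
Qed.

Lemma theta3E u : q != 0 -> nrm u = 1 -> theta3 u =
  theta u * ((t * u / q - 1) / (u / q - 1) * ((t * u - 1) / (u - 1))).
Proof.
move=> q0 u1; rewrite [X in theta u * X]mulrC mulrA -theta1E //.
have u0 := unit_neq0 u1.
have uq : q - u != 0.
  by rewrite subr_eq0; apply/eqP => E; move: q_lt1; rewrite E u1 ltxx.
rewrite /theta1 /theta3 (@qpochS _ u^-1) // (@qpochS _ (u^-1 * q)) //.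
have -> : u^-1 * q * q = q ^+ 2 / u by ring.
have h1 : qpoch (t * q * u) q != 0 by rewrite (@qpoch_tq _ 1%N).
have h2 : qpoch (t / u) q != 0 by apply: qpoch_t; rewrite nrmV u1 invr1.
have uq' : u - q != 0 by rewrite -opprB oppr_eq0.
by field; rewrite ?mulN1r ?h1 ?h2 ?u0 ?q0 ?uq'.
Qed.

(** The factor that [theta3] leaves after the contour shift, with [c = q ^+ 2]. Its pole at [u = 1]
    meets a zero of [theta]; the one at [u = c] is off the unit circle. *)
Definition source_ratio (c u : C) : C := (c - t * u) * (u - t) / ((u - 1) * (c - u)).

Lemma theta3_shift u : q != 0 -> nrm u = 1 ->
  theta3 (q^-1 * u) = theta u * source_ratio (q ^+ 2) u.
Proof.
move=> q0 u1; have u0 := unit_neq0 u1.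
rewrite /theta3 /source_ratio invfM invrK mulVKf //.
have -> : t * q * (q^-1 * u) = t * u by field.
have -> : q ^+ 2 * (q / u) = q ^+ 3 / u by ring.
have [->|un1] := eqVneq u 1.
  by rewrite /theta qpoch1 !(mulr0, mul0r).
have un1' : u - 1 != 0 by rewrite subr_eq0.
have uq : q ^+ 2 - u != 0.
  rewrite subr_eq0; apply/eqP => E; move: (nrmX q 2); rewrite E u1.
  by move/esym/eqP; rewrite lt_eqF // expr_lt1 ?nrm_ge0.
have h1 : qpoch (t * u) q != 0 by rewrite qpoch_t // u1.
have h2 : qpoch (t * (q / u)) q != 0.
  by apply: qpoch_t; rewrite nrmM nrmV u1 invr1 mulr1 ltW.
have h3 : 1 - t / u != 0 by apply: one_sub_neq0; rewrite nrmM nrmV u1 invr1 mulr1.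
have h3' : u - t != 0.
  by rewrite subr_eq0; apply/eqP => E; move: t_lt1; rewrite -E u1 ltxx.
rewrite /theta (@qpochS _ u^-1) // (@qpochS _ (u^-1 * q)) // (@qpochS _ (u^-1 * q * q)) //.
rewrite (@qpochS _ (t / u)) //.
have -> : u^-1 * q * q * q = q ^+ 3 / u by ring.
have -> : t / u * q = t * (q / u) by ring.
by field; rewrite h1 h2 h3' u0 q0 uq un1'.
Qed.

End Theta.

(** * Products over pairs of indices *)

Section PairProducts.
Variable C : comNzRingType.
Variable n : nat.
Variable F : 'I_n -> 'I_n -> C.

Lemma pair_prod_split (k : 'I_n) : (forall i j, F i j = F j i) ->
  \prod_(i < n) \prod_(j < n | (i < j)%N) F i j =
  (\prod_(j < n | j != k) F k j) *
  \prod_(i < n | i != k) \prod_(j < n | (i < j)%N && (j != k)) F i j.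
Proof.
move=> Fs; rewrite (bigD1 k) //=.
have E : \prod_(i < n | i != k) \prod_(j < n | (i < j)%N) F i j =
   \prod_(i < n | i != k) ((if (i < k)%N then F i k else 1) *
      \prod_(j < n | (i < j)%N && (j != k)) F i j).
  apply: eq_bigr => i ik; case: ifP => ilk; first by rewrite (bigD1 k).
  rewrite mul1r; apply: eq_bigl => j; case: eqP => [->|]; rewrite ?andbT ?andbF //.
rewrite E big_split /= mulrA; congr (_ * _).
rewrite -big_mkcondr /= [in RHS](bigID (fun j : 'I_n => (k < j)%N)) /=.
congr (_ * _).
  apply: eq_bigl => j; case: eqP => [->|] /=; rewrite ?ltnn //.
apply: eq_big => [j|j _]; last exact: Fs.
by case: eqVneq => //= jk; case: ltngtP => // /ord_inj /eqP; rewrite (negbTE jk).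
Qed.

Lemma pair_prod_perm (p : {perm 'I_n}) : (forall i j, F i j = F j i) ->
  \prod_(i < n) \prod_(j < n | (i < j)%N) F (p i) (p j) =
  \prod_(i < n) \prod_(j < n | (i < j)%N) F i j.
Proof.
move=> Fs; rewrite !pair_big_dep /=.
(* [h r] maps a pair to its image under [r], put back in increasing order. *)
pose h (r : {perm 'I_n}) (x : 'I_n * 'I_n) :=
  if (r x.1 < r x.2)%N then (r x.1, r x.2) else (r x.2, r x.1).
rewrite [RHS](reindex_onto (h p) (h p^-1%g)) /=; last first.
  move=> [i j] /= ij; rewrite /h /=.
  by have [h1|h1] := ltnP (p^-1%g i) (p^-1%g j); rewrite /= !permKV ?ij // ltnNge (ltnW ij).
apply: eq_big => [[i j]|[i j] ij] /=; last first.
  by rewrite /h /=; case: ifP.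
rewrite /h /=; case: (ltngtP (p i) (p j)) => pij /=.
- rewrite !permK pij /=; case: ltnP => ij; first by rewrite eqxx.
  by apply/esym/negbTE; apply: contraTneq pij => -[ij' _]; rewrite ij' ltnn.
- rewrite !permK pij /=; case: (ltnP j i) => ij.
    by rewrite ltnNge (ltnW ij) /=; apply/esym/negbTE; apply: contraTneq ij => -[_ ->]; rewrite ltnn.
  rewrite eqxx ltn_neqAle ij andbT; apply/eqP => /ord_inj ij'.
  by move: pij; rewrite ij' ltnn.
- by move/ord_inj/perm_inj: pij => ->; rewrite !ltnn.
Qed.

End PairProducts.

(** * The density: symmetries, zeros and approximability *)

Section Density.
Variable R : realType.
Local Notation C := R[i].
Variables q t : C.
Hypotheses (q_lt1 : nrm q < 1) (t_lt1 : nrm t < 1).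
Variable n : nat.
Local Notation T := (@on_torus R n).
Implicit Types (z : n.-tuple C).

Definition density_rest (k : 'I_n) z : C :=
  \prod_(i < n | i != k) \prod_(j < n | (i < j)%N && (j != k))
    theta q t (tnth z i / tnth z j).

Lemma densityE z : macdonald_density q t z =
  \prod_(i < n) \prod_(j < n | (i < j)%N) theta q t (tnth z i / tnth z j).
Proof. by []. Qed.

Lemma density_split k z : macdonald_density q t z =
  (\prod_(j < n | j != k) theta q t (tnth z k / tnth z j)) * density_rest k z.
Proof.
rewrite densityE.
apply: (pair_prod_split (F := fun i j => theta q t (tnth z i / tnth z j))) => i j.
by rewrite -thetaV invfM invrK mulrC.
Qed.

Lemma density_perm p z : macdonald_density q t (permute_tuple p z) = macdonald_density q t z.
Proof.
rewrite !densityE -(pair_prod_perm (F := fun i j => theta q t (tnth z i / tnth z j)) p).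
  by do 2!(apply: eq_bigr => ? _); rewrite !tnth_mktuple.
by move=> i j; rewrite -thetaV invfM invrK mulrC.
Qed.

Lemma density_inv z : macdonald_density q t (inv_tuple z) = macdonald_density q t z.
Proof.
rewrite !densityE; do 2!(apply: eq_bigr => ? _).
by rewrite !tnth_mktuple -[in RHS]thetaV invfM.
Qed.

Lemma density_rest_scale k a z : density_rest k (scale_tuple k a z) = density_rest k z.
Proof.
apply: eq_bigr => i /negbTE ik; apply: eq_bigr => j /andP[_ /negbTE jk].
by rewrite !tnth_mktuple ik jk.
Qed.

Lemma density_eq0 z (i j : 'I_n) : i != j -> tnth z j != 0 -> tnth z i = tnth z j ->
  macdonald_density q t z = 0.
Proof.
move=> ij zj zij; rewrite (density_split i) (bigD1 j) 1?eq_sym //=.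
by rewrite zij divff // /theta (qpoch1 q_lt1) !mul0r.
Qed.

Section Lapprox.
Variable K : n.-tuple C -> Prop.
Hypothesis bK : bounded_units K.

Lemma lapprox_ratio i j : lapprox K (fun z => tnth z i / tnth z j).
Proof. by apply: lapproxM => //; [exact: lapprox_coord|exact: lapprox_coordV]. Qed.

Lemma lapprox_ratioV i j : lapprox K (fun z => (tnth z i / tnth z j)^-1).
Proof. by apply: lapprox_eq (lapprox_ratio j i) => z _; rewrite invfM invrK mulrC. Qed.

Lemma lapproxZ (a : C) f : lapprox K f -> lapprox K (fun z => a * f z).
Proof. by move=> fA; apply: lapproxM => //; exact: lapprox_cst. Qed.

Lemma lapprox_qpoch_ratio i j (a b c d : C) (rho : R) : rho < 1 ->
  (forall z, K z -> nrm (c * (tnth z i / tnth z j)) <= rho) ->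
  (forall z, K z -> nrm (d * (tnth z i / tnth z j)^-1) <= rho) ->
  lapprox K (fun z => let u := tnth z i / tnth z j in
    qpoch (a * u) q * qpoch (b * u^-1) q / (qpoch (c * u) q * qpoch (d * u^-1) q)).
Proof.
move=> r1 hc hd /=.
apply: (@lapprox_eq _ _ _ _ (fun z => (qpoch (a * (tnth z i / tnth z j)) q *
    qpoch (b * (tnth z i / tnth z j)^-1) q) *
   ((qpoch (c * (tnth z i / tnth z j)) q)^-1 * (qpoch (d * (tnth z i / tnth z j)^-1) q)^-1))).
  by move=> z _; congr (_ * _); exact: invfM.
by repeat apply: lapproxM => //;
  [apply: lapprox_qpoch|apply: lapprox_qpoch
  |apply: lapprox_qpochV r1 hc _|apply: lapprox_qpochV r1 hd _] => //;
  apply: lapproxZ; [exact: lapprox_ratio|exact: lapprox_ratioV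
    |exact: lapprox_ratio|exact: lapprox_ratioV].
Qed.

End Lapprox.

Lemma nrm_ratio_torus z i j : nrm (tnth z i) = 1 -> nrm (tnth z j) = 1 ->
  nrm (tnth z i / tnth z j) = 1 /\ nrm (tnth z i / tnth z j)^-1 = 1.
Proof. by move=> h1 h2; rewrite nrmV nrmM nrmV h1 h2 divr1 invr1. Qed.

Lemma lapprox_density_rest k rho : 0 < rho -> lapprox (two_tori k rho) (density_rest k).
Proof.
move=> r0; have bK := two_tori_bounded k r0.
apply: lapprox_prod => // i ik; apply: lapprox_prod => // j /andP[_ jk].
have h z : two_tori k rho z -> nrm (t * (tnth z i / tnth z j)) <= nrm t /\
    nrm (t * (tnth z i / tnth z j)^-1) <= nrm t.
  move=> [z1 _]; have [h1 h2] := nrm_ratio_torus (z1 i ik) (z1 j jk).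
  by rewrite !(nrmM t) h1 h2 mulr1 lexx.
apply: lapprox_eq (@lapprox_qpoch_ratio _ bK i j 1 1 t t (nrm t) t_lt1 _ _) => [z _|z|z].
- by rewrite /= !mul1r.
- by move=> /h[].
- by move=> /h[].
Qed.

Lemma lapprox_density : lapprox T (@macdonald_density R q t n).
Proof.
have bK := @on_torus_bounded R n.
apply: lapprox_prod => // i _; apply: lapprox_prod => // j _.
have h z : T z -> nrm (t * (tnth z i / tnth z j)) <= nrm t /\
    nrm (t * (tnth z i / tnth z j)^-1) <= nrm t.
  move=> z1; have [h1 h2] := nrm_ratio_torus (z1 i) (z1 j).
  by rewrite !(nrmM t) h1 h2 mulr1 lexx.
apply: lapprox_eq (@lapprox_qpoch_ratio _ bK i j 1 1 t t (nrm t) t_lt1 _ _) => [z _|z|z].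
- by rewrite /= !mul1r.
- by move=> /h[].
- by move=> /h[].
Qed.

End Density.

(** * Macdonald's difference operator on functions *)

Section DifferenceOperator.
Variable C : fieldType.
Variable N : nat.
Implicit Types (x : 'I_N -> C).

Definition shift_var (k : 'I_N) (a : C) x : 'I_N -> C :=
  fun i => if i == k then a * x i else x i.

Definition Dcoef (t : C) (k : 'I_N) x : C :=
  \prod_(j < N | j != k) ((t * x k - x j) / (x k - x j)).

(** Stated for arbitrary functions, so that it applies to Laurent polynomials and to inverted
    arguments; [macop] is the version on symmetric polynomials. *)
Definition Dop (q t : C) (f : ('I_N -> C) -> C) x : C :=
  \sum_(k < N) Dcoef t k x * f (shift_var k q x).

Lemma shift_varM k a b x : shift_var k a (shift_var k b x) = shift_var k (a * b) x.
Proof. by apply/funext => i; rewrite /shift_var; case: (i == k); rewrite ?mulrA. Qed.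

Lemma shift_var1 k x : shift_var k 1 x = x.
Proof. by apply/funext => i; rewrite /shift_var mul1r; case: (i == k). Qed.

Lemma shift_var_inv k a x :
  (fun i => (shift_var k a x i)^-1) = shift_var k a^-1 (fun i => (x i)^-1).
Proof. by apply/funext => i; rewrite /shift_var; case: (i == k); rewrite ?invfM. Qed.

Lemma prod_shift_var x (k : 'I_N) a : \prod_i shift_var k a x i = a * \prod_i x i.
Proof.
rewrite (bigD1 k) //= [in RHS](bigD1 k) //= /shift_var eqxx mulrA; congr (_ * _).
by apply: eq_bigr => i /negbTE ->.
Qed.

Lemma ratio_normal (a b x y : C) : y != 0 ->
  (a * x - y) / (b * x - y) = (a * (x / y) - 1) / (b * (x / y) - 1).
Proof.
move=> y0; have E c : c * x - y = y * (c * (x / y) - 1) by field.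
by rewrite (E a) (E b) -mulf_div divff // mul1r.
Qed.

End DifferenceOperator.

(** * Self-adjointness by a contour shift *)

Section Adjoint.
Variable R : realType.
Local Notation C := R[i].
Variables q t : C.
Hypotheses (q_neq0 : q != 0) (q_lt1 : nrm q < 1) (t_lt1 : nrm t < 1).
Variable n : nat.
Local Notation T := (@on_torus R n).
Implicit Types (z : n.-tuple C) (s : seq (C * {ffun 'I_n -> int})).

(** The product of [Dcoef] and the density on the torus, with the poles at [z_k = z_j] cancelled so
    that it can be followed to the second torus. *)
Definition kernel1 (k : 'I_n) z : C :=
  (\prod_(j < n | j != k) theta1 q t (tnth z k / tnth z j)) * density_rest q t k z.

Lemma tnth_scale k a z : tnth (scale_tuple k a z) = shift_var k a (tnth z).
Proof. by apply/funext => i; rewrite tnth_mktuple. Qed.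

Lemma tnth_inv z : tnth (inv_tuple z) = (fun i => (tnth z i)^-1).
Proof. by apply/funext => i; rewrite tnth_mktuple. Qed.

Lemma inv_tupleK : involutive (@inv_tuple R n).
Proof. by move=> z; apply: eq_from_tnth => i; rewrite !tnth_mktuple invrK. Qed.

Lemma scale_ratio k a z j : j != k -> tnth (scale_tuple k a z) k / tnth (scale_tuple k a z) j =
  a * (tnth z k / tnth z j).
Proof. by move=> /negbTE jk; rewrite !tnth_mktuple eqxx jk mulrA. Qed.

Lemma kernel1E k z : T z ->
  Dcoef t k (tnth z) * macdonald_density q t z = kernel1 k z.
Proof.
move=> Tz; rewrite (density_split _ _ k) mulrA -big_split; congr (_ * _).
apply: eq_bigr => j jk; have [h1 h2] := nrm_ratio_torus (Tz k) (Tz j).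
rewrite (theta1E q_lt1 t_lt1 h1) [LHS]mulrC; congr (_ * _).
have := @ratio_normal _ t 1 (tnth z k) (tnth z j) (on_torus_neq0 j Tz).
by rewrite !mul1r.
Qed.

Lemma kernel1_inv k z : T z ->
  Dcoef t k (fun i => (tnth z i)^-1) * macdonald_density q t z = kernel1 k (inv_tuple z).
Proof.
by move=> Tz; rewrite -density_inv -tnth_inv (kernel1E k (on_torus_inv Tz)).
Qed.

Lemma kernel1_shift k z : T z -> kernel1 k (scale_tuple k q^-1 z) = kernel1 k (inv_tuple z).
Proof.
move=> Tz; rewrite /kernel1 density_rest_scale; apply: (congr2 *%R).
  apply: eq_bigr => j jk; rewrite (scale_ratio _ _ jk).
  have u0 : tnth z k / tnth z j != 0 by rewrite mulf_neq0 ?invr_eq0 ?(on_torus_neq0 _ Tz).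
  by rewrite (theta1_shift _ q_neq0 u0) !tnth_mktuple invfM invrK.
apply: eq_bigr => i ik; apply: eq_bigr => j _.
by rewrite !tnth_mktuple -thetaV invfM.
Qed.

Lemma nrm_two_tori_ratio k rho z j : j != k -> two_tori k rho z ->
  nrm (tnth z k / tnth z j) = 1 \/ nrm (tnth z k / tnth z j) = rho.
Proof. by move=> jk [z1 zk]; rewrite nrmM nrmV (z1 _ jk) invr1 mulr1. Qed.

(** No pole is met: with [u = z_k / z_j] of modulus 1 or [1/|q|], the arguments [t * q * u] and
    [t / u] of the denominators have modulus at most [|t|]. *)
Lemma lapprox_kernel1 k : lapprox (two_tori k (nrm q^-1)) (kernel1 k).
Proof.
have q0 : 0 < nrm q^-1 by rewrite nrm_gt0 invr_eq0.
have bK := two_tori_bounded k q0.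
apply: lapproxM => //; last exact: lapprox_density_rest.
apply: lapprox_prod => // j jk.
apply: lapprox_eq (@lapprox_qpoch_ratio _ _ q_lt1 _ _ bK k j q 1 (t * q) t (nrm t) t_lt1 _ _) => [z _|z|z].
- by rewrite /= mul1r.
- move=> Kz; rewrite !(nrmM t, nrmM (t * q)) -mulrA ler_piMr ?nrm_ge0 //.
  case: (nrm_two_tori_ratio jk Kz) => ->; first by rewrite mulr1 ltW.
  by rewrite nrmV mulfV // nrm_eq0.
- move=> Kz; rewrite (nrmM t) ler_piMr ?nrm_ge0 // nrmV.
  case: (nrm_two_tori_ratio jk Kz) => ->; first by rewrite invr1.
  by rewrite nrmV invrK ltW.
Qed.

Lemma lapprox_laurent_shift K k a s : lapprox K (fun z => laurent s (shift_var k a (tnth z))).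
Proof. by apply: lapprox_eq (lapprox_laurent K _) => z _; rewrite -laurent_shift. Qed.

Lemma lapprox_laurent_inv K s : lapprox K (fun z => laurent s (fun i => (tnth z i)^-1)).
Proof. by apply: lapprox_eq (lapprox_laurent K _) => z _; rewrite -laurent_inv. Qed.

(** The contour shift [z_k -> z_k / q] carries the [k]-th term of the left side to the [k]-th term
    of the right side: it undoes the [q]-shift in [s1], creates one in the inverted argument of
    [s2], and inverts the kernel by [kernel1_shift]. *)
Lemma Dop_adjoint s1 s2 :
  torus_integral (fun z => Dop q t (laurent s1) (tnth z) *
    laurent s2 (fun i => (tnth z i)^-1) * macdonald_density q t z) =
  torus_integral (fun z => laurent s1 (tnth z) *
    Dop q t (laurent s2) (fun i => (tnth z i)^-1) * macdonald_density q t z).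
Proof.
pose G k z := kernel1 k z * laurent s1 (shift_var k q (tnth z)) *
  laurent s2 (fun i => (tnth z i)^-1).
pose H k z := kernel1 k (inv_tuple z) * laurent s1 (tnth z) *
  laurent s2 (shift_var k q (fun i => (tnth z i)^-1)).
have q0 : 0 < nrm q^-1 by rewrite nrm_gt0 invr_eq0.
have GA k : lapprox (two_tori k (nrm q^-1)) (G k).
  apply: lapproxM; [exact: two_tori_bounded| |exact: lapprox_laurent_inv].
  apply: lapproxM; [exact: two_tori_bounded|exact: lapprox_kernel1|].
  exact: lapprox_laurent_shift.
have HE k z : T z -> H k z = G k (scale_tuple k q^-1 z).
  move=> Tz; rewrite /G /H (kernel1_shift k Tz) !tnth_scale shift_varM (mulfV q_neq0) shift_var1.
  by rewrite shift_var_inv invrK.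
have HA k : lapprox T (H k).
  apply: lapproxM; [exact: on_torus_bounded| |].
    apply: lapproxM; [exact: on_torus_bounded| |exact: lapprox_laurent].
    exact/lapprox_inv/lapprox_two_tori/lapprox_kernel1.
  apply: lapprox_eq (lapprox_inv (lapprox_laurent_shift T k q s2)) => z _.
  by rewrite tnth_inv.
transitivity (\sum_k torus_integral (G k)).
  rewrite -torus_integral_sum => [|k _]; last exact: lapprox_two_tori (GA k).
  apply: eq_torus_integral => z Tz; rewrite /Dop !mulr_suml; apply: eq_bigr => k _.
  by rewrite /G -(kernel1E k Tz); ring.
transitivity (\sum_k torus_integral (H k)).
  apply: eq_bigr => k _; apply: etrans (esym (torus_integral_shift (GA k))) _.
  by apply: eq_torus_integral => z Tz; rewrite HE.
rewrite -torus_integral_sum //.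
apply: eq_torus_integral => z Tz; rewrite /Dop mulr_sumr mulr_suml; apply: eq_bigr => k _.
by rewrite /H -(kernel1_inv k Tz); ring.
Qed.

End Adjoint.

(** * Lagrange interpolation and the identity between rational functions *)

Section LagrangeSum.
Variable F : fieldType.

(** Compare the coefficients of degree [#|I|.-1] in [g] and in its Lagrange interpolant [h]. *)
Lemma lagrange_leading_sum (I : finType) (y : I -> F) (g : {poly F}) : injective y ->
  (size g <= #|I|)%N ->
  \sum_k g.[y k] / \prod_(l | l != k) (y k - y l) = g`_(#|I|.-1).
Proof.
move=> yI sg.
pose B k : {poly F} := \prod_(l | l != k) ('X - (y l)%:P).
have sB k : size (B k) = #|I|.
  rewrite /B -big_filter size_prod_XsubC size_filter -sum1_count sum1_card cardC1.
  by rewrite prednK //; apply/card_gt0P; exists k.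
have Bm k : B k \is monic by apply: monic_prod_XsubC.
have d0 k : \prod_(l | l != k) (y k - y l) != 0.
  apply/prodf_neq0 => l lk; rewrite subr_eq0; apply: contra lk => /eqP /yI ->.
  by rewrite eqxx.
pose h := \sum_k (g.[y k] / \prod_(l | l != k) (y k - y l)) *: B k.
have hy k : h.[y k] = g.[y k].
  have B0 l : l != k -> ((g.[y l] / \prod_(j | j != l) (y l - y j)) *: B l).[y k] = 0.
    move=> lk; rewrite hornerZ; have -> : (B l).[y k] = 0; last by rewrite mulr0.
    by rewrite /B horner_prod (bigD1 k) 1?eq_sym //= hornerXsubC subrr mul0r.
  rewrite /h horner_sum (bigD1 k) //= (eq_bigr (fun=> 0) B0) big1_eq addr0.
  rewrite hornerZ; have -> : (B k).[y k] = \prod_(l | l != k) (y k - y l).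
    by rewrite /B horner_prod; apply: eq_bigr => l _; rewrite hornerXsubC.
  by rewrite divfK.
have -> : g = h.
  apply/eqP; rewrite -subr_eq0; apply/negPn/negP => gh0.
  have := max_poly_roots gh0 (rs := [seq y k | k <- enum I]).
  rewrite size_map -cardE map_inj_uniq ?enum_uniq //.
  move/(_ _ isT) => lt; have : (#|I| < size (g - h)%R)%N.
    apply: lt; apply/allP => _ /mapP[k _ ->].
    by rewrite /root hornerD hornerN hy subrr.
  rewrite ltnNge => /negP; apply.
  apply: leq_trans (size_polyD _ _) _; rewrite size_polyN geq_max sg /=.
  apply: leq_trans (size_sum _ _ _) _; apply/bigmax_leqP => k _.
  by apply: leq_trans (size_scale_leq _ _) _; rewrite sB.
rewrite /h coef_sum; apply: eq_bigr => k _; rewrite coefZ hy.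
by have /monicP := Bm k; rewrite /lead_coef sB => ->; rewrite mulr1.
Qed.

End LagrangeSum.

Section SourceIdentity.
Variable R : realType.
Local Notation F := R[i].

(* Lagrange interpolation at the nodes [0], [z_i] and [c z_i]. *)
Lemma source_identity (n : nat) (t c : F) (z : 'I_n -> F) :
  t != 0 -> t != 1 -> c != 0 -> c != 1 -> (forall i, z i != 0) -> injective z ->
  (forall i j, z i != c * z j) -> (forall i j, z i != t * z j) ->
  \sum_i \prod_(j < n | j != i) source_ratio t c (z i / z j) =
  \sum_i \prod_(j < n | j != i) source_ratio t c (z j / z i).
Proof.
move=> t0 t1 c0 c1 z0 zI zc zt.
(* If [c = t], every factor equals [t]. The case is separated because the constant [kappa] below, to
   be cancelled, would vanish. *)
have [ct|ct] := eqVneq c t.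
  apply: eq_bigr => i _; apply: eq_bigr => j ji; rewrite /source_ratio ct.
  have e1 (a b : 'I_n) : a != b -> (t - t * (z a / z b)) * (z a / z b - t) /
      ((z a / z b - 1) * (t - z a / z b)) = t.
    move=> ab; have h1 : z a - z b != 0 by rewrite subr_eq0 (inj_eq zI).
    have h2 : t * z b - z a != 0 by rewrite subr_eq0 eq_sym.
    by field; rewrite mulN1r z0 h1 h2.
  by rewrite !e1 // eq_sym.
pose I : finType := (unit + ('I_n + 'I_n))%type.
pose y (k : I) : F := match k with
  inl _ => 0 | inr (inl i) => z i | inr (inr i) => c * z i end.
have yI : injective y.
  have zc' i j : (z i = c * z j) -> False by move/eqP; rewrite (negbTE (zc i j)).
  have z0' i : z i = 0 -> False by move/eqP; rewrite (negbTE (z0 i)).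
  have cz0' i : c * z i = 0 -> False.
    by move/eqP; rewrite mulf_eq0 (negbTE c0) (negbTE (z0 i)).
  move=> [[]|[i|i]] [[]|[j|j]] //= E.
  - by case: (z0' _ (esym E)).
  - by case: (cz0' _ (esym E)).
  - by case: (z0' _ E).
  - by rewrite (zI _ _ E).
  - by case: (zc' _ _ E).
  - by case: (cz0' _ E).
  - by case: (zc' _ _ (esym E)).
  - by rewrite (zI _ _ (mulfI c0 E)).
(* [g] takes the value [\prod_j (c z_j - t w) (w - t z_j)] at [w]. Its leading coefficient
   [(- t) ^+ n] is also the contribution of the node 0, so the contributions of the nodes [z_i] and
   [c z_i] cancel; these are the two sides, up to [kappa] and [- kappa]. *)
pose g0 : {poly F} := (\prod_(j < n) ('X - (c * z j / t)%:P)) *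
                     \prod_(j < n) ('X - (t * z j)%:P).
pose g := (- t) ^+ n *: g0.
have mg0 : g0 \is monic by rewrite monicMl monic_prod_XsubC.
have cI : #|I| = (n + n).+1 by rewrite !card_sum card_unit !card_ord.
have sg0 : size g0 = (n + n).+1.
  rewrite size_monicM ?monic_prod_XsubC ?monic_neq0 ?monic_prod_XsubC //.
  have sI : size (index_enum (ordinal n)) = n by rewrite -sum1_size big_const_ord iter_addn_0 mul1n.
  by rewrite !size_prod_XsubC sI addSn addnS.
have gE w : g.[w] = \prod_(j < n) ((c * z j - t * w) * (w - t * z j)).
  rewrite hornerZ hornerM !horner_prod mulrA.
  under [X in _ * X * _]eq_bigr do rewrite hornerXsubC.
  under [X in _ * X]eq_bigr do rewrite hornerXsubC.
  rewrite -[n in _ ^+ n]card_ord -prodr_const -!big_split /=.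
  by apply: eq_bigr => j _; congr (_ * _); field.
have := lagrange_leading_sum (g := g) yI.
rewrite cI (leq_trans (size_scale_leq _ _)) ?sg0 // => /(_ isT).
rewrite /= coefZ; have /monicP := mg0; rewrite /lead_coef sg0 /= => ->; rewrite mulr1.
have G1 (P : pred unit) (G : unit -> F) : P =1 xpredT -> \prod_(u | P u) G u = G tt.
  by move=> PT; rewrite (big_pred1 tt) // => -[]; rewrite PT.
have G0 (P : pred unit) (G : unit -> F) : P =1 xpred0 -> \prod_(u | P u) G u = 1.
  by move=> PT; rewrite big_pred0.
have S1 (G : unit -> F) : \sum_u G u = G tt by rewrite (big_pred1 tt) // => -[].
rewrite big_sumType S1 big_sumType.
have E0 : g.[y (inl tt)] / \prod_(l | l != inl tt) (y (inl tt) - y l) = (- t) ^+ n.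
  rewrite gE !big_sumType /= G0; last by case.
  rewrite mul1r.
  rewrite -big_split -prodf_div -[n in _ ^+ n]card_ord -prodr_const /=.
  by apply: eq_bigr => j _; field; rewrite z0 c0.
(* The factor of index [j = i] in the contribution of the node [z_i], with one sign for each other
   [j]. *)
pose kappa := (c - t) * (1 - t) / (1 - c) * (-1) ^+ n.-1.
have kappa0 : kappa != 0.
  rewrite !mulf_neq0 ?invr_eq0 ?subr_eq0 ?signr_eq0 //; first by rewrite eq_sym.
  by rewrite eq_sym.
have sgn (i : 'I_n) : (-1) ^+ n.-1 = \prod_(j < n | j != i) (-1) :> F.
  by rewrite prodr_const cardC1 card_ord.
have c1' : 1 - c != 0 by rewrite subr_eq0 eq_sym.
have zz (i j : 'I_n) : j != i -> z i - z j != 0.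
  by move=> ji; rewrite subr_eq0 (inj_eq zI) eq_sym.
have zcz (i j : 'I_n) : z i - c * z j != 0 by rewrite subr_eq0.
have E1 i : g.[y (inr (inl i))] / \prod_(l | l != inr (inl i)) (y (inr (inl i)) - y l) =
    kappa * \prod_(j < n | j != i) source_ratio t c (z i / z j).
  rewrite gE !big_sumType /= G1 // subr0 /kappa (sgn i) -!mulrA -big_split /=.
  rewrite (bigD1 i) //= (bigD1 (F := fun j => z i - c * z j) i) //=.
  have -> : \prod_(j < n | j != i) (-1 * source_ratio t c (z i / z j)) =
      \prod_(j < n | j != i) ((c * z j - t * z i) * (z i - t * z j)) /
      (\prod_(j < n | j != i) (z i - z j) * \prod_(j < n | j != i) (z i - c * z j)).
    rewrite -big_split -prodf_div /=; apply: eq_bigr => j ji; rewrite /source_ratio.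
    by field; rewrite zcz zz // z0 -opprB oppr_eq0 zcz.
  have h1 : \prod_(j < n | j != i) (z i - z j) != 0 by apply/prodf_neq0 => j; exact: zz.
  have h2 : \prod_(j < n | j != i) (z i - c * z j) != 0 by apply/prodf_neq0.
  by field; rewrite h1 h2 c1' zcz z0.
have E2 i : g.[y (inr (inr i))] / \prod_(l | l != inr (inr i)) (y (inr (inr i)) - y l) =
    - (kappa * \prod_(j < n | j != i) source_ratio t c (z j / z i)).
  rewrite gE !big_sumType /= G1 // subr0 /kappa (sgn i) -!mulrA -big_split /=.
  rewrite (bigD1 i) //= (bigD1 (F := fun j => c * z i - z j) i) //=.
  have -> : \prod_(j < n | j != i) (-1 * source_ratio t c (z j / z i)) =
      \prod_(j < n | j != i) ((c * z j - t * (c * z i)) * (c * z i - t * z j)) /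
      (\prod_(j < n | j != i) (c * z i - z j) * \prod_(j < n | j != i) (c * z i - c * z j)).
    rewrite -big_split -prodf_div /=; apply: eq_bigr => j ji; rewrite /source_ratio.
    have h1 : c * z i - z j != 0 by rewrite -opprB oppr_eq0.
    have h2 : c * z i - c * z j != 0 by rewrite -mulrBr mulf_neq0 // zz.
    by field; rewrite mulN1r h1 h2 z0 -opprB oppr_eq0 zz.
  have h1 : \prod_(j < n | j != i) (c * z i - z j) != 0.
    by apply/prodf_neq0 => j _; rewrite -opprB oppr_eq0.
  have h2 : \prod_(j < n | j != i) (c * z i - c * z j) != 0.
    by apply/prodf_neq0 => j ji; rewrite -mulrBr mulf_neq0 // zz.
  have h3 : c * z i - z i != 0 by rewrite -opprB oppr_eq0.
  by field; rewrite h1 h2 h3 c1' z0 c0.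
rewrite E0 -[RHS]addr0 => /addrI.
rewrite (eq_bigr _ (fun i _ => E1 i)) (eq_bigr _ (fun i _ => E2 i)) sumrN -!mulr_sumr.
by move/eqP; rewrite subr_eq0 => /eqP /(mulfI kappa0).
Qed.

End SourceIdentity.

(** * Indexing the doubled arguments *)

Section Doubling.
Variable n : nat.
Local Notation N := (2 * n)%N.

Lemma doubled_index_subproof (i : 'I_n) (b : bool) : (b + i.*2 < N)%N.
Proof. by have := ltn_ord i; case: b; lia. Qed.

(** The slot of [r z_i] is [b = false] and that of [r^-1 z_i] is [b = true], in accordance with the
    parity test in [doubled_args]. *)
Definition doubled_index (i : 'I_n) (b : bool) : 'I_N := Ordinal (doubled_index_subproof i b).

Lemma half_index_subproof (k : 'I_N) : (k./2 < n)%N.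
Proof. by have := ltn_ord k; lia. Qed.

Definition half_index (k : 'I_N) : 'I_n := Ordinal (half_index_subproof k).

Lemma half_doubled i b : half_index (doubled_index i b) = i.
Proof. by apply: val_inj; rewrite /= half_bit_double. Qed.

Lemma odd_doubled i b : odd (doubled_index i b) = b.
Proof. by rewrite /= oddD odd_double addbF; case: b. Qed.

Lemma doubled_half k : doubled_index (half_index k) (odd k) = k.
Proof. by apply: val_inj; rewrite /= odd_double_half. Qed.

Lemma doubled_index_eq i b j c :
  (doubled_index i b == doubled_index j c) = (i == j) && (b == c).
Proof.
apply/eqP/andP => [E|[/eqP -> /eqP ->] //].
split; apply/eqP; first by have := congr1 half_index E; rewrite !half_doubled.
by have := congr1 (fun k : 'I_N => odd k) E; rewrite !odd_doubled.
Qed.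

Lemma big_doubled (C : Type) (idx : C) (op : Monoid.com_law idx) (P : pred 'I_N) (G : 'I_N -> C) :
  \big[op/idx]_(k < N | P k) G k =
  \big[op/idx]_(i < n) \big[op/idx]_(b | P (doubled_index i b)) G (doubled_index i b).
Proof.
rewrite (reindex (fun x : 'I_n * bool => doubled_index x.1 x.2)) /=; last first.
  exists (fun k => (half_index k, odd k)) => [[i b] _|k _] /=; last exact: doubled_half.
  by rewrite half_doubled -[odd _]/(odd (doubled_index i b)) odd_doubled.
by rewrite pair_big_dep /=.
Qed.

Lemma prod_doubled_excl (C : comNzRingType) i b (G : 'I_N -> C) :
  \prod_(k < N | k != doubled_index i b) G k =
  G (doubled_index i (~~ b)) *
  \prod_(j < n | j != i) (G (doubled_index j false) * G (doubled_index j true)).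
Proof.
rewrite big_doubled (bigD1 i) //=; congr (_ * _); last apply: eq_bigr.
  by rewrite (big_pred1 (~~ b)) // => c; rewrite doubled_index_eq eqxx; case: b c => -[].
move=> j /negbTE ji; rewrite (eq_bigl xpredT) => [|c]; first by rewrite big_bool mulrC.
by rewrite doubled_index_eq ji.
Qed.

(** Exchanges the slots of [r z_i] and [r^-1 z_i]. Inverting all the doubled arguments amounts to
    inverting [z] and swapping. *)
Definition swap_index (k : 'I_N) : 'I_N := doubled_index (half_index k) (~~ odd k).

Lemma swap_indexK : involutive swap_index.
Proof. by move=> k; rewrite /swap_index half_doubled odd_doubled negbK doubled_half. Qed.

Definition swap_perm : {perm 'I_N} := perm (can_inj swap_indexK).

Lemma half_swap k : half_index (swap_perm k) = half_index k.
Proof. by rewrite permE half_doubled. Qed.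

Lemma odd_swap k : odd (swap_perm k) = ~~ odd k.
Proof. by rewrite permE odd_doubled. Qed.

End Doubling.

(** * Coefficients of the operator at the doubled arguments *)

Section DoubledIntegral.
Variable R : realType.
Local Notation C := R[i].
Variables r t : C.
Local Notation p := (r ^+ 2).
Local Notation q := (r ^+ 4).
Hypotheses (r_neq0 : r != 0) (p_lt1 : nrm p < 1) (t_neq0 : t != 0) (t_lt1 : nrm t < 1).
Variable n : nat.
Local Notation N := (2 * n)%N.
Local Notation T := (@on_torus R n).
Local Notation density := (@macdonald_density R p t n).
Implicit Types (z : n.-tuple C) (s : seq (C * {ffun 'I_N -> int})).

Definition dilate (c : 'I_N -> C) z : 'I_N -> C := fun k => c k * tnth z (half_index k).

Definition doubled_coef (k : 'I_N) : C := if odd k then r^-1 else r.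

Lemma doubled_argsE z : doubled_args r z = dilate doubled_coef z.
Proof. by apply/funext => k; rewrite /doubled_args /dilate (tnth_nth 0). Qed.

Lemma dilate_neq0 c z k : (forall k, c k != 0) -> T z -> dilate c z k != 0.
Proof. by move=> c0 Tz; rewrite mulf_neq0 // (on_torus_neq0 _ Tz). Qed.

Lemma lapprox_laurent_dilate K c s : bounded_units K ->
  lapprox K (fun z => laurent s (dilate c z)).
Proof.
move=> bK; apply: lapprox_sum => d _; apply: lapproxZ => //.
apply: lapprox_prod => // k _.
apply: lapprox_eq (lapproxZ bK (c k ^ d.2 k) (lapprox_coordX K (half_index k) (d.2 k))) => z _.
by rewrite /dilate expfzMl.
Qed.

Lemma shift_var_dilate k a c z : shift_var k a (dilate c z) = dilate (shift_var k a c) z.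
Proof. by apply/funext => l; rewrite /shift_var /dilate; case: (l == k); rewrite ?mulrA. Qed.

(** [kernel2] and [kernel3] are, up to the constants [beta] and [alpha], the density times the
    coefficients of the shifts of [r z_i] and of [r^-1 z_i], with the poles at [z_i = z_j]
    cancelled. *)
Definition kernel2 (i : 'I_n) z : C :=
  (\prod_(j < n | j != i) theta2 p t (tnth z i / tnth z j)) * density_rest p t i z.

Definition kernel3 (i : 'I_n) z : C :=
  (\prod_(j < n | j != i) theta3 p t (tnth z i / tnth z j)) * density_rest p t i z.

(** The factor of [Dcoef] due to the other argument attached to the same [z_i]: the ratio of the two
    is [p] here and [p^-1] in [alpha]. *)
Definition beta : C := (t * p - 1) / (p - 1).

Definition alpha : C := (t / p - 1) / (p^-1 - 1).

Lemma Dcoef_doubled_false i z : T z ->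
  Dcoef t (doubled_index i false) (dilate doubled_coef z) * density z = beta * kernel2 i z.
Proof.
move=> Tz; have z0 j := on_torus_neq0 j Tz.
rewrite /Dcoef (prod_doubled_excl _ _ (fun k => (t * dilate doubled_coef z _ - dilate doubled_coef z k) /
  (dilate doubled_coef z _ - dilate doubled_coef z k))).
have assoc (a b c d : C) : a * b * (c * d) = a * ((b * c) * d) by ring.
rewrite (density_split p t i) assoc -big_split.
have dE j b : dilate doubled_coef z (doubled_index j b) = (if b then r^-1 else r) * tnth z j.
  by rewrite /dilate half_doubled /doubled_coef odd_doubled.
rewrite !dE; congr (_ * (_ * _)).
  have y0 : r^-1 * tnth z i != 0 by rewrite mulf_neq0 ?invr_eq0.
  have := ratio_normal t 1 (r * tnth z i) y0; rewrite !mul1r => ->.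
  by have -> : r * tnth z i / (r^-1 * tnth z i) = p by field; rewrite r_neq0 z0.
apply: eq_bigr => j ji; rewrite !dE.
have [u1 _] := nrm_ratio_torus (Tz i) (Tz j).
rewrite (theta2E p_lt1 t_lt1 u1) [LHS]mulrC; congr (_ * (_ * _)).
  have y0 : r * tnth z j != 0 by rewrite mulf_neq0.
  have := ratio_normal t 1 (r * tnth z i) y0; rewrite !mul1r => ->.
  by have -> : r * tnth z i / (r * tnth z j) = tnth z i / tnth z j by field; rewrite r_neq0 z0.
have y0 : r^-1 * tnth z j != 0 by rewrite mulf_neq0 ?invr_eq0.
have := ratio_normal t 1 (r * tnth z i) y0; rewrite !mul1r => ->.
by have -> : r * tnth z i / (r^-1 * tnth z j) = p * (tnth z i / tnth z j);
  [by field; rewrite r_neq0 z0|rewrite !mulrA].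
Qed.

Lemma Dcoef_doubled_true i z : T z ->
  Dcoef t (doubled_index i true) (dilate doubled_coef z) * density z = alpha * kernel3 i z.
Proof.
move=> Tz; have z0 j := on_torus_neq0 j Tz.
have p0 : p != 0 by rewrite expf_neq0.
rewrite /Dcoef (prod_doubled_excl _ _ (fun k => (t * dilate doubled_coef z _ - dilate doubled_coef z k) /
  (dilate doubled_coef z _ - dilate doubled_coef z k))).
have assoc (a b c d : C) : a * b * (c * d) = a * ((b * c) * d) by ring.
rewrite (density_split p t i) assoc -big_split.
have dE j b : dilate doubled_coef z (doubled_index j b) = (if b then r^-1 else r) * tnth z j.
  by rewrite /dilate half_doubled /doubled_coef odd_doubled.
rewrite !dE; congr (_ * (_ * _)).
  have y0 : r * tnth z i != 0 by rewrite mulf_neq0.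
  have := ratio_normal t 1 (r^-1 * tnth z i) y0; rewrite !mul1r => ->.
  by have -> : r^-1 * tnth z i / (r * tnth z i) = p^-1 by field; rewrite r_neq0 z0.
apply: eq_bigr => j ji; rewrite !dE.
have [u1 _] := nrm_ratio_torus (Tz i) (Tz j).
rewrite (theta3E p_lt1 t_lt1 p0 u1) [LHS]mulrC; congr (_ * (_ * _)).
  have y0 : r * tnth z j != 0 by rewrite mulf_neq0.
  have := ratio_normal t 1 (r^-1 * tnth z i) y0; rewrite !mul1r => ->.
  have -> : r^-1 * tnth z i / (r * tnth z j) = tnth z i / tnth z j / p by field; rewrite r_neq0 z0.
  by rewrite !mulrA.
have y0 : r^-1 * tnth z j != 0 by rewrite mulf_neq0 ?invr_eq0.
have := ratio_normal t 1 (r^-1 * tnth z i) y0; rewrite !mul1r => ->.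
by have -> : r^-1 * tnth z i / (r^-1 * tnth z j) = tnth z i / tnth z j by field; rewrite r_neq0 z0.
Qed.

End DoubledIntegral.

Section ScaleApprox.
Variable R : realType.
Variable n : nat.

Lemma lapprox_scale k (a : R[i]) (f : n.-tuple R[i] -> R[i]) :
  lapprox (two_tori k (nrm a)) f ->
  lapprox (@on_torus R n) (fun z => f (scale_tuple k a z)).
Proof.
move=> fA e /fA[s hs].
exists [seq (c.1 * a ^ c.2 k, c.2) | c : R[i] * {ffun 'I_n -> int} <- s].
move=> z Tz; rewrite laurent_shift -/(shift_var k a (tnth z)) -tnth_scale; apply: hs.
split=> [i /negbTE ik|]; rewrite tnth_mktuple ?ik ?eqxx; first exact: Tz.
by right; rewrite nrmM Tz mulr1.
Qed.

Lemma torus_integral_sum2 (I : Type) (l : seq I) (G H : I -> n.-tuple R[i] -> R[i]) (a b : R[i]) :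
  (forall i, lapprox (@on_torus R n) (G i)) -> (forall i, lapprox (@on_torus R n) (H i)) ->
  torus_integral (fun z => \sum_(i <- l) (a * G i z + b * H i z)) =
  a * \sum_(i <- l) torus_integral (G i) + b * \sum_(i <- l) torus_integral (H i).
Proof.
move=> GA HA; have bT := @on_torus_bounded R n.
have Ga i := lapproxZ bT a (GA i); have Hb i := lapproxZ bT b (HA i).
rewrite torus_integral_sum => [|i _]; last exact: lapproxD.
rewrite !mulr_sumr -big_split; apply: eq_bigr => i _.
by rewrite torus_integralD // !torus_integralZ.
Qed.

End ScaleApprox.

(** * Invariance under inversion of the integral at the doubled arguments *)

Section DoubledVanishing.
Variable R : realType.
Local Notation C := R[i].
Variables r t : C.
Local Notation p := (r ^+ 2).
Local Notation q := (r ^+ 4).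
Hypotheses (r_neq0 : r != 0) (p_lt1 : nrm p < 1) (t_neq0 : t != 0) (t_lt1 : nrm t < 1).
Variable n : nat.
Local Notation N := (2 * n)%N.
Local Notation T := (@on_torus R n).
Local Notation density := (@macdonald_density R p t n).
Local Notation dc := (@doubled_coef R r n).
Implicit Types (z : n.-tuple C) (s : seq (C * {ffun 'I_N -> int})).

Let p_neq0 : p != 0. Proof. by rewrite expf_neq0. Qed.

Let pV_gt0 : 0 < nrm p^-1. Proof. by rewrite nrm_gt0 invr_eq0. Qed.

Let bT := @on_torus_bounded R n.

Let bK (i : 'I_n) := two_tori_bounded i pV_gt0.

Lemma dilate_scale i a c z : dilate c (scale_tuple i a z) =
  dilate (fun k => if half_index k == i then a * c k else c k) z.
Proof.
apply/funext => k; rewrite /dilate tnth_mktuple; case: ifP => // _.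
by rewrite mulrCA mulrA.
Qed.

Lemma nrm_kernel_denominators i j z m : j != i -> two_tori i (nrm p^-1) z -> (0 < m)%N ->
  nrm (t * p ^+ m * (tnth z i / tnth z j)) <= nrm t /\
  nrm (t * (tnth z i / tnth z j)^-1) <= nrm t.
Proof.
move=> ji Kz; case: m => // m _; rewrite exprSr.
have pm : nrm p ^+ m <= 1 by rewrite exprn_ile1 ?nrm_ge0 // ltW.
split.
  have -> v : t * (p ^+ m * p) * v = t * (p ^+ m * (p * v)) by rewrite -(mulrA t) -(mulrA (p ^+ m)).
  rewrite (nrmM t) ler_piMr ?nrm_ge0 // (nrmM (p ^+ m)) (nrmX p).
  apply: mulr_ile1; rewrite ?exprn_ge0 ?nrm_ge0 ?pm //.
  rewrite (nrmM p); case: (nrm_two_tori_ratio ji Kz) => ->; first by rewrite mulr1 ltW.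
  by rewrite nrmV mulfV // nrm_eq0.
rewrite (nrmM t) ler_piMr ?nrm_ge0 // nrmV.
case: (nrm_two_tori_ratio ji Kz) => ->; first by rewrite invr1.
by rewrite nrmV invrK ltW.
Qed.

Lemma lapprox_kernel2 i : lapprox (two_tori i (nrm p^-1)) (@kernel2 R r t n i).
Proof.
apply: lapproxM => //; last exact: lapprox_density_rest.
apply: lapprox_prod => // j ji.
apply: lapprox_eq (@lapprox_qpoch_ratio _ _ p_lt1 _ _ (@bK i) i j (p ^+ 2) 1 (t * p ^+ 2) t
  (nrm t) t_lt1 _ _) => [z _|z|z].
- by rewrite /= mul1r.
- by move=> /nrm_kernel_denominators -/(_ _ 2 ji isT)[].
- by move=> /nrm_kernel_denominators -/(_ _ 2 ji isT)[].
Qed.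

Lemma lapprox_kernel3 i : lapprox (two_tori i (nrm p^-1)) (@kernel3 R r t n i).
Proof.
apply: lapproxM => //; last exact: lapprox_density_rest.
apply: lapprox_prod => // j ji.
pose u z := tnth z i / tnth z j : C.
have uA := lapprox_ratio (@bK i) i j; have uVA := lapprox_ratioV (@bK i) i j.
have h := @lapprox_qpoch_ratio _ _ p_lt1 _ _ (@bK i) j i (p ^+ 2) p t (t * p) (nrm t) t_lt1.
apply: (@lapprox_eq _ _ _ _ (fun z => ((1 + (- t / p) * u z) * (- p * (u z)^-1) * (1 + -1 * (u z)^-1)) *
  (qpoch (p ^+ 2 * (tnth z j / tnth z i)) p * qpoch (p * (tnth z j / tnth z i)^-1) p /
    (qpoch (t * (tnth z j / tnth z i)) p * qpoch ((t * p) * (tnth z j / tnth z i)^-1) p)))).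
  move=> z _; rewrite /theta3 -/(u z).
  have -> : tnth z j / tnth z i = (u z)^-1 by rewrite /u invfM invrK mulrC.
  by rewrite invrK (mulrC (qpoch (t / u z) p)) [RHS]mulrA; congr (_ * _ / _); ring.
have uE z : (tnth z j / tnth z i)^-1 = tnth z i / tnth z j.
  by rewrite invfM invrK mulrC.
apply: lapproxM => //; last first.
  apply: h => z Kz; have := @nrm_kernel_denominators i j z 1 ji Kz isT.
    by rewrite -uE invrK => -[].
  by rewrite expr1 uE => -[].
by repeat (apply: lapproxM => //); try apply: lapproxD; try apply: lapproxZ => //;
  exact: lapprox_cst.
Qed.

(* After the contour shift the arguments attached to [z_i] are [r^3 z_i] and
   [r^-3 z_i], which the inversion of [z] merely exchanges. *)
Definition wide_coef (i : 'I_n) (k : 'I_N) : C :=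
  if half_index k == i then p^-1 * shift_var (doubled_index i false) q dc k else dc k.

Definition source_sum z : C :=
  \sum_(i < n) \prod_(j < n | j != i) source_ratio t (p ^+ 2) (tnth z i / tnth z j).

(** [H2] and [H3] are the integrands after the contour shift. The arguments of [s] in [H3] do not
    depend on [i], so the kernels are already summed there into [source_sum]. *)
Let H2 s i z := kernel2 r t i (scale_tuple i p^-1 z) * laurent s (dilate (wide_coef i) z).

Let H3 s z := density z * source_sum z * laurent s (dilate dc z).

Definition laurent_symmetric s := forall (g : {perm 'I_N}) (x : 'I_N -> C),
  (forall k, x k != 0) -> laurent s (fun k => x (g k)) = laurent s x.

Let dc_neq0 k : dc k != 0.
Proof. by rewrite /doubled_coef; case: ifP => _; rewrite ?invr_eq0. Qed.

Lemma kernel3_scale i z : T z -> kernel3 r t i (scale_tuple i p^-1 z) =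
  density z * \prod_(j < n | j != i) source_ratio t (p ^+ 2) (tnth z i / tnth z j).
Proof.
move=> Tz; rewrite (density_split _ _ i) /kernel3 density_rest_scale mulrAC; congr (_ * _).
rewrite -big_split; apply: eq_bigr => j ji; rewrite scale_ratio //.
by have [u1 _] := nrm_ratio_torus (Tz i) (Tz j); rewrite theta3_shift.
Qed.

Let H2A s i : lapprox T (H2 s i).
Proof.
apply: lapproxM => //; first exact: lapprox_scale (@lapprox_kernel2 i).
exact: lapprox_laurent_dilate.
Qed.

Let H3E s z : T z -> H3 s z =
  \sum_(i < n) kernel3 r t i (scale_tuple i p^-1 z) * laurent s (dilate dc z).
Proof.
move=> Tz; rewrite /H3 /source_sum [X in X * laurent _ _]mulr_sumr mulr_suml.
by apply: eq_bigr => i _; rewrite kernel3_scale.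
Qed.

Let H3A s : lapprox T (H3 s).
Proof.
apply: lapprox_eq (@H3E s) _; apply: lapprox_sum => i _.
apply: lapproxM => //; first exact: lapprox_scale (@lapprox_kernel3 i).
exact: lapprox_laurent_dilate.
Qed.

Lemma doubled_integral_Dop s : laurent_symmetric s ->
  torus_integral (fun z => Dop q t (laurent s) (doubled_args r z) * density z) =
  beta r t * \sum_(i < n) torus_integral (H2 s i) + alpha r t * torus_integral (H3 s).
Proof.
move=> ss.
pose G2 i z := kernel2 r t i z * laurent s (dilate (shift_var (doubled_index i false) q dc) z).
pose G3 i z := kernel3 r t i z * laurent s (dilate (shift_var (doubled_index i true) q dc) z).
have G2A i : lapprox (two_tori i (nrm p^-1)) (G2 i).
  by apply: lapproxM; [exact: bK|exact: lapprox_kernel2|exact: lapprox_laurent_dilate].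
have G3A i : lapprox (two_tori i (nrm p^-1)) (G3 i).
  by apply: lapproxM; [exact: bK|exact: lapprox_kernel3|exact: lapprox_laurent_dilate].
have G2T i := lapprox_two_tori (G2A i); have G3T i := lapprox_two_tori (G3A i).
have E2 i : torus_integral (G2 i) = torus_integral (H2 s i).
  apply: etrans (esym (torus_integral_shift (G2A i))) _.
  apply: eq_torus_integral => z Tz; rewrite /G2.
  rewrite (dilate_scale i _ (shift_var (doubled_index i false) q dc) z).
  suff -> : (fun k => if half_index k == i then p^-1 * shift_var (doubled_index i false) q dc k
      else shift_var (doubled_index i false) q dc k) = wide_coef i by [].
  apply/funext => k; rewrite /wide_coef; case: eqP => // ki.
  by rewrite /shift_var; case: eqP => // E'; case: ki; rewrite E' half_doubled.
have E3 : \sum_(i < n) torus_integral (G3 i) = torus_integral (H3 s).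
  apply/esym; apply: etrans (eq_torus_integral (@H3E s)) _.
  rewrite torus_integral_sum => [|i _]; last first.
    apply: lapproxM => //; first exact: lapprox_scale (@lapprox_kernel3 i).
    exact: lapprox_laurent_dilate.
  apply/esym/eq_bigr => i _; apply: etrans (esym (torus_integral_shift (G3A i))) _.
  apply: eq_torus_integral => z Tz; rewrite /G3; congr (_ * _).
  rewrite (dilate_scale i _ (shift_var (doubled_index i true) q dc) z).
  (* After the contour shift the two arguments attached to [z_i] are the original ones exchanged;
     the symmetry of [s] puts them back. *)
  rewrite -(ss (tperm (doubled_index i false) (doubled_index i true)) (dilate dc z)); last first.
    by move=> k; exact: dilate_neq0.
  congr laurent; apply/funext => k; rewrite /dilate.
  have E b : dc (doubled_index i b) = if b then r^-1 else r.
    by rewrite /doubled_coef odd_doubled.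
  rewrite -(doubled_half k); move: (half_index k) (odd k) => j b; rewrite half_doubled.
  case: (eqVneq j i) => [->|ji]; last first.
    have h c : doubled_index i c != doubled_index j b by rewrite doubled_index_eq eq_sym (negbTE ji).
    by rewrite (tpermD (h false) (h true)) half_doubled /shift_var eq_sym (negbTE (h true)).
  rewrite /shift_var; case: b.
    rewrite eqxx tpermR !E half_doubled; congr (_ * _); field.
    by rewrite r_neq0.
  rewrite doubled_index_eq andbF tpermL !E half_doubled; congr (_ * _); field.
  by rewrite r_neq0.
have E2' : \sum_(i < n) torus_integral (G2 i) = \sum_(i < n) torus_integral (H2 s i).
  by apply: eq_bigr => i _; exact: E2.
apply: etrans (congr2 (fun a b => beta r t * a + alpha r t * b) E2' E3).
apply: etrans (torus_integral_sum2 (index_enum 'I_n) (beta r t) (alpha r t) G2T G3T).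
apply: eq_torus_integral => z Tz; rewrite doubled_argsE /Dop big_doubled mulr_suml.
apply: eq_bigr => i _; rewrite big_bool /= mulrDl addrC; congr (_ + _).
  rewrite mulrAC (Dcoef_doubled_false r_neq0 p_lt1 t_lt1 i Tz) shift_var_dilate.
  exact/esym/mulrA.
rewrite mulrAC (Dcoef_doubled_true r_neq0 p_lt1 t_lt1 i Tz) shift_var_dilate.
exact/esym/mulrA.
Qed.

Lemma kernel2_scale_inv i z : T z ->
  kernel2 r t i (scale_tuple i p^-1 (inv_tuple z)) = kernel2 r t i (scale_tuple i p^-1 z).
Proof.
move=> Tz; have z0 j := on_torus_neq0 j Tz.
rewrite /kernel2 !density_rest_scale; apply: (congr2 *%R).
  apply: eq_bigr => j ji; rewrite !(scale_ratio _ _ ji) !tnth_mktuple -(invfM (tnth z i)).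
  by rewrite -theta2_shift // mulf_neq0 ?invr_eq0.
apply: eq_bigr => j _; apply: eq_bigr => k _.
by rewrite !tnth_mktuple -[LHS]thetaV invfM !invrK.
Qed.

Lemma wide_coef_swap i (k : 'I_N) : (wide_coef i k)^-1 = wide_coef i (swap_perm n k).
Proof.
rewrite /wide_coef half_swap /shift_var /doubled_coef odd_swap.
rewrite -(doubled_half k); move: (half_index k) (odd k) => j b.
rewrite half_doubled odd_doubled permE /swap_index half_doubled odd_doubled !doubled_index_eq.
case: (eqVneq j i) => _; last by case: b; rewrite ?invrK.
by case: b => /=; field; rewrite r_neq0.
Qed.

Lemma wide_coef_neq0 i k : wide_coef i k != 0.
Proof.
have h : shift_var (doubled_index i false) q dc k != 0.
  rewrite /shift_var; case: ifP => _; last exact: dc_neq0.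
  by apply: mulf_neq0; [exact: expf_neq0|exact: dc_neq0].
rewrite /wide_coef; case: ifP => _; last exact: dc_neq0.
by apply: mulf_neq0; [rewrite invr_eq0|exact: h].
Qed.

Lemma doubled_coef_swap (k : 'I_N) : (dc k)^-1 = dc (swap_perm n k).
Proof. by rewrite /doubled_coef odd_swap; case: (odd k); rewrite ?invrK. Qed.

Lemma laurent_dilate_swap s (c : 'I_N -> C) z : laurent_symmetric s -> T z ->
  (forall k, c k != 0) -> (forall k, (c k)^-1 = c (swap_perm n k)) ->
  laurent s (fun k => (dilate c (inv_tuple z) k)^-1) = laurent s (dilate c z).
Proof.
move=> ss Tz c0 cV; rewrite -(ss (swap_perm n) (dilate c z)); last first.
  by move=> k; exact: dilate_neq0.
congr laurent; apply/funext => k; rewrite /dilate half_swap tnth_mktuple invfM invrK.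
by rewrite cV.
Qed.

Lemma source_sum_inv z : T z -> density z * source_sum z = density z * source_sum (inv_tuple z).
Proof.
move=> Tz; have z0 i := on_torus_neq0 i Tz.
(* The interpolation identity needs distinct [z_i]; at the other points the density vanishes. *)
have [/injectiveP zI|/injectivePn [i [j ij zij]]] := boolP (injectiveb (tnth z)); last first.
  by rewrite (@density_eq0 _ _ t p_lt1 _ z i j ij) // !mul0r.
congr (_ * _); rewrite /source_sum.
under [RHS]eq_bigr do under eq_bigr do rewrite !tnth_mktuple invrK mulrC.
have nz (c : C) i j : nrm c < 1 -> tnth z i != c * tnth z j.
  move=> c1; apply/eqP => E; have := Tz i; rewrite E nrmM Tz mulr1 => c1'.
  by move: c1; rewrite c1' ltxx.
have p2 : nrm (p ^+ 2) < 1 by rewrite (nrmX p) expr_lt1 ?nrm_ge0.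
have n1 (c : C) : nrm c < 1 -> c != 1.
  by move=> c1; apply/eqP => E; move: c1; rewrite E nrm1 ltxx.
apply: source_identity => //; [exact: n1|by rewrite !expf_neq0|exact: n1|..];
  by move=> i j; exact: nz.
Qed.

Lemma doubled_integral_Dop_inv s : laurent_symmetric s ->
  torus_integral (fun z => Dop q t (laurent s) (doubled_args r z) * density z) =
  torus_integral (fun z => Dop q t (laurent [seq (c.1, - c.2) | c <- s]) (doubled_args r z)
     * density z).
Proof.
move=> ss.
have ss' : laurent_symmetric [seq (c.1, - c.2) | c <- s].
  move=> g x x0; rewrite !laurent_inv; apply: (ss g (fun k => (x k)^-1)) => k.
  by rewrite invr_eq0.
have EB i : torus_integral (H2 s i) = torus_integral (H2 [seq (c.1, - c.2) | c <- s] i).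
  apply: etrans (torus_integral_inv (@H2A _ i)); apply: eq_torus_integral => z Tz.
  rewrite /H2 (kernel2_scale_inv i Tz) laurent_inv.
  by rewrite (laurent_dilate_swap ss Tz (@wide_coef_neq0 i) (@wide_coef_swap i)).
have EA : torus_integral (H3 s) = torus_integral (H3 [seq (c.1, - c.2) | c <- s]).
  apply: etrans (torus_integral_inv (@H3A _)); apply: eq_torus_integral => z Tz.
  rewrite /H3 density_inv -(source_sum_inv Tz) laurent_inv.
  by rewrite (laurent_dilate_swap ss Tz dc_neq0 doubled_coef_swap).
apply: etrans (doubled_integral_Dop ss) (etrans _ (esym (doubled_integral_Dop ss'))).
by rewrite EA (eq_bigr _ (fun i _ => EB i)).
Qed.

Lemma doubled_integral_inv s : laurent_symmetric s ->
  torus_integral (fun z => laurent s (doubled_args r z) * density z) =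
  torus_integral (fun z => laurent s (fun k => (doubled_args r z k)^-1) * density z).
Proof.
move=> ss.
have A : lapprox T (fun z => laurent s (doubled_args r z) * density z).
  apply: lapproxM => //; last exact: lapprox_density.
  apply: lapprox_eq (lapprox_laurent_dilate dc s bT) => z _.
  by rewrite doubled_argsE.
apply: etrans (esym (torus_integral_inv A)) _; apply: eq_torus_integral => z Tz.
rewrite density_inv !doubled_argsE; apply: (congr2 *%R _ (erefl _)).
by have := laurent_dilate_swap ss (on_torus_inv Tz) dc_neq0 doubled_coef_swap; rewrite inv_tupleK => ->.
Qed.

End DoubledVanishing.

(** * Divisibility of antisymmetric polynomials by the Vandermonde product *)

Section VandermondeDivisibility.
Variable A : comNzRingType.

Definition newton_poly (x : nat -> A) (l : nat) : {poly A} := \prod_(j < l) ('X - (x j)%:P).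

Lemma newton_expansion (x : nat -> A) (f : {poly A}) (k : nat) :
  exists (a : nat -> A) (g : {poly A}),
  f = \sum_(l < k) a l *: newton_poly x l + g * newton_poly x k.
Proof.
elim: k => [|k [a [g ->]]].
  by exists (fun=> 0), f; rewrite big_ord0 add0r /newton_poly big_ord0 mulr1.
have /factor_theorem [h gh] : root (g - (g.[x k])%:P) (x k).
  by rewrite /root hornerD hornerN hornerC subrr.
exists (fun l => if l == k then g.[x k] else a l), h.
rewrite big_ord_recr /= eqxx -addrA; congr (_ + _).
  by apply: eq_bigr => l _; rewrite (ltn_eqF (ltn_ord l)).
rewrite [in RHS]/newton_poly big_ord_recr /= -/(newton_poly x k).
rewrite [newton_poly x k * _]mulrC mulrA -gh mulrBl -mul_polyC addrC subrK //.
Qed.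

(** In the Newton basis at the points [x_i] the matrix factors as [L *m U]: [L] is lower triangular
    with the Vandermonde product as determinant, and [U] collects the Newton coefficients. No
    division occurs, so the [x_i] may be polynomial variables. *)
Lemma det_poly_vandermonde (N : nat) (x : 'I_N -> A) (f : 'I_N -> {poly A}) :
  exists c, \det (\matrix_(i < N, j < N) (f j).[x i]) =
    (\prod_(i < N) \prod_(j < N | (i < j)%N) (x j - x i)) * c.
Proof.
case: N x f => [|N] x f.
  by exists 1; rewrite det_mx00 big_ord0 mulr1.
pose y k := x (inord k).
have yE (i : 'I_N.+1) : y i = x i by rewrite /y inord_val.
have /choice [a ha] : forall j, exists a : nat -> A, exists g,
    f j = \sum_(l < N.+1) a l *: newton_poly y l + g * newton_poly y N.+1.
  by move=> j; have [a [g h]] := newton_expansion y (f j) N.+1; exists a, g.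
pose L := \matrix_(i < N.+1, l < N.+1) (newton_poly y l).[x i].
pose U := \matrix_(l < N.+1, j < N.+1) a j l.
have newton0 (i : 'I_N.+1) l : (i < l)%N -> (newton_poly y l).[x i] = 0.
  move=> il; rewrite horner_prod (bigD1 (Ordinal il)) //=.
  by rewrite hornerXsubC yE subrr mul0r.
exists (\det U).
have -> : \matrix_(i < N.+1, j < N.+1) (f j).[x i] = L *m U.
  apply/matrixP => i j; rewrite !mxE; have [g ->] := ha j.
  rewrite hornerD hornerM newton0 // mulr0 addr0 horner_sum.
  by apply: eq_bigr => l _; rewrite !mxE hornerZ mulrC.
rewrite det_mulmx det_trig; last first.
  by apply/is_trig_mxP => i l il; rewrite mxE newton0.
congr (_ * _); rewrite (exchange_big_dep xpredT) //=; apply: eq_bigr => i _.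
rewrite mxE horner_prod.
rewrite (big_ord_widen_cond N.+1 xpredT (fun j => ('X - (y j)%:P).[x i])) 1?ltnW //.
by apply: eq_bigr => j _; rewrite hornerXsubC yE.
Qed.

End VandermondeDivisibility.

Section AntisymmetricPolynomials.
Variable F : numFieldType.
Variable N : nat.
Local Notation P := (mpoly N F).
Local Notation X i := (mpolyX F (mnm1 i) : P).
Implicit Types (f g : P) (m : multinom N) (s : {perm 'I_N}).

Definition vandermonde_poly : P := \prod_(i < N) \prod_(j < N | (i < j)%N) (X j - X i).

Definition antisymmetric f := forall s, msym s f = (-1) ^+ s *: f.

Definition permute_mnm s m : multinom N := Multinom [tuple m (s i) | i < N].

Lemma permute_mnmE s m i : permute_mnm s m i = m (s i).
Proof. by rewrite mnm_tnth tnth_mktuple. Qed.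

Lemma mcoeff_msym f s m : mcoeff m (msym s f) = mcoeff (permute_mnm s m) f.
Proof. exact: mcoeff_sym. Qed.

Lemma msym_permX s m : msym s (mpolyX F m) = mpolyX F (permute_mnm s^-1%g m).
Proof. exact: msymX. Qed.

Lemma vandermonde_antisymmetric : antisymmetric vandermonde_poly.
Proof.
move=> s; pose v : 'rV[P]_N := \row_i X i.
have vE : vandermonde_poly = \det (Vandermonde N v).
  by rewrite det_Vandermonde; do 2!(apply: eq_bigr => ? _); rewrite !mxE.
rewrite vE -det_map_mx.
have -> : map_mx (msym s) (Vandermonde N v) = col_perm s (Vandermonde N v).
  apply/matrixP => i j; rewrite !mxE rmorphXn; congr (_ ^+ _).
  rewrite /= msym_permX; congr mpolyX; apply/mnmP => k.
  by rewrite permute_mnmE !mnmE; congr (nat_of_bool _); rewrite -(inj_eq (@perm_inj _ s)) permKV.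
by rewrite col_permE det_mulmx det_perm odd_permV mulrC mulr_sign -scaler_sign.
Qed.

Lemma vandermonde_poly_neq0 : vandermonde_poly != 0.
Proof.
apply/prodf_neq0 => i _; apply/prodf_neq0 => j ij; rewrite subr_eq0.
apply/eqP => /(congr1 (mcoeff (mnm1 j))); rewrite !mcoeffX !eqxx eq_mnm1.
by case: eqP ij => [-> /[!ltnn] //|_ _ /eqP]; rewrite oner_eq0.
Qed.

(** [g] is the average of its signed permutations, hence a combination of alternants. Each alternant
    is a determinant [det (x_i ^ m_j)], to which [det_poly_vandermonde] applies. *)
Lemma vandermonde_dvd g : antisymmetric g -> exists h, g = vandermonde_poly * h.
Proof.
move=> ga.
pose alt m : P := \sum_(s : {perm 'I_N}) (-1) ^+ s *: mpolyX F (permute_mnm s m).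
have altE m : exists c, alt m = vandermonde_poly * c.
  have [c hc] := det_poly_vandermonde (fun i => X i) (fun j => 'X^(m j)).
  exists c; rewrite -hc; apply: eq_bigr => s _.
  rewrite scaler_sign -mulr_sign; congr (_ * _).
  rewrite mpolyXE_id; apply: eq_bigr => i _.
  by rewrite mxE hornerXn permute_mnmE.
have [c hc] := choice altE.
have E : g *+ #|{: {perm 'I_N}}| = \sum_(m <- msupp g) mcoeff m g *: alt m.
  rewrite -sumr_const.
  transitivity (\sum_(s : {perm 'I_N}) \sum_(m <- msupp g)
      mcoeff m g *: ((-1) ^+ s *: mpolyX F (permute_mnm s m))).
    rewrite [RHS](reindex_inj invg_inj) /=; apply: eq_bigr => s _.
    transitivity ((-1) ^+ s *: msym s g).
      by rewrite ga scalerA -signr_addb addbb scale1r.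
    have -> : msym s g = \sum_(m <- msupp g) msym s (mcoeff m g *: mpolyX F m).
      by rewrite {1}(mpolyE g); exact: raddf_sum.
    rewrite scaler_sumr; apply: eq_bigr => m _.
    by rewrite msymZ msym_permX odd_permV scalerA mulrC -scalerA.
  rewrite exchange_big /=; apply: eq_bigr => m _.
  by rewrite scaler_sumr.
have k0 : (#|{: {perm 'I_N}}|%:R : F) != 0.
  by rewrite pnatr_eq0 -lt0n; apply/card_gt0P; exists 1%g.
exists (\sum_(m <- msupp g) (#|{: {perm 'I_N}}|%:R^-1 * mcoeff m g) *: c m).
have gE : g = #|{: {perm 'I_N}}|%:R^-1 *: (g *+ #|{: {perm 'I_N}}|).
  by rewrite -(scaler_nat _ g) scalerA mulVf // scale1r.
rewrite [LHS]gE E mulr_sumr scaler_sumr.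
by apply: eq_bigr => m _; rewrite scalerA hc -scalerAr.
Qed.

End AntisymmetricPolynomials.

(** * Macdonald's operator on symmetric polynomials *)

Section MacdonaldOperator.
Variable F : numFieldType.
Variable N : nat.
Local Notation P := (mpoly N F).
Local Notation V := (@vandermonde_poly F N).
Local Notation sym := (@mpoly.symmetric N F).
Implicit Types (f g : P) (m : multinom N) (s : {perm 'I_N}) (k : 'I_N) (a c q t : F).

Definition mdilate k a f : P := \sum_(m <- msupp f) (a ^+ m k * mcoeff m f) *: mpolyX F m.

Lemma mcoeff_mdilate k a f m : mcoeff m (mdilate k a f) = a ^+ m k * mcoeff m f.
Proof.
rewrite /mdilate raddf_sum /=.
have [ms|/memN_msupp_eq0 m0] := boolP (m \in msupp f); last first.
  rewrite m0 mulr0 big1_seq // => m' /andP[_ m's].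
  rewrite mcoeffZ mcoeffX; case: eqP => [E|_]; last by rewrite mulr0.
  by move: m's; rewrite E mcoeff_msupp m0 eqxx.
rewrite (bigD1_seq m) ?msupp_uniq //= big1 => [|m' /negbTE m'm].
  by rewrite mcoeffZ mcoeffX eqxx mulr1 addr0.
by rewrite mcoeffZ mcoeffX m'm mulr0.
Qed.

Lemma meval_mdilate k a f (x : 'I_N -> F) :
  meval x (mdilate k a f) = meval (shift_var k a x) f.
Proof.
rewrite /mdilate raddf_sum mevalE; apply: eq_bigr => m _.
rewrite /= mevalZ mevalX mulrAC mulrC; congr (_ * _).
rewrite (bigD1 k) //= [RHS](bigD1 k) //= /shift_var eqxx exprMn mulrA; congr (_ * _).
by apply: eq_bigr => i /negbTE ->.
Qed.

Lemma msym_mdilate s k a f : msym s (mdilate k a f) = mdilate (s k) a (msym s f).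
Proof. by apply/mpolyP => m; rewrite mcoeff_msym !mcoeff_mdilate mcoeff_msym permute_mnmE. Qed.

Lemma mdilateZ k a c f : mdilate k a (c *: f) = c *: mdilate k a f.
Proof. by apply/mpolyP => m; rewrite mcoeff_mdilate !mcoeffZ mcoeff_mdilate mulrCA. Qed.

Lemma mdilateD k a f g : mdilate k a (f + g) = mdilate k a f + mdilate k a g.
Proof. by apply/mpolyP => m; rewrite mcoeff_mdilate !mcoeffD !mcoeff_mdilate mulrDr. Qed.

Lemma msupp_mdilate k a f m : m \in msupp (mdilate k a f) -> m \in msupp f.
Proof. by rewrite !mcoeff_msupp mcoeff_mdilate; apply: contraNneq => ->; rewrite mulr0. Qed.

(** Dilating [x_k] by [t] multiplies [V] by the rational function [Dcoef t k], so this is [V] times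
    the image of [f] under the operator. *)
Definition macdonald_numerator q t f : P := \sum_(k < N) mdilate k t V * mdilate k q f.

(** For symmetric [f] the numerator is antisymmetric and the quotient by [V] exists ([macopE]);
    where there is no quotient the value is 0. *)
Definition macop q t f : P := xget 0 [set g | macdonald_numerator q t f = V * g].

Lemma macdonald_numerator_antisym q t f : f \is sym ->
  antisymmetric (macdonald_numerator q t f).
Proof.
move=> /issymP fs s; rewrite /macdonald_numerator raddf_sum /= scaler_sumr.
rewrite [RHS](reindex_inj (@perm_inj _ s)) /=; apply: eq_bigr => k _.
by rewrite msymM !msym_mdilate fs vandermonde_antisymmetric mdilateZ -scalerAl.
Qed.

Lemma macopE q t f : f \is sym -> macdonald_numerator q t f = V * macop q t f.
Proof.
move=> fs; have := vandermonde_dvd (macdonald_numerator_antisym q t fs).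
exact: (@xgetPex _ 0 [set g | macdonald_numerator q t f = V * g]).
Qed.

Lemma macop_sym q t f : f \is sym -> macop q t f \is sym.
Proof.
move=> fs; apply/issymP => s; apply: (mulfI (@vandermonde_poly_neq0 F N)).
have := macdonald_numerator_antisym q t fs s; rewrite macopE // msymM.
rewrite vandermonde_antisymmetric -scalerAl => /(congr1 (fun h => (-1) ^+ s *: h)).
by rewrite !scalerA -signr_addb addbb !scale1r.
Qed.

Lemma macopD q t f g : f \is sym -> g \is sym -> macop q t (f + g) = macop q t f + macop q t g.
Proof.
move=> fs gs; apply: (mulfI (@vandermonde_poly_neq0 F N)).
rewrite mulrDr -!macopE ?rpredD // -big_split.
by apply: eq_bigr => k _; rewrite mdilateD mulrDr.
Qed.

Lemma macopZ q t c f : f \is sym -> macop q t (c *: f) = c *: macop q t f.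
Proof.
move=> fs; apply: (mulfI (@vandermonde_poly_neq0 F N)).
rewrite -scalerAr -!macopE ?rpredZ // scaler_sumr.
by apply: eq_bigr => k _; rewrite mdilateZ scalerAr.
Qed.

Lemma meval_vandermonde (x : 'I_N -> F) :
  meval x V = \prod_(i < N) \prod_(j < N | (i < j)%N) (x j - x i).
Proof.
rewrite rmorph_prod; apply: eq_bigr => i _; rewrite rmorph_prod; apply: eq_bigr => j _.
by rewrite rmorphB /= !mevalXU.
Qed.

Lemma meval_vandermonde_neq0 (x : 'I_N -> F) : injective x -> meval x V != 0.
Proof.
move=> xI; rewrite meval_vandermonde; apply/prodf_neq0 => i _; apply/prodf_neq0 => j ij.
by rewrite subr_eq0 (inj_eq xI) neq_ltn ij orbT.
Qed.

Lemma meval_vandermonde_shift k t (x : 'I_N -> F) : injective x ->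
  meval (shift_var k t x) V = meval x V * Dcoef t k x.
Proof.
move=> xI; have V0 := meval_vandermonde_neq0 xI.
apply: (mulIf (invr_neq0 V0)); rewrite [RHS]mulrAC mulfV // mul1r.
rewrite !meval_vandermonde -prodf_div.
under eq_bigr do rewrite -prodf_div.
have xx i j : i != j -> x j - x i != 0 by rewrite subr_eq0 (inj_eq xI) eq_sym.
rewrite (pair_prod_split (F := fun i j =>
  (shift_var k t x j - shift_var k t x i) / (x j - x i)) k) => [|i j]; last first.
  by rewrite -opprB -[x j - _]opprB invrN mulrNN.
rewrite [X in _ * X]big1 ?mulr1 => [|i ik]; last first.
  rewrite big1 // => j /andP[ij jk].
  by rewrite /shift_var (negbTE ik) (negbTE jk) mulfV // xx // neq_ltn ij.
apply: eq_bigr => j jk; rewrite /shift_var eqxx (negbTE jk).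
by rewrite -opprB -[x j - _]opprB invrN mulrNN.
Qed.

Lemma meval_macop q t f (x : 'I_N -> F) : f \is sym -> injective x ->
  meval x (macop q t f) = Dop q t (fun y => meval y f) x.
Proof.
move=> fs xI; apply: (mulfI (meval_vandermonde_neq0 xI)).
rewrite -mevalM -macopE // raddf_sum mulr_sumr; apply: eq_bigr => k _.
by rewrite /= mevalM !meval_mdilate meval_vandermonde_shift // mulrA.
Qed.

End MacdonaldOperator.

(** * Dominance order on exponent vectors *)

Section Dominance.
Variable N : nat.
Implicit Types (m kappa lambda : multinom N) (s : {perm 'I_N}) (k : nat).

Definition partial_sum k m : nat := \sum_(i < N | (i < k)%N) m i.

Lemma dominated_refl kappa : dominated kappa kappa.
Proof. by []. Qed.

Lemma dominated_trans kappa mu lambda :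
  dominated kappa mu -> dominated mu lambda -> dominated kappa lambda.
Proof.
move=> [e1 h1] [e2 h2]; split; first by rewrite e1.
by move=> k; apply: leq_trans (h1 k) (h2 k).
Qed.

(** At the first index where the vectors differ, the dominance inequality becomes a strict
    inequality of entries; as the degrees agree, this decides the monomial order. Inductions on
    dominance can thus follow that well-founded order. *)
Lemma dominated_lt kappa lambda : dominated kappa lambda -> kappa <> lambda ->
  (kappa < lambda)%O.
Proof.
move=> [E H] ne.
have ex : exists i : nat, (i < N)%N && [exists j : 'I_N, (j == i :> nat) && (kappa j != lambda j)].
  have [j hj] : exists j, kappa j != lambda j.
    apply/existsP; rewrite -negb_forall; apply/negP => /forallP h.
    by apply: ne; apply/mnmP => j; apply/eqP; exact: h.
  by exists j; rewrite ltn_ord; apply/existsP; exists j; rewrite eqxx.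
case: (ex_minnP ex) => i /andP[iN /existsP[j /andP[/eqP ji jne]]] imin.
apply/ltmcP => //; exists j => [l lj|].
  apply/eqP; apply/negPn/negP => hl; have := imin l.
  rewrite ltn_ord (leqNgt i) -ji lj => /(_ _)/negP; apply => //.
  by apply/existsP; exists l; rewrite eqxx.
rewrite ltn_neqAle jne /=.
have := H j.+1; rewrite (bigD1 j) ?ltnS //= [X in (_ <= X)%N](bigD1 j) ?ltnS //=.
suff -> : \sum_(l < N | (l < j.+1)%N && (l != j)) kappa l =
          \sum_(l < N | (l < j.+1)%N && (l != j)) lambda l by rewrite leq_add2r.
apply: eq_bigr => l /andP[lj lnj]; apply/eqP; have {}lj : (l < j)%N by rewrite ltn_neqAle -ltnS lj andbT.
apply/negPn/negP => hl; have := imin l.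
rewrite ltn_ord (leqNgt i) -ji lj => /(_ _)/negP; apply => //.
by apply/existsP; exists l; rewrite eqxx.
Qed.

Lemma dominated_le kappa lambda : dominated kappa lambda -> (kappa <= lambda)%O.
Proof.
move=> h; have [->|/eqP ne] := eqVneq kappa lambda; first exact: lexx.
exact/ltW/dominated_lt.
Qed.

Lemma partial_sum_perm_le k kappa s : is_partition_vec kappa ->
  (partial_sum k (permute_mnm s kappa) <= partial_sum k kappa)%N.
Proof.
move=> kp; rewrite /partial_sum; under eq_bigr do rewrite permute_mnmE.
have [kN|Nk] := ltnP k N; last first.
  have tt (i : 'I_N) : (i < k)%N by apply: leq_trans (ltn_ord i) Nk.
  rewrite (eq_bigl xpredT) // [X in (_ <= X)%N](eq_bigl xpredT) //.
  by rewrite [X in (_ <= X)%N](reindex_inj (@perm_inj _ s)).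
(* With threshold [c], any [k] parts add up to at most [k c] plus the total excess of all parts over
   [c]; for the [k] largest parts this is an equality. *)
pose c := kappa (Ordinal kN).
apply: (@leq_trans (\sum_(i < N | (i < k)%N) (c + (kappa (s i) - c)))).
  by apply: leq_sum => i _; lia.
rewrite big_split /=.
apply: (@leq_trans (\sum_(i < N | (i < k)%N) c + \sum_(i < N) (kappa i - c))).
  rewrite leq_add2l [X in (_ <= X)%N](reindex_inj (@perm_inj _ s)) /=.
  by rewrite [X in (_ <= X)%N](bigID (fun i : 'I_N => (i < k)%N)) /= leq_addr.
rewrite [X in (_ + X)%N](bigID (fun i : 'I_N => (i < k)%N)) /=.
rewrite [X in (_ + (_ + X))%N]big1 ?addn0 => [|i].
  rewrite -big_split /=; apply: leq_sum => i ik.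
  have : (c <= kappa i)%N by apply: kp; exact: ltnW.
  lia.
rewrite -leqNgt => ki; apply/eqP; rewrite subn_eq0; exact: kp.
Qed.

Lemma sort_mnm m : exists s, is_partition_vec (permute_mnm s m).
Proof.
have /tuple_permP[s hs] : perm_eq (sort_tuple geq (multinom_val m)) (multinom_val m).
  by rewrite perm_sort.
exists s => i j ij.
have E l : permute_mnm s m l = nth 0%N (sort geq m) l.
  rewrite permute_mnmE mnm_tnth.
  have -> : sort geq m = [tuple tnth (multinom_val m) (s i) | i < N] by exact: hs.
  by rewrite -tnth_nth tnth_mktuple.
rewrite !E; apply: (sorted_leq_nth (leT := geq)) => //.
- by move=> a b c /= h1 h2; apply: leq_trans h2 h1.
- by move=> a /=.
- by apply: sort_sorted => a b; rewrite /geq /= leq_total.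
- by rewrite inE size_sort size_tuple.
- by rewrite inE size_sort size_tuple.
Qed.

End Dominance.

(** * Gradings by partial sums of exponents *)

Section Grading.
Variable F : numFieldType.
Variable N : nat.
Local Notation P := (mpoly N F).
Local Notation Var i := (mpolyX F (mnm1 i) : P).
Local Notation V := (@vandermonde_poly F N).
Local Notation sym := (@mpoly.symmetric N F).
Implicit Types (f g : P) (m kappa lambda : multinom N) (k : nat) (q t : F).

(* Multiplies the variables [x_i] with [i < k] by an auxiliary variable, whose
   degree then records the partial sums of the exponent vectors. *)
Definition grade k : P -> {poly P} :=
  mmap (@polyC P \o @mpolyC N F) (fun i => (Var i)%:P * (if (i < k)%N then 'X else 1)).

Lemma gradeM k f g : grade k (f * g) = grade k f * grade k g.
Proof. exact: rmorphM. Qed.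

Lemma gradeE k f : grade k f =
  \sum_(m <- msupp f) (mcoeff m f *: mpolyX F m)%:P * 'X^(partial_sum k m).
Proof.
apply: eq_bigr => m _; rewrite -mul_mpolyC polyCM -mulrA; congr (_ * _).
rewrite /mmap1; under eq_bigr do rewrite exprMn.
rewrite big_split /= mpolyXE_id rmorph_prod; congr (_ * _).
  by apply: eq_bigr => i _; rewrite rmorphXn.
rewrite /partial_sum -prodrXr big_mkcond [RHS]big_mkcond /=.
by apply: eq_bigr => i _; case: ifP => // _; rewrite expr1n.
Qed.

Lemma coef_grade k f m : mcoeff m (grade k f)`_(partial_sum k m) = mcoeff m f.
Proof.
rewrite gradeE coef_sum raddf_sum /=.
have E m' : mcoeff m (((mcoeff m' f *: mpolyX F m')%:P * 'X^(partial_sum k m'))`_(partial_sum k m))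
    = if m' == m then mcoeff m' f else 0.
  rewrite coefCM coefXn.
  case: (partial_sum k m =P _) => [_|h]; last first.
    by rewrite mulr0 mcoeff0; case: eqP h => // ->.
  by rewrite mulr1 mcoeffZ mcoeffX; case: eqP => _; rewrite ?mulr1 ?mulr0.
rewrite (eq_bigr _ (fun m' _ => E m')).
have [ms|/memN_msupp_eq0 m0] := boolP (m \in msupp f); last first.
  by rewrite m0 big1_seq // => m' _; case: eqP => // ->.
rewrite (bigD1_seq m) ?msupp_uniq //= eqxx big1 ?addr0 // => m' /negbTE -> //.
Qed.

Lemma size_grade_le k f (b : nat) :
  (forall m, m \in msupp f -> (partial_sum k m <= b)%N) <-> (size (grade k f) <= b.+1)%N.
Proof.
split => [h|h m ms].
  rewrite gradeE; apply: leq_trans (size_sum _ _ _) _.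
  rewrite big_seq; elim/big_rec: _ => // m a /h mb ab; rewrite geq_max ab andbT.
  apply: leq_trans (size_polyMleq _ _) _; rewrite size_polyXn addnS /=.
  by rewrite -add1n leq_add ?size_polyC_leq1.
rewrite leqNgt; apply/negP => bm; have := coef_grade k f m.
rewrite nth_default ?mcoeff0 => [E|]; last exact: leq_trans h bm.
by move: ms; rewrite mcoeff_msupp -E eqxx.
Qed.

Lemma grade_homogeneous f d :
  (forall m, m \in msupp f -> mdeg m = d) <-> grade N f = f%:P * 'X^d.
Proof.
have pN m : partial_sum N m = mdeg m.
  by rewrite /partial_sum mdegE; apply: eq_bigl => i; rewrite ltn_ord.
split => [h|h m ms].
  rewrite gradeE [in RHS](mpolyE f) rmorph_sum mulr_suml big_seq [RHS]big_seq.
  by apply: eq_bigr => m /h <-; rewrite pN.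
have := coef_grade N f m; rewrite h coefCM coefXn pN; case: eqP => // _.
by rewrite mulr0 mcoeff0 => /esym/eqP; rewrite mcoeff_eq0 ms.
Qed.

Lemma vandermonde_homogeneous : exists e, grade N V = V%:P * 'X^e.
Proof.
exists (\sum_(i < N) \sum_(j < N | (i < j)%N) 1)%N.
rewrite /vandermonde_poly /grade !rmorph_prod -prodrXr -big_split /=; apply: eq_bigr => i _.
rewrite !rmorph_prod -prodrXr -big_split /=; apply: eq_bigr => j _.
rewrite rmorphB expr1 /=.
have E l : mmap (@polyC P \o @mpolyC N F)
    (fun i => (Var i)%:P * (if (i < N)%N then 'X else 1)) (Var l) = (Var l)%:P * 'X.
  by rewrite mmapX mmap1U ltn_ord.
by rewrite !E rmorphB mulrBl.
Qed.

End Grading.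

(** * Triangularity of the operator and its eigenvalues *)

Section Triangularity.
Variable F : numFieldType.
Variable N : nat.
Local Notation P := (mpoly N F).
Local Notation Var i := (mpolyX F (mnm1 i) : P).
Local Notation V := (@vandermonde_poly F N).
Local Notation sym := (@mpoly.symmetric N F).
Implicit Types (f g : P) (m kappa lambda : multinom N) (k : nat) (q t c : F).

Definition macdonald_eig q t m : F := \sum_(k < N) t ^+ (N - k.+1) * q ^+ m k.

Definition dominated_poly lambda f : Prop := f \is sym /\
  forall kappa, is_partition_vec kappa -> mcoeff kappa f != 0 -> dominated kappa lambda.

(** Dominance is prescribed on partitions only; sorting an exponent vector can only increase its
    partial sums, so by symmetry the whole support obeys the bounds. *)
Lemma dominated_poly_supp lambda f m : dominated_poly lambda f -> m \in msupp f ->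
  mdeg m = mdeg lambda /\ forall k, (partial_sum k m <= partial_sum k lambda)%N.
Proof.
move=> [fs fd] ms; have [s sp] := sort_mnm m.
have [|e h] := fd _ sp; first by rewrite [mcoeff _ _](msym_coeff m s fs) -mcoeff_msupp.
split; first by rewrite -e [RHS](mdeg_mperm m s).
move=> k; apply: leq_trans (h k).
have E : m = permute_mnm s^-1%g (permute_mnm s m).
  by apply/mnmP => i; rewrite !permute_mnmE permKV.
rewrite {1}E; exact: partial_sum_perm_le.
Qed.

Lemma mlead_partition f : f \is sym -> is_partition_vec (mlead f).
Proof. by move=> fs i j; exact: mlead_msym_sorted. Qed.

Lemma mlead_le_supp f m : (forall m', m' \in msupp f -> (m' <= m)%O) -> (mlead f <= m)%O.
Proof.
move=> h; have [->|f0] := eqVneq f 0; first by rewrite mlead0 le0m.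
exact/h/mlead_supp.
Qed.

Lemma dominated_poly_mlead lambda f : dominated_poly lambda f -> f != 0 ->
  dominated (mlead f) lambda.
Proof.
by move=> [fs fd] f0; apply: fd; [exact: mlead_partition|rewrite mleadc_eq0].
Qed.

Lemma dominated_poly_le lambda f : dominated_poly lambda f -> (mlead f <= lambda)%O.
Proof.
move=> fd; have [->|f0] := eqVneq f 0; first by rewrite mlead0 le0m.
exact/dominated_le/dominated_poly_mlead.
Qed.

Lemma dominated_polyD lambda f g : dominated_poly lambda f -> dominated_poly lambda g ->
  dominated_poly lambda (f + g).
Proof.
move=> [fs fd] [gs gd]; split=> [|kappa kp]; first exact: rpredD.
rewrite mcoeffD; have [f0|f0] := eqVneq (mcoeff kappa f) 0; last by move=> _; exact: fd.
by rewrite f0 add0r; exact: gd.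
Qed.

Lemma dominated_polyZ lambda c f : dominated_poly lambda f -> dominated_poly lambda (c *: f).
Proof.
move=> [fs fd]; split=> [|kappa kp]; first exact: rpredZ.
by rewrite mcoeffZ mulf_eq0 negb_or => /andP[_]; exact: fd.
Qed.

Lemma dominated_poly_trans kappa lambda f : dominated kappa lambda ->
  dominated_poly kappa f -> dominated_poly lambda f.
Proof.
move=> kl [fs fd]; split=> // m mp m0; exact: dominated_trans (fd _ mp m0) kl.
Qed.

(** Degrees in the grading variable add under multiplication, the ring being a domain, so division
    by [V] subtracts the degree of [V] from that of the numerator. Dilations do not enlarge
    supports. *)
Lemma macop_supp_le q t f k b : f \is sym ->
  (forall m, m \in msupp f -> (partial_sum k m <= b)%N) ->
  forall m, m \in msupp (macop q t f) -> (partial_sum k m <= b)%N.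
Proof.
move=> fs fb; have [->|g0] := eqVneq (macop q t f) 0; first by move=> m; rewrite msupp0.
have grade_inj h : h != 0 -> grade k h != 0.
  rewrite -mleadc_eq0; apply: contraNneq => h0.
  by rewrite -(coef_grade k h) h0 coef0 mcoeff0.
apply/size_grade_le.
have V0 := @vandermonde_poly_neq0 F N.
have [v vE] : exists v, size (grade k V) = v.+1.
  by exists (size (grade k V)).-1; rewrite prednK // size_poly_gt0 grade_inj.
have /size_grade_le hv : (size (grade k V) <= v.+1)%N by rewrite vE.
have : (size (grade k (macdonald_numerator q t f)) <= (v + b).+1)%N.
  apply/size_grade_le => m /msupp_sum_le /flatten_mapP[i _] /msuppM_le /allpairsP[[m1 m2]] /=.
  move=> [/msupp_mdilate h1 /msupp_mdilate h2 ->].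
  have -> : partial_sum k (mnm_add m1 m2) = (partial_sum k m1 + partial_sum k m2)%N.
    by rewrite /partial_sum -big_split; apply: eq_bigr => l _; rewrite mnmDE.
  by rewrite leq_add ?fb ?hv.
rewrite (macopE _ _ fs) gradeM size_mul; [|exact: grade_inj|exact: grade_inj].
have arith (a c : nat) : a = v.+1 -> ((a + c).-1 <= (v + b).+1)%N -> (c <= b.+1)%N by lia.
exact: arith vE.
Qed.

Lemma macop_homogeneous q t f d : f \is sym ->
  (forall m, m \in msupp f -> mdeg m = d) ->
  forall m, m \in msupp (macop q t f) -> mdeg m = d.
Proof.
move=> fs fd; apply/grade_homogeneous.
have V0 := @vandermonde_poly_neq0 F N.
have [e Ve] := vandermonde_homogeneous F N.
have V0' : V%:P * 'X^e != 0 by rewrite mulf_neq0 ?polyC_eq0 // -size_poly_eq0 size_polyXn.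
apply: (mulfI V0'); rewrite -[in LHS]Ve -gradeM -macopE //.
rewrite mulrACA -rmorphM -exprD -macopE //.
apply/grade_homogeneous => m /msupp_sum_le /flatten_mapP[i _] /msuppM_le /allpairsP[[m1 m2]] /=.
move=> [/msupp_mdilate h1 /msupp_mdilate h2 ->]; rewrite mdegD (fd _ h2).
by move/grade_homogeneous: Ve => ->.
Qed.

Lemma dominated_poly_macop q t lambda f : dominated_poly lambda f ->
  dominated_poly lambda (macop q t f).
Proof.
move=> fd; have [fs _] := fd; split=> [|kappa kp]; first exact: macop_sym.
rewrite -mcoeff_msupp => ks; split.
  by apply: macop_homogeneous ks => // m /(dominated_poly_supp fd)[].
by move=> k; apply: macop_supp_le ks => // m /(dominated_poly_supp fd)[].
Qed.

Definition staircase : multinom N := Multinom [tuple (N - i.+1)%N | i < N].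

Lemma staircaseE (i : 'I_N) : staircase i = (N - i.+1)%N.
Proof. by rewrite mnm_tnth tnth_mktuple. Qed.

Lemma card_gt_ord (i : 'I_N) : \sum_(j < N | (i < j)%N) 1 = (N - i.+1)%N.
Proof.
have E : \sum_(j < N | ~~ (i < j)%N) 1 = i.+1.
  under eq_bigl do rewrite -leqNgt -ltnS.
  by rewrite -(big_ord_widen N (fun=> 1%N)) // sum_nat_const card_ord muln1.
have S : \sum_(j < N) 1 = N by rewrite sum_nat_const card_ord muln1.
move: S; rewrite (bigID (fun j : 'I_N => (i < j)%N)) /= E => S.
by rewrite -[X in (X - _)%N]S addnK.
Qed.

Lemma mlead_vandermonde : mlead V = staircase.
Proof.
have lead (i j : 'I_N) : (i < j)%N -> mlead (Var j - Var i) = mnm1 i.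
  move=> ij; rewrite mleadDr ?mleadN ?mleadXm //.
  apply/ltmcP; first by rewrite !mdeg1.
  exists i => [l li|]; rewrite !mnm1E; last by rewrite eqxx -val_eqE /= gtn_eqF.
  by rewrite -!val_eqE /= !gtn_eqF // (ltn_trans li).
have neq0 (i j : 'I_N) : (i < j)%N -> Var j - Var i != 0.
  move=> /lead h; apply/eqP => h0; move: h; rewrite h0 mlead0.
  by move/eqP; rewrite eq_sym mnm1_eq0.
rewrite /vandermonde_poly mlead_prod => [|i _ _]; last first.
  by apply/prodf_neq0 => j; exact: neq0.
apply/mnmP => k; rewrite mnm_sumE staircaseE -card_gt_ord (bigD1 k) //=.
rewrite [X in (_ + X)%N]big1 ?addn0 => [|i ik].
  rewrite mlead_prod => [|j _]; last exact: neq0.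
  by rewrite mnm_sumE; apply: eq_bigr => j /lead ->; rewrite mnm1E eqxx.
rewrite mlead_prod => [|j _]; last exact: neq0.
by rewrite mnm_sumE big1 // => j /lead ->; rewrite mnm1E (negbTE ik).
Qed.

(** Compare coefficients at [staircase + lambda] in [macopE], where only the coefficients at
    [staircase] and at [lambda] are multiplied. Dilating [x_k] in [V] contributes [t] to the
    staircase exponent, dilating it in [f] contributes [q ^+ lambda k]. *)
Lemma mcoeff_macop q t lambda f : dominated_poly lambda f ->
  mcoeff lambda (macop q t f) = macdonald_eig q t lambda * mcoeff lambda f.
Proof.
move=> fd; have [fs _] := fd.
have V0 : mcoeff staircase V != 0.
  by rewrite -mlead_vandermonde mleadc_eq0 vandermonde_poly_neq0.
have dilate_le (k : 'I_N) (a : F) (g : mpoly N F) m : (mlead g <= m)%O -> (mlead (mdilate k a g) <= m)%O.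
  move=> gm; apply: mlead_le_supp => m' /msupp_mdilate /msupp_le_mlead h.
  exact: le_trans h gm.
apply: (mulfI V0); rewrite -(@mleadcMW _ _ V (macop q t f)); first last.
- exact/dominated_poly_le/dominated_poly_macop.
- by rewrite mlead_vandermonde.
rewrite -(macopE _ _ fs) raddf_sum /= mulrCA /macdonald_eig mulr_suml.
apply: eq_bigr => k _; rewrite mleadcMW ?dilate_le ?mlead_vandermonde ?dominated_poly_le //.
by rewrite !mcoeff_mdilate staircaseE; ring.
Qed.

End Triangularity.

(** * The operator under inversion of the variables *)

Section InverseOperator.
Variable F : fieldType.
Variable N : nat.
Implicit Types (q t : F) (x : 'I_N -> F).

Lemma Dop_inverse q t (f : ('I_N -> F) -> F) x : t != 0 -> (forall i, x i != 0) -> injective x ->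
  Dop q t (fun y => f (fun i => (y i)^-1)) x =
  t ^+ N.-1 * Dop q^-1 t^-1 f (fun i => (x i)^-1).
Proof.
move=> t0 x0 xI; rewrite /Dop mulr_sumr; apply: eq_bigr => k _.
rewrite shift_var_inv mulrA; congr (_ * _).
have -> : t ^+ N.-1 = \prod_(j < N | j != k) t by rewrite prodr_const cardC1 card_ord.
rewrite -big_split; apply: eq_bigr => j jk /=.
have h : x k - x j != 0 by rewrite subr_eq0 (inj_eq xI) eq_sym.
have h' : x j - x k != 0 by rewrite -opprB oppr_eq0.
by field; rewrite ?mulN1r t0 h h' !x0.
Qed.

End InverseOperator.

(** * Macdonald's scalar product and its self-adjoint operators *)

Section Pairing.
Variable R : realType.
Local Notation C := R[i].
Variables q t : C.
Hypotheses (q_neq0 : q != 0) (q_lt1 : nrm q < 1) (t_neq0 : t != 0) (t_lt1 : nrm t < 1).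
Variable N : nat.
Local Notation T := (@on_torus R N).
Local Notation density := (@macdonald_density R q t N).
Local Notation sym := (@mpoly.symmetric N C).
Implicit Types (f g : mpoly N C) (z : N.-tuple C).

Let bT := @on_torus_bounded R N.

Definition laurent_of f : seq (C * {ffun 'I_N -> int}) :=
  [seq (mcoeff m f, [ffun i => (m i)%:Z]) | m <- msupp f].

Lemma laurent_ofE f x : laurent (laurent_of f) x = meval x f.
Proof.
rewrite /laurent big_map mevalE; apply: eq_bigr => m _ /=; congr (_ * _).
by apply: eq_bigr => i _; rewrite ffunE.
Qed.

Lemma lapprox_meval f : lapprox T (fun z => meval (tnth z) f).
Proof. by apply: lapprox_eq (lapprox_laurent T (laurent_of f)) => z _; rewrite laurent_ofE. Qed.

Lemma lapprox_mevalV f : lapprox T (fun z => meval (fun i => (tnth z i)^-1) f).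
Proof. by apply: lapprox_eq (lapprox_laurent_inv T (laurent_of f)) => z _; rewrite laurent_ofE. Qed.

Lemma lapprox_torus_product f g : lapprox T (fun z =>
  meval (tnth z) f * meval (fun i => (tnth z i)^-1) g * density z).
Proof.
apply: lapproxM => //; last exact: lapprox_density.
by apply: lapproxM => //; [exact: lapprox_meval|exact: lapprox_mevalV].
Qed.

Lemma torus_productC f g : torus_product q t f g = torus_product q t g f.
Proof.
rewrite /torus_product -(torus_integral_inv (lapprox_torus_product f g)).
apply: eq_torus_integral => z Tz; rewrite density_inv tnth_inv [in RHS](mulrC (meval _ g)).
by congr (_ * meval _ g * _); apply/funext => i; rewrite invrK.
Qed.

Lemma torus_productDl f1 f2 g :
  torus_product q t (f1 + f2) g = torus_product q t f1 g + torus_product q t f2 g.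
Proof.
rewrite /torus_product -torus_integralD; [|exact: lapprox_torus_product..].
by apply: eq_torus_integral => z Tz; rewrite mevalD !mulrDl.
Qed.

Lemma torus_productZl c f g : torus_product q t (c *: f) g = c * torus_product q t f g.
Proof.
rewrite /torus_product -torus_integralZ; last exact: lapprox_torus_product.
by apply: eq_torus_integral => z Tz; rewrite mevalZ !mulrA.
Qed.

Lemma torus_productDr f g1 g2 :
  torus_product q t f (g1 + g2) = torus_product q t f g1 + torus_product q t f g2.
Proof. by rewrite torus_productC torus_productDl !(torus_productC f). Qed.

Lemma torus_productZr c f g : torus_product q t f (c *: g) = c * torus_product q t f g.
Proof. by rewrite torus_productC torus_productZl (torus_productC f). Qed.

Lemma torus_product0r f : torus_product q t f 0 = 0.
Proof. by rewrite -(scale0r (0 : mpoly N C)) torus_productZr mul0r. Qed.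

(* Both sides vanish where two coordinates coincide, because the density does. *)
Lemma density_injective z (a b : C) : T z ->
  (injective (tnth z) -> a = b) -> a * density z = b * density z.
Proof.
move=> Tz h; have [/injectiveP/h -> //|/injectivePn [i [j ij zij]]] := boolP (injectiveb (tnth z)).
by rewrite (density_eq0 t q_lt1 ij (on_torus_neq0 j Tz) zij) !mulr0.
Qed.

Lemma torus_product_macop f g : f \is sym -> g \is sym ->
  torus_product q t (macop q t f) g = torus_product q t f (macop q t g).
Proof.
move=> fs gs; have := Dop_adjoint q_neq0 q_lt1 t_lt1 (laurent_of f) (laurent_of g).
have E h : laurent (laurent_of h) = fun x => meval x h.
  by apply/funext => x; rewrite laurent_ofE.
rewrite !E => H; transitivity (torus_integral (fun z : N.-tuple C =>
    Dop q t (fun x => meval x f) (tnth z) * meval (fun i => (tnth z i)^-1) g * density z)).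
  apply: eq_torus_integral => z Tz; apply: density_injective => // zI.
  by congr (_ * _); exact: meval_macop.
rewrite H; apply: eq_torus_integral => z Tz; apply: density_injective => // zI.
congr (_ * _); rewrite meval_macop // => i j /invr_inj; exact: zI.
Qed.

(** [1/q] lies outside the unit disc, so [Dop_adjoint] cannot be used at the inverted parameters. By
    [Dop_inverse] the operator is, up to [t ^+ N.-1], [Dop q t] acting on polynomials in the
    inverted variables, where it does apply. *)
Lemma torus_product_macopV f g : f \is sym -> g \is sym ->
  torus_product q t (macop q^-1 t^-1 f) g = torus_product q t f (macop q^-1 t^-1 g).
Proof.
move=> fs gs.
pose inv (h : mpoly N C) := [seq (c.1, - c.2) | c <- laurent_of h].
have E h : laurent (inv h) = fun x => meval (fun i => (x i)^-1) h.
  by apply/funext => x; rewrite laurent_inv laurent_ofE.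
have DE h z : h \is sym -> T z -> injective (tnth z) ->
    Dop q t (laurent (inv h)) (tnth z) =
    t ^+ N.-1 * meval (fun i => (tnth z i)^-1) (macop q^-1 t^-1 h).
  move=> hs Tz zI; have z0 i := on_torus_neq0 i Tz.
  rewrite E (Dop_inverse q (fun x => meval x h) t_neq0 z0 zI) meval_macop //.
  by move=> i j /invr_inj; exact: zI.
have tN : t ^+ N.-1 != 0 by rewrite expf_neq0.
have key h1 h2 : h1 \is sym ->
    t ^+ N.-1 * torus_product q t h2 (macop q^-1 t^-1 h1) =
    torus_integral (fun z => Dop q t (laurent (inv h1)) (tnth z) *
      laurent (inv h2) (fun i => (tnth z i)^-1) * density z).
  move=> h1s; rewrite -torus_integralZ; last exact: lapprox_torus_product.
  apply: eq_torus_integral => z Tz; rewrite mulrA; apply: density_injective => // zI.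
  have V2 : (fun i => (tnth z i)^-1^-1) = tnth z by apply/funext => i; rewrite invrK.
  rewrite (DE h1 z h1s Tz zI) E V2 -[RHS]mulrA; congr (_ * _); exact: mulrC.
apply: (mulfI tN); rewrite (torus_productC _ g).
apply: etrans (key f g fs) _.
apply: etrans (Dop_adjoint q_neq0 q_lt1 t_lt1 (inv f) (inv g)) _.
rewrite -(torus_integralZ _ (lapprox_torus_product _ _)).
apply: etrans (torus_integral_inv (lapproxZ bT _ (lapprox_torus_product _ _))).
apply: eq_torus_integral => z Tz; rewrite density_inv tnth_inv mulrA.
apply: density_injective => // zI.
have zI' : injective (tnth (inv_tuple z)).
  by move=> i j; rewrite !tnth_mktuple => /invr_inj; exact: zI.
have := DE g _ gs (on_torus_inv Tz) zI'; rewrite tnth_inv => ->.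
by rewrite E; exact: mulrCA.
Qed.

End Pairing.

(** * Nondegeneracy of the scalar product *)

Section Nondegeneracy.
Variable R : realType.
Local Notation C := R[i].
Variables q t : C.
Hypotheses (q_lt1 : nrm q < 1) (t_lt1 : nrm t < 1).
Variable N : nat.
Local Notation T := (@on_torus R N).
Local Notation density := (@macdonald_density R q t N).
Local Notation sym := (@mpoly.symmetric N C).
Local Notation V := (@vandermonde_poly C N).
Implicit Types (f g h : mpoly N C) (z : N.-tuple C) (m : multinom N).

Let bT := @on_torus_bounded R N.

(** [theta] without its double zero at [u = 1]. On the unit circle it is invertible, and its inverse
    is again approximable. *)
Definition weight_tail (u : C) : C :=
  (qpoch (q * u) q * qpoch (q * u^-1) q) / (qpoch (t * u) q * qpoch (t * u^-1) q).

Definition weight_tail_inv (u : C) : C :=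
  (qpoch (t * u) q * qpoch (t * u^-1) q) / (qpoch (q * u) q * qpoch (q * u^-1) q).

Lemma theta_tail u : theta q t u = (1 - u) * (1 - u^-1) * weight_tail u.
Proof.
rewrite /theta /weight_tail (qpochS u q_lt1) (qpochS u^-1 q_lt1) [RHS]mulrA.
by congr (_ / _); rewrite (mulrC u q) (mulrC u^-1 q); ring.
Qed.

Lemma weight_tail_mulV u : nrm u = 1 -> weight_tail u * weight_tail_inv u = 1.
Proof.
move=> u1; have nz (c : C) : nrm c < 1 -> qpoch (c * u) q != 0 /\ qpoch (c * u^-1) q != 0.
  by move=> c1; split; apply: qpoch_neq0 => //; rewrite nrmM ?nrmV u1 ?invr1 mulr1.
have [h1 h2] := nz t t_lt1; have [h3 h4] := nz q q_lt1.
by rewrite /weight_tail /weight_tail_inv; field; rewrite h1 h2 h3 h4.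
Qed.

Definition density_tail_inv z : C :=
  \prod_(i < N) \prod_(j < N | (i < j)%N) weight_tail_inv (tnth z i / tnth z j).

Lemma lapprox_density_tail_inv : lapprox T density_tail_inv.
Proof.
apply: lapprox_prod => // i _; apply: lapprox_prod => // j _.
have h z : T z -> nrm (q * (tnth z i / tnth z j)) <= nrm q /\
    nrm (q * (tnth z i / tnth z j)^-1) <= nrm q.
  move=> z1; have [h1 h2] := nrm_ratio_torus (z1 i) (z1 j).
  by rewrite !(nrmM q) h1 h2 mulr1 lexx.
exact: (@lapprox_qpoch_ratio _ _ q_lt1 _ _ bT i j t t q q (nrm q) q_lt1
  (fun z Tz => proj1 (h z Tz)) (fun z Tz => proj2 (h z Tz))).
Qed.

Lemma density_tailE z : T z -> density z * density_tail_inv z =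
  meval (tnth z) V * meval (fun i => (tnth z i)^-1) V.
Proof.
move=> Tz; rewrite densityE /density_tail_inv !meval_vandermonde -!big_split.
apply: eq_bigr => i _; rewrite -!big_split; apply: eq_bigr => j _ /=.
have [u1 _] := nrm_ratio_torus (Tz i) (Tz j).
rewrite theta_tail -[LHS]mulrA (weight_tail_mulV u1) mulr1.
by field; rewrite !on_torus_neq0.
Qed.

Lemma torus_integral_meval f g :
  torus_integral (fun z => meval (tnth z) f * meval (fun i => (tnth z i)^-1) g) =
  \sum_(m <- msupp f) mcoeff m f * mcoeff m g.
Proof.
transitivity (torus_integral (fun z : N.-tuple C => laurent
    [seq (c.1 * d.1, c.2 + d.2) | c <- laurent_of f, d <- [seq (d.1, - d.2) | d <- laurent_of g]]
    (tnth z))).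
  apply: eq_torus_integral => z Tz; rewrite laurent_mul => [|i]; last exact: on_torus_neq0.
  by rewrite laurent_inv !laurent_ofE.
rewrite torus_integral_laurent /const_term big_mkcond big_allpairs_dep /= {1}/laurent_of big_map.
apply: eq_bigr => m _; rewrite /laurent_of 2!big_map /=.
have E m' : ([ffun i => (m i)%:Z] + - [ffun i => (m' i)%:Z] == 0 :> {ffun 'I_N -> int}) = (m' == m).
  rewrite subr_eq0; apply/eqP/eqP => [/ffunP h|-> //].
  by apply/mnmP => i; have := h i; rewrite !ffunE => -[].
under eq_bigr do rewrite E.
have [ms|/memN_msupp_eq0 m0] := boolP (m \in msupp g); last first.
  by rewrite m0 mulr0 big1_seq // => m' _; case: eqP => // ->; rewrite m0 mulr0.
by rewrite (bigD1_seq m) ?msupp_uniq //= eqxx big1 ?addr0 // => m' /negbTE ->.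
Qed.

(* The coefficients of [f * V] in [torus_integral_meval] are paired with their
   conjugates, so the integral is the sum of their squared moduli. *)
Lemma conj_coef_pos f : f != 0 ->
  \sum_(m <- msupp f) mcoeff m f * mcoeff m (map_mpoly Num.conj f) != 0.
Proof.
move=> f0; rewrite gt_eqF //.
rewrite (bigD1_seq (mlead f)) ?msupp_uniq ?mlead_supp //= ltr_wpDr ?sumr_ge0 // => [m _|].
  by rewrite mcoeff_map_mpoly -normCK exprn_ge0.
by rewrite mcoeff_map_mpoly -normCK exprn_gt0 // normr_gt0 mleadc_eq0.
Qed.

Lemma conj_vandermonde : map_mpoly Num.conj V = V.
Proof.
rewrite rmorph_prod; apply: eq_bigr => i _; rewrite rmorph_prod; apply: eq_bigr => j _.
by rewrite rmorphB /= !map_mpolyX.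
Qed.

(** Vanishing against Laurent polynomials extends to their uniform limits, in particular to the
    function [h] below. Against [h] the invertible part of the density drops out, and what remains
    is the sum of the squared moduli of the coefficients of [f * V]. *)
Lemma density_nondegenerate f : f != 0 ->
  ~ (forall s, torus_integral (fun z => meval (tnth z) f * density z * laurent s (tnth z)) = 0).
Proof.
move=> f0 H.
pose fc := map_mpoly Num.conj f.
pose U z := meval (tnth z) f * density z.
have UA : lapprox T U by apply: lapproxM => //; [exact: lapprox_meval|exact: lapprox_density].
pose h z := meval (fun i => (tnth z i)^-1) fc * density_tail_inv z.
have hA : lapprox T h.
  by apply: lapproxM => //; [exact: lapprox_mevalV|exact: lapprox_density_tail_inv].
have [M M0 UM] := lapprox_bounded bT UA.
have Uh : torus_integral (fun z => U z * h z) = 0.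
  apply: (@nrm_small_eq _ _ _ (2 ^+ N * M)) => e /hA[s hs].
  have sA := lapprox_laurent T s.
  have NA : lapprox T (fun z => -1 * laurent s (tnth z)) by apply: lapproxZ.
  have dA : lapprox T (fun z => U z * (h z - laurent s (tnth z))).
    apply: lapproxM => //; apply: lapprox_eq (lapproxD hA NA) => z _.
    by rewrite mulN1r.
  have -> : torus_integral (fun z => U z * h z) - 0 =
      torus_integral (fun z => U z * (h z - laurent s (tnth z))).
    rewrite subr0 -[RHS]addr0 -(H s) -torus_integralD //; last exact: lapproxM.
    by apply: eq_torus_integral => z _; rewrite /U; ring.
  rewrite -mulrA; apply: torus_integral_bound => // z Tz.
  by rewrite nrmM ler_pM ?nrm_ge0 ?UM ?hs.
have /negP := conj_coef_pos (mulf_neq0 f0 (@vandermonde_poly_neq0 _ N)); apply.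
apply/eqP; rewrite -torus_integral_meval -[RHS]Uh; apply: eq_torus_integral => z Tz.
have -> : map_mpoly Num.conj (f * V) = fc * V.
  by rewrite -{2}conj_vandermonde; exact: rmorphM.
rewrite !mevalM /U /h mulrACA -(density_tailE Tz); ring.
Qed.

Lemma meval_msym (p : {perm 'I_N}) f (x : 'I_N -> C) :
  meval x (msym p f) = meval (fun i => x (p i)) f.
Proof.
have -> : msym p f = \sum_(m <- msupp f) msym p (mcoeff m f *: mpolyX C m).
  by rewrite {1}(mpolyE f); exact: raddf_sum.
rewrite [LHS]raddf_sum [RHS]mevalE; apply: eq_bigr => m _.
rewrite /= msymZ msym_permX mevalZ mevalX; congr (_ * _).
rewrite (reindex_inj (@perm_inj _ p)); apply: eq_bigr => i _.
by rewrite permute_mnmE permK.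
Qed.

Lemma meval_symmetric (p : {perm 'I_N}) f (x : 'I_N -> C) : f \is sym ->
  meval (fun i => x (p i)) f = meval x f.
Proof. by move=> /issymP fs; rewrite -meval_msym fs. Qed.

Lemma symmetric_nondegenerate f : f \is sym -> f != 0 ->
  ~ (forall k g, g \is sym ->
       torus_product q t ((\prod_(i < N) mpolyX C (mnm1 i)) ^+ k * f) g = 0).
Proof.
move=> fs f0 H; apply: (density_nondegenerate f0) => s.
pose U z := meval (tnth z) f * density z.
have UA : lapprox T U by apply: lapproxM => //; [exact: lapprox_meval|exact: lapprox_density].
have Uperm p z : U (permute_tuple p z) = U z.
  rewrite /U density_perm; congr (_ * _).
  have -> : tnth (permute_tuple p z) = fun i => tnth z (p i).
    by apply/funext => i; rewrite tnth_mktuple.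
  exact: meval_symmetric.
pose mon (a : {ffun 'I_N -> int}) z := laurent [:: (1, a)] (tnth z).
have monA a : lapprox T (mon a) := lapprox_laurent T _.
have UmA a : lapprox T (fun z => U z * mon a z) := lapproxM bT UA (monA a).
have mon0 a : torus_integral (fun z => U z * mon a z) = 0.
  (* [k] bounds every [|a i|], so [a i = k - m i] with [m i] a natural number: the Laurent monomial
     is a power of the product of the variables times a monomial in their inverses. *)
  pose k := (\sum_(i < N) `|a i|)%N.
  pose m : multinom N := Multinom [tuple `|k%:Z - a i|%N | i < N].
  have mE i : a i = k%:Z - (m i)%:Z.
    rewrite mnm_tnth tnth_mktuple gez0_abs ?subKr // subr_ge0.
    apply: le_trans (lez_abs _) _; rewrite lez_nat /k (bigD1 i) //= leq_addr //.
  (* The monomial may be symmetrized because [U] and the integral are invariant under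
     permutations. *)
  pose G := \sum_(p : {perm 'I_N}) msym p (mpolyX C m).
  have Gs : G \is sym.
    apply/issymP => s'; rewrite /G raddf_sum [RHS](reindex_inj (mulIg s')) /=.
    by apply: eq_bigr => p _; rewrite msymMm.
  have pA p : lapprox T (fun z => U z * mon a (permute_tuple p z)).
    by apply: lapproxM => //; exact: lapprox_permute.
  have E : torus_integral (fun z => U z * mon a z) *+ #|{: {perm 'I_N}}| = 0.
    rewrite -[RHS](H k G Gs) -sumr_const.
    transitivity (\sum_(p : {perm 'I_N}) torus_integral (fun z => U z * mon a (permute_tuple p z))).
      apply: eq_bigr => p _; apply: etrans (esym (torus_integral_perm p (UmA a))) _.
      by apply: eq_torus_integral => z _; rewrite Uperm.
    rewrite -torus_integral_sum //; apply: eq_torus_integral => z Tz.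
    rewrite -mulr_sumr [meval _ G]raddf_sum /= mevalM rmorphXn rmorph_prod /=.
    have -> : \prod_(i < N) meval (tnth z) (mpolyX C (mnm1 i)) = \prod_(i < N) tnth z i.
      by apply: eq_bigr => i _; rewrite mevalXU.
    have arr (A B S d : C) : A * B * S * d = B * d * (A * S) by ring.
    rewrite arr; congr (_ * _).
    rewrite mulr_sumr; apply: eq_bigr => p _.
    rewrite meval_msym mevalX /mon /laurent big_seq1 /= mul1r.
    rewrite [Y in Y ^+ k](reindex_inj (@perm_inj _ p)) /= -prodrXl -big_split /=.
    apply: eq_bigr => i _; rewrite tnth_mktuple mE expfzDr ?on_torus_neq0 //.
    by rewrite -exprnN exprVn.
  move/eqP: E; rewrite -mulr_natr mulf_eq0 pnatr_eq0 => /orP[/eqP //|/eqP c0].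
  by have : (0 < #|{: {perm 'I_N}}|)%N; [apply/card_gt0P; exists 1%g|rewrite c0].
rewrite -[RHS](@big1 _ _ +%R _ s xpredT (fun=> 0)) //.
transitivity (torus_integral (fun z => \sum_(c <- s) c.1 * (U z * mon c.2 z))).
  apply: eq_torus_integral => z _; rewrite {1}/laurent mulr_sumr; apply: eq_bigr => c _.
  by rewrite /mon /laurent big_seq1 /= mul1r mulrCA.
rewrite torus_integral_sum => [|c _]; last exact: lapproxZ.
by apply: eq_bigr => c _; rewrite torus_integralZ // mon0 mulr0.
Qed.

End Nondegeneracy.

(** * Monomial symmetric polynomials *)

Section MonomialSymmetric.
Variable C : comNzRingType.
Variable N : nat.
Implicit Types (kappa m : multinom N).

Lemma mcoeff_monomial_sym kappa m :
  mcoeff m (monomial_sym C kappa) = (perm_eq (val m) (val kappa))%:R.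
Proof.
have E s : size s = N -> (Multinom [tuple nth 0%N s i | i < N] == m) = (s == val m :> seq nat).
  move=> sN; apply/eqP/eqP => [<-|->].
    apply: (@eq_from_nth _ 0%N) => [|i]; first by rewrite sN size_tuple.
    by rewrite sN => iN; rewrite (_ : i = val (Ordinal iN)) // -tnth_nth tnth_mktuple.
  by apply/mnmP => i; rewrite mnm_tnth tnth_mktuple mnm_tnth (tnth_nth 0%N).
have sz s : s \in permutations (val kappa) -> size s = N.
  by rewrite mem_permutations => /perm_size ->; rewrite size_tuple.
rewrite /monomial_sym raddf_sum /=.
transitivity (\sum_(s <- permutations (val kappa)) ((s == val m :> seq nat)%:R : C)).
  by apply: eq_big_seq => s /sz sN; rewrite mcoeffX E.
have [ms|ms] := boolP ((val m : seq nat) \in permutations (val kappa)).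
  rewrite (bigD1_seq _ ms (permutations_uniq _)) /= eqxx big1 => [|s /negbTE -> //].
  by move: ms; rewrite mem_permutations => ->; rewrite addr0.
rewrite big1_seq => [|s /andP[_ sk]].
  by move: ms; rewrite mem_permutations => /negbTE ->.
by case: eqP => // E'; move: ms; rewrite -E' sk.
Qed.

Lemma perm_mnm_partition kappa m : is_partition_vec kappa -> is_partition_vec m ->
  perm_eq (val m) (val kappa) -> m = kappa.
Proof.
have sp (x : multinom N) : is_partition_vec x -> sorted geq (val x).
  move=> xp; apply/(sortedP 0%N) => i; rewrite size_tuple => iN.
  have := xp (Ordinal (ltnW iN)) (Ordinal iN) (leqnSn _).
  by rewrite !mnm_tnth !(tnth_nth 0%N).
move=> /sp ks /sp ms pe; apply/val_inj/val_inj.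
apply: sorted_eq ms ks pe => [a b c h1 h2|a b]; first exact: leq_trans h2 h1.
by rewrite andbC -eqn_leq => /eqP.
Qed.

Lemma monomial_sym_symmetric kappa : monomial_sym C kappa \is @mpoly.symmetric N C.
Proof.
apply/issymP => s; apply/mpolyP => m; rewrite mcoeff_sym !mcoeff_monomial_sym.
have /permPl -> // : perm_eq (val (permute_mnm s m)) (val m).
by apply/tuple_permP; exists s.
Qed.

End MonomialSymmetric.

(** * Consequences of algebraic independence *)

Section GenericParameters.
Variable R : realType.
Local Notation C := R[i].
Variables q t : C.
Hypothesis qt_generic : generic q t.

Let mono (x y : nat) : mpoly 2 rat := mpolyX rat (Multinom [tuple x; y]).

Let eval_mono x y : meval (tnth [tuple q; t]) (map_mpoly ratr (mono x y)) = q ^+ x * t ^+ y.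
Proof.
rewrite /mono map_mpolyX mevalX big_ord_recl big_ord1 /=.
by rewrite !mnm_tnth.
Qed.

Lemma generic_neq0 : q != 0 /\ t != 0.
Proof.
have nz x y : q ^+ x * t ^+ y != 0.
  rewrite -eval_mono; apply: qt_generic; apply/eqP.
  move/(congr1 (mcoeff (Multinom [tuple x; y]))); rewrite mcoeffX eqxx mcoeff0.
  by move/eqP; rewrite oner_eq0.
by have := nz 1%N 0%N; have := nz 0%N 1%N; rewrite !expr0 !expr1 mul1r mulr1.
Qed.

(** The exponents [N - k.+1] of [t] are distinct, so terms of different index cannot cancel: if
    [a k] and [b k] differ, the monomial [q ^+ a k * t ^+ (N - k.+1)] has coefficient 1 in the
    difference. *)
Lemma generic_sum_inj (N : nat) (a b : 'I_N -> nat) :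
  \sum_(k < N) t ^+ (N - k.+1) * q ^+ a k = \sum_(k < N) t ^+ (N - k.+1) * q ^+ b k ->
  a =1 b.
Proof.
move=> E k; apply/eqP/negPn/negP => ab.
pose p (c : 'I_N -> nat) : mpoly 2 rat := \sum_(i < N) mono (c i) (N - i.+1).
have pE c : meval (tnth [tuple q; t]) (map_mpoly ratr (p c)) =
    \sum_(i < N) t ^+ (N - i.+1) * q ^+ c i.
  transitivity (\sum_(i < N) meval (tnth [tuple q; t]) (map_mpoly ratr (mono (c i) (N - i.+1)))).
    by rewrite -raddf_sum; congr meval; exact: raddf_sum.
  by apply: eq_bigr => i _ /=; rewrite eval_mono mulrC.
have /qt_generic : p a - p b != 0.
  pose m := Multinom [tuple a k; (N - k.+1)%N].
  have mE (c : 'I_N -> nat) (i : 'I_N) : mcoeff m (mono (c i) (N - i.+1)%N) = ((c i == a k) && (i == k))%:R.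
    rewrite mcoeffX; congr (nat_of_bool _)%:R; apply/eqP/andP => [/mnmP h|[/eqP e /eqP ik]].
      have := h ord0; have := h (lift ord0 ord0); rewrite !mnm_tnth /= => h1 h0.
      split; apply/eqP; first exact: h0.
      apply: ord_inj; move: h1; rewrite /tnth /=.
      have := ltn_ord i; have := ltn_ord k; lia.
    by rewrite /m -e ik.
  apply/eqP => /(congr1 (mcoeff m)); rewrite mcoeff0 mcoeffB !raddf_sum /=.
  rewrite (bigD1 k) //= mE !eqxx /= big1 ?addr0 => [|i ik]; last first.
    by rewrite mE (negbTE ik) andbF.
  rewrite big1 ?subr0 => [/eqP|i _]; first by rewrite oner_eq0.
  by rewrite mE; case: (i =P k) => [->|]; rewrite ?andbF // eq_sym (negbTE ab).
have -> : map_mpoly ratr (p a - p b) = map_mpoly ratr (p a) - map_mpoly ratr (p b) :> mpoly 2 C.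
  exact: raddfB.
move/negP; apply; apply/eqP; apply: etrans (mevalB _ _ _) _.
by apply: etrans (congr2 (fun x y => x - y) (pE a) (pE b)) _; apply/eqP; rewrite subr_eq0 E.
Qed.

End GenericParameters.

(** * Eigenfunctions built from triangularity *)

Section Eigenfunctions.
Variable R : realType.
Local Notation C := R[i].
Variables q t : C.
Hypotheses (q_lt1 : nrm q < 1) (t_lt1 : nrm t < 1) (qt_generic : generic q t).
Variable N : nat.
Local Notation P := (mpoly N C).
Local Notation sym := (@mpoly.symmetric N C).
Local Notation eig := (@macdonald_eig C N q t).
Local Notation "<< f , g >>" := (@torus_product R q t N f g).
Implicit Types (f g h E : P) (kappa lambda eta m : multinom N).

Let q_neq0 : q != 0. Proof. by case: (generic_neq0 qt_generic). Qed.
Let t_neq0 : t != 0. Proof. by case: (generic_neq0 qt_generic). Qed.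

Lemma eig_inj kappa lambda : eig kappa = eig lambda -> kappa = lambda.
Proof. by move=> /(generic_sum_inj qt_generic) h; apply/mnmP. Qed.

Lemma monomial_sym_dominated kappa : is_partition_vec kappa ->
  dominated_poly kappa (monomial_sym C kappa).
Proof.
move=> kp; split=> [|m mp]; first exact: monomial_sym_symmetric.
rewrite mcoeff_monomial_sym pnatr_eq0 eqb0 negbK => /(perm_mnm_partition kp mp) ->.
exact: dominated_refl.
Qed.

Lemma monomial_sym_lead kappa : mcoeff kappa (monomial_sym C kappa) = 1.
Proof. by rewrite mcoeff_monomial_sym perm_refl. Qed.

Lemma mlead_cancel f g : (mlead g <= mlead f)%O -> mcoeff (mlead f) g = 1 ->
  f - mcoeff (mlead f) f *: g != 0 ->
  (mlead (f - mcoeff (mlead f) f *: g)%R < mlead f)%O.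
Proof.
move=> gf g1 h0; rewrite lt_neqAle; apply/andP; split.
  apply: contraNneq h0 => E; rewrite -mleadc_eq0 E mcoeffB mcoeffZ g1 mulr1.
  by rewrite subrr.
apply: le_trans (mleadB_le _ _) _; rewrite leUx lexx /=.
exact: le_trans (mleadZ_le _ _) gf.
Qed.

(** Zero is kept apart because its leading exponent is 0 by convention: cancelling the leading term
    of a constant yields 0 without lowering [mlead]. *)
Lemma mlead_ind (A : P -> Prop) : A 0 ->
  (forall f, f != 0 -> (forall g, g != 0 -> (mlead g < mlead f)%O -> A g) -> A f) ->
  forall f, A f.
Proof.
move=> A0 H f; have [->|] := eqVneq f 0; first exact: A0.
move: {2}(mlead f) (erefl (mlead f)) => m; move: f.
elim/(well_founded_induction (@ltom_wf N)): m => m IH f fm f0.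
by apply: H => // g g0 gf; apply: (IH (mlead g)) => //; rewrite -fm.
Qed.

Definition eigenpoly kappa E : Prop :=
  [/\ dominated_poly kappa E, mcoeff kappa E = 1 & macop q t E = eig kappa *: E].

Lemma eigenpoly_mlead kappa E : eigenpoly kappa E -> mlead E = kappa.
Proof.
move=> [Ed E1 _]; apply/le_anti; rewrite (dominated_poly_le Ed) /=.
by apply: msupp_le_mlead; rewrite mcoeff_msupp E1 oner_eq0.
Qed.

(** Back substitution in a triangular operator whose diagonal entries are distinct by genericity. In
    [solve], [macop q t - eig kappa] is inverted on polynomials without [kappa] term, by peeling off
    eigenpolynomials supplied by the outer induction; the solution [u] then corrects the monomial
    symmetric polynomial. *)
Lemma eigenpoly_exists kappa : is_partition_vec kappa -> exists E, eigenpoly kappa E.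
Proof.
elim/(well_founded_induction (@ltom_wf N)): kappa => kappa IH kp.
have sol0 : exists u : P, [/\ dominated_poly kappa u, mcoeff kappa u = 0 &
    macop q t u - eig kappa *: u = 0].
  have s0 : (0 : P) \is sym by exact: rpred0.
  exists 0; split; [split=> // m _; by rewrite mcoeff0 eqxx|exact: mcoeff0|].
  by rewrite -(scale0r (0 : P)) (macopZ q t _ s0) !scale0r scaler0 subrr.
have solve f : dominated_poly kappa f -> mcoeff kappa f = 0 ->
    exists u, [/\ dominated_poly kappa u, mcoeff kappa u = 0 &
      macop q t u - eig kappa *: u = f].
  elim/mlead_ind: f => [|f f0 IHf] fd fk.
    exact: sol0.
  pose eta := mlead f.
  have ed : dominated eta kappa by exact: dominated_poly_mlead.
  have ek : eta <> kappa by move=> E; move: fk; rewrite -E => /eqP; rewrite mleadc_eq0 (negbTE f0).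
  have elt := dominated_lt ed ek.
  have [E Ee] := IH _ elt (mlead_partition (proj1 fd)).
  have [Ed E1 ED] := Ee.
  have Ed' := dominated_poly_trans ed Ed.
  have Ek : mcoeff kappa E = 0 by apply: mcoeff_gt_mlead; rewrite (eigenpoly_mlead Ee).
  pose c := mcoeff eta f.
  pose f' := f - c *: E.
  have f'd : dominated_poly kappa f'.
    by rewrite /f' -scaleNr; apply: dominated_polyD => //; exact: dominated_polyZ.
  have f'k : mcoeff kappa f' = 0 by rewrite mcoeffB mcoeffZ Ek fk mulr0 subrr.
  have [u' [u'd u'k u'D]] : exists u, [/\ dominated_poly kappa u, mcoeff kappa u = 0 &
      macop q t u - eig kappa *: u = f'].
    have [f'0|f'0] := eqVneq f' 0; last first.
      by apply: IHf => //; apply: mlead_cancel; rewrite ?(eigenpoly_mlead Ee).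
    by rewrite f'0.
  have e0 : eig eta - eig kappa != 0.
    by rewrite subr_eq0; apply/eqP => /eig_inj.
  (* On [E] the operator minus [eig kappa] acts as multiplication by [eig eta - eig kappa]. *)
  pose d := c / (eig eta - eig kappa).
  exists (d *: E + u'); split.
  - exact: (dominated_polyD (dominated_polyZ d Ed') u'd).
  - by rewrite mcoeffD mcoeffZ Ek u'k mulr0 addr0.
  - have dEs : d *: E \is sym by apply: rpredZ; exact: (proj1 Ed).
    rewrite (macopD q t dEs (proj1 u'd)) (macopZ q t d (proj1 Ed)) ED.
    rewrite scalerDr opprD addrACA u'D !scalerA -scalerBl /f'.
    have -> : d * eig eta - eig kappa * d = c by rewrite mulrC -mulrBl mulrC divfK.
    by rewrite addrC subrK.
have md := monomial_sym_dominated kp; have m1 := monomial_sym_lead kappa.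
pose mk := monomial_sym C kappa.
have [||u [ud uk uD]] := solve (eig kappa *: mk - macop q t mk).
- rewrite -scaleN1r; apply: dominated_polyD; first exact: dominated_polyZ.
  by apply: dominated_polyZ; exact: dominated_poly_macop.
- by rewrite mcoeffB mcoeffZ mcoeff_macop // m1 subrr.
exists (mk + u); split.
- exact: dominated_polyD.
- by rewrite mcoeffD m1 uk addr0.
- have Du : macop q t u = (eig kappa *: mk - macop q t mk) + eig kappa *: u.
    by rewrite -uD subrK.
  rewrite (macopD q t (proj1 md) (proj1 ud)) scalerDr Du addrA; congr (_ + _).
  rewrite addrC; exact: subrK.
Qed.

Lemma self_adjoint f g : f \is sym -> g \is sym -> << macop q t f, g >> = << f, macop q t g >>.
Proof. exact: torus_product_macop. Qed.

(** For [f] the eigenvalue equation is only assumed after pairing with [g], the form in which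
    [eigen_XallX] provides it. *)
Lemma eigen_orthogonal a b f g : a != b -> f \is sym -> g \is sym ->
  << macop q t f, g >> = a * << f, g >> -> macop q t g = b *: g -> << f, g >> = 0.
Proof.
move=> ab fs gs fE gE; have := self_adjoint fs gs; rewrite fE gE torus_productZr //.
by move/eqP; rewrite -subr_eq0 -mulrBl mulf_eq0 subr_eq0 (negbTE ab) => /eqP.
Qed.

Lemma eigenpoly_orthogonal_lower kappa E g : eigenpoly kappa E -> g \is sym ->
  (g != 0 -> (mlead g < kappa)%O) -> << g, E >> = 0.
Proof.
move=> Ee; have [Ed E1 ED] := Ee; have Es := proj1 Ed.
elim/mlead_ind: g => [|g g0 IHg] gs gk; first by rewrite torus_productC // torus_product0r.
have [E' E'e] := eigenpoly_exists (mlead_partition gs).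
have [E'd E'1 E'D] := E'e; have E's := proj1 E'd.
pose g' := g - mcoeff (mlead g) g *: E'.
have -> : g = mcoeff (mlead g) g *: E' + g' by rewrite addrC subrK.
have g's : g' \is sym by exact: (rpredB gs (rpredZ _ E's)).
rewrite torus_productDl // torus_productZl //.
have -> : << E', E >> = 0.
  apply: (@eigen_orthogonal (eig (mlead g)) (eig kappa)) => //.
    by apply/eqP => /eig_inj h; move: (gk g0); rewrite h ltxx.
  by rewrite E'D torus_productZl.
rewrite mulr0 add0r; have [->|g'0] := eqVneq g' 0; first by rewrite torus_productC // torus_product0r.
have lt : (mlead g' < mlead g)%O by apply: mlead_cancel; rewrite ?(eigenpoly_mlead E'e).
by apply: IHg => // _; apply: lt_trans lt (gk g0).
Qed.

(** [h] is orthogonal to every eigenpolynomial with another leading exponent. When [g] has the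
    leading exponent of [h], the leading term is removed with [h] itself, which costs nothing
    because its norm is 0. *)
Lemma orthogonal_all h : h \is sym -> h != 0 ->
  (forall g, g \is sym -> << macop q t h, g >> = eig (mlead h) * << h, g >>) ->
  << h, h >> = 0 -> forall g, g \is sym -> << h, g >> = 0.
Proof.
move=> hs h0 hE hh g; elim/mlead_ind: g => [|g g0 IHg] gs; first by rewrite torus_product0r.
have [E Ee] := eigenpoly_exists (mlead_partition gs).
have [Ed E1 ED] := Ee; have Es := proj1 Ed.
have [gh|gh] := eqVneq (mlead g) (mlead h).
  pose c := mcoeff (mlead g) g / mcoeff (mlead h) h.
  pose h1 := (mcoeff (mlead h) h)^-1 *: h.
  have hl : mcoeff (mlead h) h != 0 by rewrite mleadc_eq0.
  pose g' := g - mcoeff (mlead g) g *: h1.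
  have h1s : h1 \is sym by rewrite rpredZ.
  have g's : g' \is sym by exact: (rpredB gs (rpredZ _ h1s)).
  have gE : g = mcoeff (mlead g) g *: h1 + g' by rewrite addrC subrK.
  rewrite {1}gE.
  rewrite torus_productDr // !torus_productZr // hh !mulr0 add0r.
  have [->|g'0] := eqVneq g' 0; first by rewrite torus_product0r.
  apply: IHg => //; apply: mlead_cancel => //.
    by rewrite gh mleadZ_le.
  by rewrite gh mcoeffZ mulVf.
pose g' := g - mcoeff (mlead g) g *: E.
have g's : g' \is sym by exact: (rpredB gs (rpredZ _ Es)).
have -> : g = mcoeff (mlead g) g *: E + g' by rewrite addrC subrK.
rewrite torus_productDr // torus_productZr //.
have -> : << h, E >> = 0.
  apply: (@eigen_orthogonal (eig (mlead h)) (eig (mlead g))) => //; last exact: hE.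
  by apply/eqP => /eig_inj h'; move: gh; rewrite h' eqxx.
rewrite mulr0 add0r; have [->|g'0] := eqVneq g' 0; first by rewrite torus_product0r.
by apply: IHg => //; apply: mlead_cancel; rewrite ?(eigenpoly_mlead Ee).
Qed.

End Eigenfunctions.

(** * Macdonald polynomials are eigenfunctions *)

Section MacdonaldEigen.
Variable R : realType.
Local Notation C := R[i].
Variables q t : C.
Hypotheses (q_lt1 : nrm q < 1) (t_lt1 : nrm t < 1) (qt_generic : generic q t).
Variable N : nat.
Local Notation P := (mpoly N C).
Local Notation sym := (@mpoly.symmetric N C).
Local Notation eig := (@macdonald_eig C N q t).
Local Notation "<< f , g >>" := (@torus_product R q t N f g).
Local Notation Xall := (\prod_(i < N) mpolyX C (mnm1 i) : P).
Implicit Types (f g h E : P) (kappa lambda eta m : multinom N).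

Let q_neq0 : q != 0. Proof. by case: (generic_neq0 qt_generic). Qed.
Let t_neq0 : t != 0. Proof. by case: (generic_neq0 qt_generic). Qed.

Definition const_mnm k : multinom N := Multinom [tuple k | i < N].

Lemma XallX k : Xall ^+ k = mpolyX C (const_mnm k).
Proof.
rewrite mpolyXE_id -prodrXl; apply: eq_bigr => i _.
by rewrite mnm_tnth tnth_mktuple.
Qed.

Lemma meval_XallX k x : meval x (Xall ^+ k) = (\prod_i x i) ^+ k.
Proof.
rewrite XallX mevalX -prodrXl; apply: eq_bigr => i _.
by rewrite mnm_tnth tnth_mktuple.
Qed.

Lemma XallX_sym k : Xall ^+ k \is sym.
Proof.
rewrite XallX; apply/issymP => s; rewrite msymX; congr mpolyX.
by apply/mnmP => i; rewrite !mnm_tnth !tnth_mktuple mnm_tnth tnth_mktuple.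
Qed.

(** A [q]-shift of one variable multiplies [Xall ^+ k] by [q ^+ k], and raising all exponents by [k]
    multiplies the eigenvalue by the same factor. Pairing with [g] lets the density absorb the
    points where coordinates coincide. *)
Lemma eigen_XallX k h g : h \is sym -> h != 0 -> macop q t h = eig (mlead h) *: h ->
  g \is sym -> << macop q t (Xall ^+ k * h), g >> =
    eig (mlead (Xall ^+ k * h)) * << Xall ^+ k * h, g >>.
Proof.
move=> hs h0 hE gs.
have ks := XallX_sym k; have khs : Xall ^+ k * h \is sym by exact: rpredM.
have -> : eig (mlead (Xall ^+ k * h)) = q ^+ k * eig (mlead h).
  have X0 : mpolyX C (const_mnm k) != 0 by rewrite -mleadc_eq0 mleadXm mcoeffX eqxx oner_eq0.
  rewrite XallX mleadM // mleadXm /macdonald_eig mulr_sumr; apply: eq_bigr => i _.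
  by rewrite mnmDE mnm_tnth tnth_mktuple exprD mulrCA.
apply: etrans (torus_integralZ _ (lapprox_torus_product q_lt1 t_lt1 _ _)).
apply: eq_torus_integral => z Tz; rewrite mulrA; apply: (density_injective t q_lt1 Tz) => zI.
rewrite mulrA; congr (_ * _).
rewrite (meval_macop q t khs zI) mevalM meval_XallX.
have := congr1 (meval (tnth z)) hE; rewrite (meval_macop q t hs zI) mevalZ.
rewrite /Dop -mulrA [X in _ = q ^+ k * X]mulrCA => <-.
rewrite mulr_sumr mulr_sumr; apply: eq_bigr => i _.
by rewrite mevalM meval_XallX prod_shift_var exprMn; ring.
Qed.

Lemma eigen_norm_neq0 h : h \is sym -> h != 0 -> macop q t h = eig (mlead h) *: h ->
  << h, h >> != 0.
Proof.
move=> hs h0 hE; apply/eqP => hh.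
apply: (symmetric_nondegenerate q_lt1 t_lt1 hs h0) => k g gs.
have khs : Xall ^+ k * h \is sym by apply: rpredM => //; exact: XallX_sym.
have kh0 : Xall ^+ k * h != 0.
  by rewrite mulf_neq0 // XallX -mleadc_eq0 mleadXm mcoeffX eqxx oner_eq0.
apply: (orthogonal_all q_lt1 t_lt1 qt_generic khs kh0) => //.
  by move=> g' g's; exact: eigen_XallX.
(* [Xall] times its value at the inverted variables is 1, so its powers do not change the norm. *)
rewrite -hh; apply: eq_torus_integral => z Tz; congr (_ * _).
rewrite !mevalM !meval_XallX mulrACA -exprMn -big_split /=.
by rewrite big1 ?expr1n ?mul1r // => i _; rewrite mulfV // on_torus_neq0.
Qed.

(** Test [f] against the eigenpolynomial [E] of its leading exponent: what lies below is orthogonal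
    to [E], which leaves the leading coefficient times the nonzero norm of [E]. *)
Lemma radical_trivial lambda f : dominated_poly lambda f -> mcoeff lambda f = 0 ->
  (forall g, dominated_poly lambda g -> mcoeff lambda g = 0 -> << f, g >> = 0) -> f = 0.
Proof.
move=> fd fl H; apply/eqP/negPn/negP => f0; have fs := proj1 fd.
pose eta := mlead f.
have ed : dominated eta lambda by exact: dominated_poly_mlead.
have el : eta <> lambda by move=> E; move: fl; rewrite -E => /eqP; rewrite mleadc_eq0 (negbTE f0).
have elt := dominated_lt ed el.
have [E Ee] := eigenpoly_exists qt_generic (mlead_partition fs).
have Em := eigenpoly_mlead Ee; have [Ed E1 ED] := Ee; have Es := proj1 Ed.
have E0 : E != 0 by rewrite -mleadc_eq0 Em E1 oner_eq0.
have El : mcoeff lambda E = 0 by apply: mcoeff_gt_mlead; rewrite Em.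
have fE := H E (dominated_poly_trans ed Ed) El.
pose f' := f - mcoeff eta f *: E.
have f's : f' \is sym by exact: (rpredB fs (rpredZ _ Es)).
have fE' : f = mcoeff eta f *: E + f' by rewrite addrC subrK.
have f'E : << f', E >> = 0.
  apply: (eigenpoly_orthogonal_lower q_lt1 t_lt1 qt_generic Ee f's) => f'0.
  by apply: mlead_cancel => //; rewrite Em.
have nE : << E, E >> != 0 by apply: (eigen_norm_neq0 Es E0); rewrite Em ED.
move: fE; rewrite fE' (torus_productDl q_lt1 t_lt1) (torus_productZl q_lt1 t_lt1) f'E addr0.
by move/eqP; rewrite mulf_eq0 (negbTE nE) mleadc_eq0 (negbTE f0).
Qed.

Lemma macdonald_orthogonal lambda f : is_macdonald q t lambda f ->
  forall g, dominated_poly lambda g -> mcoeff lambda g = 0 -> << f, g >> = 0.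
Proof.
move=> [fs _ _ fo] g; elim/mlead_ind: g => [|g g0 IHg] gd gl.
  exact: (torus_product0r q_lt1 t_lt1).
have gs := proj1 gd.
have ep := mlead_partition gs.
have ed : dominated (mlead g) lambda by exact: dominated_poly_mlead.
have el : mlead g <> lambda.
  by move=> E; move: gl; rewrite -E => /eqP; rewrite mleadc_eq0 (negbTE g0).
pose mk := monomial_sym C (mlead g).
have md : dominated_poly (mlead g) mk by exact: monomial_sym_dominated.
have ml : mcoeff lambda mk = 0.
  apply: mcoeff_gt_mlead; apply: le_lt_trans (dominated_poly_le md) _; exact: dominated_lt.
pose g' := g - mcoeff (mlead g) g *: mk.
have gE : g = mcoeff (mlead g) g *: mk + g' by rewrite addrC subrK.
have g'd : dominated_poly lambda g'.
  rewrite /g' -scaleNr; apply: (dominated_polyD gd); apply: dominated_polyZ.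
  exact: dominated_poly_trans md.
have g'l : mcoeff lambda g' = 0 by rewrite mcoeffB mcoeffZ gl ml mulr0 subrr.
rewrite gE (torus_productDr q_lt1 t_lt1) (torus_productZr q_lt1 t_lt1) fo // mulr0 add0r.
have [->|g'0] := eqVneq g' 0; first exact: (torus_product0r q_lt1 t_lt1).
apply: IHg => //; apply: mlead_cancel => //; first exact: dominated_poly_le.
exact: monomial_sym_lead.
Qed.

(* [q'] and [t'] need not be the parameters of the scalar product: the operator
   with parameters [1/q] and [1/t] is self-adjoint for it too. *)
Lemma macdonald_eigen (q' t' : C) lambda f : is_macdonald q t lambda f ->
  (forall g h, g \is sym -> h \is sym -> << macop q' t' g, h >> = << g, macop q' t' h >>) ->
  macop q' t' f = macdonald_eig q' t' lambda *: f.
Proof.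
move=> fm adj; have [fs f1 fdom _] := fm.
have fd : dominated_poly lambda f by split.
have Dd := dominated_poly_macop q' t' fd.
apply/eqP; rewrite -subr_eq0; apply/eqP.
pose e := macdonald_eig q' t' lambda.
(* Triangularity kills the coefficient at [lambda] of [macop q' t' f - e f]. Moving the operator to
   the other side keeps the test polynomial strictly below [lambda], where [f] is orthogonal to
   everything. *)
apply: (@radical_trivial lambda).
- by rewrite -scaleNr; apply: (dominated_polyD Dd); exact: dominated_polyZ.
- by rewrite mcoeffB mcoeffZ (mcoeff_macop _ _ fd) f1 subrr.
move=> g gd gl; rewrite -scaleNr (torus_productDl q_lt1 t_lt1) (torus_productZl q_lt1 t_lt1).
have Dgl : mcoeff lambda (macop q' t' g) = 0 by rewrite (mcoeff_macop _ _ gd) gl mulr0.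
rewrite (adj _ _ fs (proj1 gd)) (macdonald_orthogonal fm (dominated_poly_macop q' t' gd) Dgl).
by rewrite (macdonald_orthogonal fm gd gl) mulr0 addr0.
Qed.

End MacdonaldEigen.

(** * Laurent polynomials obtained by a power of the product of the variables *)

Section TwistedMacdonald.
Variable R : realType.
Local Notation C := R[i].
Variable N : nat.
Variable f : mpoly N C.
Hypothesis fs : f \is @mpoly.symmetric N C.
Variable M : int.

(** [M] may be negative, so the product of [f] with the power [M] of all variables is encoded as a
    list with integer exponents. *)
Definition twist : seq (C * {ffun 'I_N -> int}) :=
  [seq (mcoeff m f, [ffun i => M + (m i)%:Z]) | m <- msupp f].

Lemma twistE x : (forall i, x i != 0) -> laurent twist x = (\prod_i x i) ^ M * meval x f.
Proof.
move=> x0; rewrite /laurent big_map mevalE mulr_sumr; apply: eq_bigr => m _ /=.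
rewrite mulrCA; congr (_ * _).
have -> : (\prod_i x i) ^ M = \prod_i x i ^ M.
  exact: (big_morph (fun y => y ^ M) (fun y z => expfzMl y z M) (exp1rz _ M)).
rewrite -big_split; apply: eq_bigr => i _.
by rewrite ffunE expfzDr.
Qed.

Lemma twist_symmetric (g : {perm 'I_N}) x : (forall i, x i != 0) ->
  laurent twist (fun i => x (g i)) = laurent twist x.
Proof.
move=> x0; rewrite (twistE x0) (twistE (fun i => x0 (g i))) (meval_symmetric _ _ fs).
by congr (_ ^ M * _); rewrite [RHS](reindex_inj (@perm_inj _ g)).
Qed.

Lemma Dop_twist q t e x : q != 0 -> (forall i, x i != 0) -> injective x ->
  macop q t f = e *: f -> Dop q t (laurent twist) x = q ^ M * e * laurent twist x.
Proof.
move=> q0 x0 xI fe.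
have := congr1 (meval x) fe; rewrite (meval_macop q t fs xI) mevalZ => E.
have arr (a b c d : C) : a * b * (c * d) = a * c * (b * d) by ring.
rewrite (twistE x0) arr -E /Dop mulr_sumr; apply: eq_bigr => k _.
have sx i : shift_var k q x i != 0.
  by rewrite /shift_var; case: ifP => _ //; rewrite mulf_neq0.
rewrite (twistE sx) prod_shift_var expfzMl; ring.
Qed.

End TwistedMacdonald.

(** * Partitions and their signed vectors *)

Section Partitions.

Lemma nth_partition_le mu i j : is_partition mu -> (i <= j)%N -> (nth 0%N mu j <= nth 0%N mu i)%N.
Proof.
move=> /andP[ms _] ij; have [jm|jm] := ltnP j (size mu); last by rewrite nth_default.
apply: (sorted_leq_nth (leT := geq)) => //.
- by move=> a b c /= h1 h2; apply: leq_trans h2 h1.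
- by move=> a /=.
- by rewrite inE (leq_ltn_trans ij).
Qed.

Lemma eq_partition mu nu : is_partition mu -> is_partition nu ->
  (forall k, nth 0%N mu k = nth 0%N nu k) -> mu = nu.
Proof.
have le a b : is_partition a -> (forall k, nth 0%N a k = nth 0%N b k) -> (size a <= size b)%N.
  move=> /andP[_ /allP a1] h; rewrite leqNgt; apply/negP => ba.
  have := a1 _ (mem_nth 0%N ba); rewrite h nth_default //.
move=> mp np h; apply: (@eq_from_nth _ 0%N) => //.
by apply/eqP; rewrite eqn_leq !le.
Qed.

Lemma mubarE N mu nu (i : 'I_N) :
  tnth (mubar N mu nu) i = (nth 0%N mu i)%:Z - (nth 0%N nu (N - i.+1))%:Z.
Proof. by rewrite tnth_mktuple. Qed.

Lemma last_mubar_le N mu nu (i : 'I_N) : is_partition mu -> is_partition nu ->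
  last_part (mubar N mu nu) <= tnth (mubar N mu nu) i.
Proof.
move=> mp np; case: N i => [[]//|N] i.
have -> : last_part (mubar N.+1 mu nu) = tnth (mubar N.+1 mu nu) ord_max.
  by rewrite /last_part (last_nth 0) (tnth_nth 0) size_tuple.
rewrite !mubarE; have := nth_partition_le (i := i) (j := ord_max) mp (leq_ord i).
have := nth_partition_le (i := 0) (j := N.+1 - i.+1) np (leq0n _).
rewrite /= subnn; lia.
Qed.

(** By the bound on the lengths, [mu_k] and [nu_{N-1-k}] are not both nonzero, so [mu_k] is the
    positive part of the [k]-th entry. Likewise [nu_k] is the positive part of minus the mirror
    entry, and the two entries agree. *)
Lemma mubar_antisymmetric N mu nu : is_partition mu -> is_partition nu ->
  (size mu + size nu <= N)%N ->
  (forall i : 'I_N, tnth (mubar N mu nu) i = - tnth (mubar N mu nu) (rev_ord i)) -> mu = nu.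
Proof.
move=> mp np sz H; apply: eq_partition => // k.
have [kN|Nk] := ltnP k N; last by rewrite !nth_default //; lia.
have := H (Ordinal kN); rewrite !mubarE /=.
have -> : (N - (N - k.+1).+1)%N = k by lia.
have z a b : (size a + size b <= N)%N -> nth 0%N a k = 0%N \/ nth 0%N b (N - k.+1) = 0%N.
  move=> ab; have [ka|ka] := ltnP k (size a); last by left; rewrite nth_default.
  by right; rewrite nth_default //; lia.
have := z mu nu sz; have := z nu mu; rewrite addnC => /(_ sz); lia.
Qed.

End Partitions.

Lemma abs_le_shift (b x : int) : `|x| <= b -> 0 <= b + x /\ 0 <= b - x.
Proof. by rewrite ler_norml => /andP[h1 h2]; split; lia. Qed.

Lemma rev_exponents (N i : nat) : (i < N)%N ->
  (N - (N - i.+1).+1)%N = i /\ N.-1 = (N - i.+1 + i)%N.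
Proof. by split; lia. Qed.

(** * Comparison of eigenvalues *)

Section Vanishing.
Variable R : realType.
Local Notation C := R[i].
Variables (n : nat) (r t : C) (mu nu : seq nat).
Local Notation N := (2 * n)%N.
Local Notation p := (r ^+ 2).
Local Notation q := (r ^+ 4).
Hypotheses (q_lt1 : nrm q < 1) (t_lt1 : nrm t < 1) (qt_generic : generic q t).
Hypotheses (mu_part : is_partition mu) (nu_part : is_partition nu).
Hypothesis size_mu_nu : (size mu + size nu <= N)%N.
Local Notation lam := (mubar N mu nu).
Local Notation M := (last_part lam).
Variable f : mpoly N C.
Hypothesis fm : is_macdonald q t (shifted_vec lam) f.
Local Notation T := (@on_torus R n).

Let t_neq0 : t != 0. Proof. by case: (generic_neq0 qt_generic). Qed.

Let r_neq0 : r != 0.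
Proof. by case: (generic_neq0 qt_generic); rewrite expf_eq0. Qed.

Let r_lt1 : nrm r < 1. Proof. by move: q_lt1; rewrite nrmX expr_lt1 // nrm_ge0. Qed.

Let p_lt1 : nrm p < 1. Proof. by rewrite nrmX expr_lt1 // nrm_ge0. Qed.

Let shiftedE (i : 'I_N) : (shifted_vec lam i)%:Z = tnth lam i - M.
Proof.
rewrite mnm_tnth tnth_mktuple gez0_abs // subr_ge0.
exact: last_mubar_le.
Qed.

Lemma doubled_args_neq0 (z : n.-tuple C) : T z -> forall k, doubled_args r z k != 0.
Proof.
move=> Tz k; rewrite doubled_argsE; apply: dilate_neq0 => // l.
by rewrite /doubled_coef; case: ifP; rewrite ?invr_eq0.
Qed.

(** The moduli [|r|] and [1/|r|] differ, so the parity of the index can be read off the argument. *)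
Lemma doubled_args_inj (z : n.-tuple C) : T z -> injective (tnth z) -> injective (doubled_args r z).
Proof.
move=> Tz zI k l; rewrite doubled_argsE /dilate => E.
have r1 : nrm r < nrm r^-1.
  rewrite nrmV (lt_trans r_lt1) // invf_gt1 ?r_lt1 // nrm_gt0 //.
have := congr1 (@nrm R) E; rewrite !nrmM !Tz !mulr1 /doubled_coef => E'.
have ekl : odd k = odd l.
  by move: E'; case: (odd k); case: (odd l) => // h; move: r1; rewrite h ltxx.
move: E; rewrite /doubled_coef ekl => /mulfI/zI h.
rewrite -(doubled_half k) -(doubled_half l) ekl h //.
by case: ifP; rewrite ?invr_eq0.
Qed.

Lemma twisted_integral_eq0 : mu <> nu ->
  torus_integral (fun z : n.-tuple C =>
    laurent (twist f M) (doubled_args r z) * macdonald_density p t z) = 0.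
Proof.
move=> munu; set J := torus_integral _; apply/eqP/negPn/negP => J0; apply: munu.
have [fs _ _ _] := fm.
have [q0 _] := generic_neq0 qt_generic.
have ss : laurent_symmetric (twist f M) by move=> g x; exact: twist_symmetric.
have adj g h : g \is @mpoly.symmetric N C -> h \is @mpoly.symmetric N C ->
    torus_product q t (macop q t g) h = torus_product q t g (macop q t h).
  exact: torus_product_macop.
have adjV g h : g \is @mpoly.symmetric N C -> h \is @mpoly.symmetric N C ->
    torus_product q t (macop q^-1 t^-1 g) h = torus_product q t g (macop q^-1 t^-1 h).
  exact: torus_product_macopV.
have fe := macdonald_eigen q_lt1 t_lt1 qt_generic fm adj.
have feV := macdonald_eigen q_lt1 t_lt1 qt_generic fm adjV.
set e := macdonald_eig q t _ in fe; set eV := macdonald_eig q^-1 t^-1 _ in feV.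
have sA : lapprox T (fun z : n.-tuple C => laurent (twist f M) (doubled_args r z) *
    macdonald_density p t z).
  apply: (lapproxM (@on_torus_bounded R n)); last exact: lapprox_density.
  apply: lapprox_eq (lapprox_laurent_dilate _ _ (@on_torus_bounded R n)) => z _.
  by rewrite doubled_argsE.
have sVA : lapprox T (fun z : n.-tuple C =>
    laurent (twist f M) (fun k => (doubled_args r z k)^-1) * macdonald_density p t z).
  apply: (lapproxM (@on_torus_bounded R n)); last exact: lapprox_density.
  have := lapprox_inv (lapprox_laurent_dilate (fun k => (doubled_coef r k)^-1) (twist f M)
    (@on_torus_bounded R n)); apply: lapprox_eq => z _.
  rewrite doubled_argsE; congr laurent; apply/funext => k.
  by rewrite /dilate tnth_mktuple invfM.
have qV0 : q^-1 != 0 by rewrite invr_eq0.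
have E1 : torus_integral (fun z => Dop q t (laurent (twist f M)) (doubled_args r z) *
    macdonald_density p t z) = q ^ M * e * J.
  apply: etrans (torus_integralZ _ sA); apply: eq_torus_integral => z Tz.
  rewrite [RHS]mulrA; apply: (density_injective t p_lt1 Tz) => zI.
  exact: (Dop_twist fs M q0 (doubled_args_neq0 Tz) (doubled_args_inj Tz zI) fe).
have E2 : torus_integral (fun z =>
    Dop q t (laurent [seq (c.1, - c.2) | c <- twist f M]) (doubled_args r z) *
    macdonald_density p t z) = t ^+ N.-1 * (q^-1 ^ M * eV) * J.
  have -> : J = torus_integral (fun z =>
      laurent (twist f M) (fun k => (doubled_args r z k)^-1) * macdonald_density p t z).
    exact: (doubled_integral_inv r_neq0 p_lt1 t_lt1 ss).
  apply: etrans (torus_integralZ _ sVA); apply: eq_torus_integral => z Tz.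
  rewrite [RHS]mulrA; apply: (density_injective t p_lt1 Tz) => zI.
  have x0 := doubled_args_neq0 Tz; have xI := doubled_args_inj Tz zI.
  have -> : laurent [seq (c.1, - c.2) | c <- twist f M] =
      fun x => laurent (twist f M) (fun k => (x k)^-1).
    by apply/funext => x; rewrite laurent_inv.
  rewrite (Dop_inverse q (laurent (twist f M)) t_neq0 x0 xI) -[RHS]mulrA; congr (_ * _).
  have x0' k : (doubled_args r z k)^-1 != 0 by rewrite invr_eq0.
  have xI' : injective (fun k => (doubled_args r z k)^-1) by move=> k l /invr_inj; exact: xI.
  exact: (Dop_twist fs M qV0 x0' xI' feV).
have := doubled_integral_Dop_inv r_neq0 p_lt1 t_neq0 t_lt1 ss.
rewrite E1 E2 => /(mulIf J0) {E1 E2} E.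
(* [B] bounds the absolute values of all entries: multiplying both eigenvalues by [q ^+ B] makes the
   exponents of [q] nonnegative, as [generic_sum_inj] requires. *)
pose B := (\sum_(i < N) `|tnth lam i|)%N.
have lamB i : `|tnth lam i| <= B%:Z.
  by rewrite -abszE lez_nat /B (bigD1 i) //= leq_addr.
(* The index is reversed in [b] because [t ^+ N.-1] times the powers of [t^-1] runs through the
   powers of [t] in the opposite order. *)
pose a (i : 'I_N) := absz (B%:Z + tnth lam i)%R; pose b (i : 'I_N) := absz (B%:Z - tnth lam (rev_ord i))%R.
have aE i : (a i)%:Z = B%:Z + tnth lam i.
  exact/gez0_abs/(proj1 (abs_le_shift (lamB i))).
have bE i : (b i)%:Z = B%:Z - tnth lam (rev_ord i).
  exact/gez0_abs/(proj2 (abs_le_shift (lamB (rev_ord i)))).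
have ab : a =1 b.
  apply: (generic_sum_inj qt_generic).
  transitivity (q ^ B%:Z * (q ^ M * e)).
    rewrite /e /macdonald_eig !mulr_sumr; apply: eq_bigr => i _.
    rewrite -[q ^+ a i]/(q ^ (a i)%:Z) -[q ^+ _]/(q ^ (shifted_vec lam i)%:Z).
    rewrite aE shiftedE.
    have arr (x1 x3 x4 x5 : C) : x3 * (x4 * (x1 * x5)) = x1 * (x3 * (x4 * x5)) by ring.
    by rewrite arr -(expfzDr _ _ q0) -(expfzDr _ _ q0) [M + _]addrC subrK.
  rewrite E /eV /macdonald_eig !mulr_sumr (reindex_inj rev_ord_inj) /=.
  apply: eq_bigr => i _.
  rewrite -[q ^+ b i]/(q ^ (b i)%:Z) -[q^-1 ^+ _]/(q^-1 ^ (shifted_vec lam (rev_ord i))%:Z).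
  rewrite bE shiftedE !exprz_inv.
  have -> : q ^ (B%:Z - tnth lam (rev_ord i)) =
      q ^ B%:Z * (q ^ (- M) * q ^ (- (tnth lam (rev_ord i) - M))).
    by rewrite -(expfzDr _ _ q0) -(expfzDr _ _ q0); congr (_ ^ _); ring.
  have -> : t ^+ (N - i.+1) = t ^+ N.-1 * t^-1 ^+ (N - (N - i.+1).+1).
    have [-> ->] := rev_exponents (ltn_ord i).
    by rewrite exprD exprVn mulfK // expf_neq0.
  have arr (x1 x2 x3 x4 x5 : C) : x1 * x2 * (x3 * (x4 * x5)) = x3 * (x1 * (x4 * (x2 * x5))).
    by ring.
  exact/esym/arr.
apply: (mubar_antisymmetric mu_part nu_part size_mu_nu) => i.
have := congr1 Posz (ab i); rewrite aE bE; exact: addrI.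
Qed.

End Vanishing.

(* r is the fixed fourth root of q, so that r ^+ 2 is the square root of q. *)
Theorem theorem4p6 (R : realType) (n : nat) (q t r : R[i]) (mu nu : seq nat)
    (F : ('I_(2 * n) -> R[i]) -> R[i])
    (n_ge1 : (1 <= n)%N)
    (q_lt1 : `|q| < 1) (t_lt1 : `|t| < 1) (qt_generic : generic q t)
    (rE : r ^+ 4 = q)
    (mu_part : is_partition mu) (nu_part : is_partition nu)
    (size_mu_nu : (size mu + size nu <= 2 * n)%N)
    (FP : is_laurent_macdonald q t (mubar (2 * n) mu nu) F) :
  mu <> nu ->
  torus_integral (fun z : n.-tuple R[i] =>
    F (doubled_args r z) * macdonald_density (r ^+ 2) t z) = 0.
Proof.
move=> munu; subst q; case: FP => f fm FE.
have r4_lt1 : nrm (r ^+ 4) < 1 by rewrite -ltcR -nrmE.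
have nrm_t_lt1 : nrm t < 1 by rewrite -ltcR -nrmE.
have := twisted_integral_eq0 r4_lt1 nrm_t_lt1 qt_generic mu_part nu_part size_mu_nu fm munu.
apply: etrans; apply: eq_torus_integral => z Tz; congr (_ * _).
have x0 := doubled_args_neq0 qt_generic Tz.
rewrite (FE _ x0); exact/esym/twistE.
Qed.
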